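(* Let $0<p<\infty$, $n$ a positive integer, $F\in H(\mathbb{D})$ with $I^nF\in A^p$, and $g_k\in\mathcal{B}^{0,n-k}$ for all $0\leq k\leq n-1$. Then there exists $A>0$, depending only on $p$, such that whenever $\|g_k\|_{0,n-k}<A$ for all $0\le k\le n-1$, every analytic solution $f$ on $\mathbb{D}$ of $$f^{(n)}+g_{n-1}(z)f^{(n-1)}+\cdots+g_0(z)f=F(z)$$ belongs to $A^p$. Furthermore, if $g_k\in\mathcal{B}_0^{0,n-k}$ for all $0\leq k\leq n-1$, then every such solution belongs to $A^p$ without any restriction on the norms $\|g_k\|_{0,n-k}$.
   Context: $\mathbb{D}$ is the open unit disc, $H(\mathbb{D})$ the analytic functions on $\mathbb{D}$, $dA=\frac{dx\,dy}{\pi}$, and $A^p=\{f\in H(\mathbb{D}):\int_{\mathbb{D}}|f|^p\,dA<\infty\}$. $I$ is the integration operator $(If)(z)=\int_0^zf(w)\,dw$ and $I^n$ its $n$-th iterate. For $\alpha>0$, $\mathcal{B}^{0,\alpha}=\{g\in H(\mathbb{D}):\|g\|_{0,\alpha}=\sup_{z\in\mathbb{D}}|g(z)|(1-|z|^2)^\alpha<\infty\}$ and $\mathcal{B}_0^{0,\alpha}=\{g\in H(\mathbb{D}):\lim_{|z|\to1^-}|g(z)|(1-|z|^2)^\alpha=0\}$. *)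

(* Defs.v *)
From mathcomp Require Import all_boot all_order all_algebra.
From mathcomp Require Import all_classical all_reals all_analysis.
Import Order.TTheory GRing.Theory Num.Theory.
From mathcomp Require Export complex.
Export ComplexField.
Export numFieldTopology.Exports numFieldNormedType.Exports.


Local Open Scope ring_scope.
Local Open Scope classical_set_scope.

Definition cfun (R : realType) := (R[i])^o -> (R[i])^o.

Definition cabs (R : realType) (z : R[i]) : R := Normc.normc z.

Definition disc (R : realType) : set R[i] := [set z | cabs R z < 1].

Definition analytic_on_disc (R : realType) (f : cfun R) : Prop :=
  forall z : (R[i])^o, z \in disc R -> derivable f z 1.

Definition cderiv (R : realType) (k : nat) (f : cfun R) : cfun R :=
  derive1n k (f : R[i] -> (R[i])^o).

Definition disc2 (R : realType) : set (R * R) :=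
  [set xy | cabs R (xy.1 +i* xy.2)%C < 1].

Definition Lp_integral (R : realType) (p : R) (f : cfun R) : \bar R :=
  ((pi^-1)%:E *
   \int[(@lebesgue_measure R \x @lebesgue_measure R)%E]_(xy in disc2 R)
      ((cabs R (f (xy.1 +i* xy.2)%C)) `^ p)%:E)%E.

Definition Bergman (R : realType) (p : R) (f : cfun R) : Prop :=
  analytic_on_disc R f /\ (Lp_integral R p f < +oo)%E.

(* integration operator (I F)(z) = int_0^z F(w) dw, along the segment [0,z]:
   int_0^1 F(t z) z dt, computed through real and imaginary parts *)
Definition Iop (R : realType) (F : cfun R) : cfun R := fun z =>
  ((\int[@lebesgue_measure R]_(t in `[0%R, 1%R]) Re (z * F ((t%:C)%C * z)))%R
   +i* (\int[@lebesgue_measure R]_(t in `[0%R, 1%R]) Im (z * F ((t%:C)%C * z)))%R)%C.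

Definition Iter_op (R : realType) (n : nat) (F : cfun R) : cfun R :=
  iter n (Iop R) F.

Definition bnorm (R : realType) (alpha : R) (g : cfun R) : \bar R :=
  ereal_sup [set ((cabs R (g z)) * (1 - cabs R z ^+ 2) `^ alpha)%:E | z in disc R].

Definition B0 (R : realType) (alpha : R) (g : cfun R) : Prop :=
  analytic_on_disc R g /\ (bnorm R alpha g < +oo)%E.

Definition B0_little (R : realType) (alpha : R) (g : cfun R) : Prop :=
  analytic_on_disc R g /\
  forall eps : R, 0 < eps -> exists r : R, r < 1 /\
    forall z : R[i], r < cabs R z -> cabs R z < 1 ->
      cabs R (g z) * (1 - cabs R z ^+ 2) `^ alpha < eps.

Definition solves_lde (R : realType) (n : nat) (g : nat -> cfun R)
    (F f : cfun R) : Prop :=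
  forall z : R[i], z \in disc R ->
    cderiv R n f z + \sum_(k < n) g k z * cderiv R k f z = F z.

(* Main.v *)
(* For r < 1 put t = r - |z|. There is a constant K depending only on p with
     int |f^(k)|^p t^(kp) <= K (int_{|z| < 3/4} |f^(k)|^p
                                + (k+1)^(-p) int |f^(k+1)|^p t^((k+1)p)),
   all integrals but the middle one being over |z| < r. Iterating j times down from
   the order n produces the factor K^j / (n(n-1)...(n-j+1))^p <= K^j / (j!)^p. The
   equation, together with |g_k| (1 - |z|^2)^(n-k) <= A near the circle, gives
     int |f^(n)|^p t^(np) <= const + 2^p A^p sum_j 2^(jp) int |f^(n-j)|^p t^((n-j)p),
   where the term with F is controlled by the reverse inequality applied to I^n F.
   Since sum_j 2^(jp) K^j / (j!)^p converges, a small A depending only on p allows the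
   sum to be absorbed by the (finite) left-hand side, and r tends to 1. A compact part
   of the disc only contributes to the constant, so for g_k in the little space the
   bound by A near the circle suffices.

   For p < 1 the sub-mean-value property of |f|^p comes from the one of |f| at a point
   where |f|^p times the squared distance to the boundary of a square is nearly
   maximal. Derivatives are controlled by Cauchy's formula on squares, which rests on
   Goursat's bisection. *)

Require Import Defs.
From HB Require Import structures.
From mathcomp Require Import all_boot all_order all_algebra.
From mathcomp Require Import all_classical all_reals all_analysis.
From mathcomp Require Import measurable_realfun.
From mathcomp Require Import ring lra.
Import Order.TTheory GRing.Theory Num.Theory.
Import complex.
Local Open Scope classical_set_scope.
Local Open Scope ring_scope.
Set Implicit Arguments.
Unset Strict Implicit.
Unset Printing Implicit Defensive.

(** * Complex derivatives and curve integrals *)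

Section ComplexBasics.
Context {R : realType}.
Local Notation C := R[i].
Local Notation nm := (cabs R).
Implicit Types (z w h l : C) (f g : C -> C).

(** The obstacle is that [A] must not depend on the order [n], so the weighted inequality needs a
    constant uniform in [k] and must still gain [(k + 1)^(-p)]. Both come from one choice of scale:
    [z] is compared with the point obtained by multiplying [t] by [1 + de], where [de] is of order
    [1 / (k + 1)]. Then [(1 + de)^(k p)] stays between constants independent of [k], while the
    increment of [f^(k)] is of order [de * t * |f^(k+1)|], which yields [de^p]. The comparison
    returns the left-hand integral with a factor below 1 by a margin independent of [k]: for [k = 0]
    the margin is due to the Jacobian of the contraction, for [k > 0] to the weight. The reverse
    inequality may have a constant that grows with [k], since it only enters the term with [F].
    Squares and rectangles replace discs and circles: the plane measure is a product, and Fubini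
    then selects good contours, while the radial contraction is handled in the coordinates
    [(x, y / x)] of lines through the origin. *)

Lemma nm0 : nm 0 = 0. Proof. exact: Normc.normc0. Qed.
Lemma nmM z w : nm (z * w) = nm z * nm w. Proof. exact: Normc.normcM. Qed.
Lemma nmV z : nm z^-1 = (nm z)^-1. Proof. exact: Normc.normcV. Qed.
Lemma nm_ge0 z : 0 <= nm z. Proof. by case: z => a b; exact: sqrtr_ge0. Qed.
Lemma nm_norm z : `|z| = (nm z)%:C%C. Proof. by []. Qed.
Lemma nmD z w : nm (z + w) <= nm z + nm w.
Proof. by rewrite -lecR rmorphD /= -!nm_norm ler_normD. Qed.
Lemma nmN z : nm (- z) = nm z.
Proof. by apply: complexI; rewrite -!nm_norm normrN. Qed.
Lemma nmB z w : nm (z - w) = nm (w - z).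
Proof. by rewrite -nmN opprB. Qed.
Lemma nm_eq0 z : (nm z == 0) = (z == 0).
Proof. by apply/eqP/eqP => [/Normc.eq0_normc //|->]; exact: nm0. Qed.
Lemma nm_gt0 z : (0 < nm z) = (z != 0).
Proof. by rewrite lt_neqAle nm_ge0 andbT eq_sym nm_eq0. Qed.
Lemma nm_real (x : R) : nm (x%:C)%C = `|x|.
Proof. by rewrite /cabs /= expr0n /= addr0 sqrtr_sqr. Qed.
Lemma nm_i : nm 'i%C = 1.
Proof. by rewrite /cabs /= expr0n expr1n add0r sqrtr1. Qed.
Lemma Re_le_nm z : `|Re z| <= nm z.
Proof.
case: z => a b /=; rewrite -sqrtr_sqr ler_wsqrtr // lerDl; exact: sqr_ge0.
Qed.
Lemma Im_le_nm z : `|Im z| <= nm z.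
Proof.
case: z => a b /=; rewrite -sqrtr_sqr ler_wsqrtr // lerDr; exact: sqr_ge0.
Qed.
Lemma complex_split z : z = ((Re z)%:C + 'i * (Im z)%:C)%C.
Proof. exact: complexE. Qed.
Lemma nm_le_ReIm z : nm z <= `|Re z| + `|Im z|.
Proof.
rewrite {1}(complex_split z); apply: (le_trans (nmD _ _)).
by rewrite nmM nm_i mul1r !nm_real.
Qed.
Lemma nm_subl z w : nm z - nm w <= nm (z - w).
Proof. by rewrite lerBlDr; rewrite -{1}(subrK w z) nmD. Qed.
Lemma nmX z n : nm (z ^+ n) = nm z ^+ n.
Proof.
elim: n => [|n IH]; first by rewrite !expr0; exact: Normc.normc1.
by rewrite !exprS nmM IH.
Qed.

(** Complex differentiability with the difference quotient cleared of its denominator, so that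
    [h = 0] is no exception and all errors are real numbers. *)
Definition cdiff f z l := forall e, 0 < e -> exists2 d, 0 < d &
  forall h, nm h < d -> nm (f (z + h) - f z - h * l) <= e * nm h.

Lemma cdiff_uniq f z l l' : cdiff f z l -> cdiff f z l' -> l = l'.
Proof.
move=> H1 H2; apply/eqP; rewrite -subr_eq0 -nm_eq0 eq_le nm_ge0 andbT.
apply/ler_addgt0Pl => e e0; rewrite addr0.
have e20 : 0 < e / 2 by rewrite divr_gt0.
have [d1 d10 h1] := H1 _ e20; have [d2 d20 h2] := H2 _ e20.
pose d := Num.min d1 d2 / 2.
have d0 : 0 < d by rewrite divr_gt0 // lt_min d10.
have nd : nm (d%:C)%C = d by rewrite nm_real gtr0_norm.
have [dd1 dd2] : d < d1 /\ d < d2.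
  have : Num.min d1 d2 <= d1 by rewrite ge_min lexx.
  have : Num.min d1 d2 <= d2 by rewrite ge_min lexx orbT.
  by move: d0; rewrite /d; lra.
have := h1 (d%:C)%C; rewrite nd => /(_ dd1) k1.
have := h2 (d%:C)%C; rewrite nd => /(_ dd2) k2.
have : nm ((d%:C)%C * (l - l')) <= e * d.
  rewrite -(_ : (f (z + (d%:C)%C) - f z - (d%:C)%C * l') -
    (f (z + (d%:C)%C) - f z - (d%:C)%C * l) = (d%:C)%C * (l - l')); last by ring.
  by apply: (le_trans (nmD _ _)); rewrite nmN; lra.
by rewrite nmM nd mulrC ler_pM2r.
Qed.

(** Radii of balls in [C^o] are elements of [R[i]]; positivity forces a zero imaginary part, so real
    radii suffice. *)
Lemma nbhs0_nmP (P : C -> Prop) :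
  (\forall h \near (0 : C^o)^', P h) <->
  exists2 d : R, 0 < d & forall h, h != 0 -> nm h < d -> P h.
Proof.
split.
  rewrite /dnbhs /within /= -nbhs_ballE => -[/= e e0 H].
  move: e0; rewrite ltcE /= => /andP[/eqP ei er].
  have ee : e = ((Re e)%:C)%C by case: (e) ei => a b /= ->.
  exists (Re e) => // h h0 hd; apply: H => //.
  by rewrite -ball_normE /= sub0r normrN nm_norm ee ltcR.
move=> [d d0 H]; rewrite /dnbhs /within /= -nbhs_ballE; exists (d%:C)%C => /=.
  by rewrite ltcR.
move=> h; rewrite -ball_normE /= sub0r normrN nm_norm ltcR => hd h0.
exact: H.
Qed.

Lemma cvg0_nmP (q : C -> C^o) (l : C^o) :
  q @ (0 : C^o)^' --> l <->
  forall e : R, 0 < e -> exists2 d : R, 0 < d &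
   forall h, h != 0 -> nm h < d -> nm (q h - l) <= e.
Proof.
split.
  move=> H e e0.
  have /nbhs0_nmP[d d0 Hd] : \forall h \near (0 : C^o)^', `|l - q h| < (e%:C)%C.
    by move/cvgrPdist_lt : H; apply; rewrite ltcR.
  exists d => // h h0 hd; have := Hd _ h0 hd; rewrite nm_norm ltcR nmB.
  exact: ltW.
move=> H; apply/cvgrPdist_le => /= e e0; apply/nbhs0_nmP.
move: e0; rewrite ltcE /= => /andP[/eqP ei er].
have ee : e = ((Re e)%:C)%C by case: (e) ei => a b /= ->.
have [d d0 Hd] := H _ er; exists d => // h h0 hd.
by rewrite nm_norm ee lecR nmB; exact: Hd.
Qed.

Lemma cdiffP (f : cfun R) z l : cdiff f z l <->
  (fun h : C => h^-1 *: (f (h + z) - f z)) @ (0 : C^o)^' --> (l : C^o).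
Proof.
have key h : h != 0 -> nm (h^-1 *: (f (h + z) - f z) - l) =
    nm (f (z + h) - f z - h * l) / nm h.
  move=> h0; rewrite -nmV -nmM [in RHS]mulrC mulrBr mulKf // (addrC z h) //.
rewrite cvg0_nmP; split=> H e e0; have [d d0 Hd] := H e e0; exists d => // h.
- by move=> h0 hd; rewrite key // ler_pdivrMr ?nm_gt0 // Hd.
- have [->|h0] := eqVneq h 0.
    by rewrite addr0 subrr mul0r subr0 nm0 mulr0.
  by move=> hd; have := Hd _ h0 hd; rewrite key // ler_pdivrMr ?nm_gt0.
Qed.

Lemma derivable_cdiff (f : cfun R) z : derivable f z 1 -> cdiff f z (derive1 f z).
Proof.
rewrite /derivable => H; apply/cdiffP.
rewrite /derive1; move: H.
rewrite (_ : (fun h => _) = (fun h : C => h^-1 *: (f (h + z) - f z))).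
  by move=> H; exact: H.
by apply/funext => h /=; rewrite [h *: 1]mulr1.
Qed.

Lemma cdiff_derivable (f : cfun R) z l : cdiff f z l ->
  derivable f z 1 /\ derive1 f z = l.
Proof.
move=> /cdiffP H; split; last by apply: cvg_lim H.
rewrite /derivable (_ : (fun h => _) = (fun h : C => h^-1 *: (f (h + z) - f z))).
  by apply/cvg_ex; exists l.
by apply/funext => h /=; rewrite [h *: 1]mulr1.
Qed.

End ComplexBasics.

(** * Continuous curves and their complex integrals *)

Section CurveIntegral.
Context {R : realType}.
Local Notation C := R[i].
Local Notation nm := (cabs R).
Local Notation mu := (@lebesgue_measure R).
Implicit Types (z w : C) (g h : R -> C) (a b t : R).

Definition ccont g t := forall e, 0 < e -> exists2 d, 0 < d &
  forall s, `|s - t| < d -> nm (g s - g t) <= e.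

Lemma Re_add z w : Re (z + w) = Re z + Re w. Proof. by case: z; case: w. Qed.
Lemma Im_add z w : Im (z + w) = Im z + Im w. Proof. by case: z; case: w. Qed.
Lemma Re_opp z : Re (- z) = - Re z. Proof. by case: z. Qed.
Lemma Im_opp z : Im (- z) = - Im z. Proof. by case: z. Qed.
Lemma Re_mul z w : Re (z * w) = Re z * Re w - Im z * Im w.
Proof. by case: z; case: w. Qed.
Lemma Im_mul z w : Im (z * w) = Re z * Im w + Im z * Re w.
Proof. by case: z; case: w. Qed.

Lemma cont_distP (u : R -> R) t : {for t, continuous u} <->
  forall e, 0 < e -> exists2 d, 0 < d & forall s, `|s - t| < d -> `|u s - u t| <= e.
Proof.
split=> [/cvgrPdist_le H e e0|H].
  have /nbhs_ballP[d /= d0 Hd] := H e e0; exists d => // s hs.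
  by rewrite distrC; apply: Hd; rewrite /ball /= distrC.
apply/cvgrPdist_le => e e0; have [d d0 Hd] := H e e0.
apply/nbhs_ballP; exists d => //= s; rewrite /ball /= distrC => hs.
by rewrite distrC; exact: Hd.
Qed.

Lemma ccontP g t : ccont g t <->
  {for t, continuous (@Re R \o g)} /\ {for t, continuous (@Im R \o g)}.
Proof.
rewrite !cont_distP; split.
  move=> H; split=> e e0; have [d d0 Hd] := H e e0; exists d => // s /Hd hs /=;
    apply: le_trans hs.
    by rewrite -Re_opp -Re_add; exact: Re_le_nm.
  by rewrite -Im_opp -Im_add; exact: Im_le_nm.
move=> [H1 H2] e e0; have e20 : 0 < e / 2 by rewrite divr_gt0.
have [d1 d10 h1] := H1 _ e20; have [d2 d20 h2] := H2 _ e20.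
exists (Num.min d1 d2); first by rewrite lt_min d10.
move=> s; rewrite lt_min => /andP[/h1 k1 /h2 k2].
apply: (le_trans (nm_le_ReIm _)); rewrite Re_add Im_add Re_opp Im_opp.
by move: k1 k2 => /=; lra.
Qed.

Lemma ccontD g h t : ccont g t -> ccont h t -> ccont (fun s => g s + h s) t.
Proof.
move=> /ccontP[g1 g2] /ccontP[h1 h2]; apply/ccontP; split.
  by rewrite [_ \o _](_ : _ = (fun s => (@Re R \o g) s + (@Re R \o h) s));
    [exact: cvgD|apply/funext => s /=; rewrite Re_add].
by rewrite [_ \o _](_ : _ = (fun s => (@Im R \o g) s + (@Im R \o h) s));
    [exact: cvgD|apply/funext => s /=; rewrite Im_add].
Qed.

Lemma ccontM g h t : ccont g t -> ccont h t -> ccont (fun s => g s * h s) t.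
Proof.
move=> /ccontP[g1 g2] /ccontP[h1 h2]; apply/ccontP; split.
  rewrite [_ \o _](_ : _ = (fun s => (@Re R \o g) s * (@Re R \o h) s -
     (@Im R \o g) s * (@Im R \o h) s)); last by apply/funext => s /=; rewrite Re_mul.
  by apply: cvgB; apply: cvgM.
rewrite [_ \o _](_ : _ = (fun s => (@Re R \o g) s * (@Im R \o h) s +
     (@Im R \o g) s * (@Re R \o h) s)); last by apply/funext => s /=; rewrite Im_mul.
by apply: cvgD; apply: cvgM.
Qed.

Lemma ccont_cst z t : ccont (fun=> z) t.
Proof. by move=> e e0; exists 1 => // s _; rewrite subrr nm0 ltW. Qed.

Lemma ccontN g t : ccont g t -> ccont (fun s => - g s) t.
Proof.
move=> H e e0; have [d d0 Hd] := H e e0; exists d => // s /Hd.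
by rewrite -opprD nmN.
Qed.

Lemma ccontB g h t : ccont g t -> ccont h t -> ccont (fun s => g s - h s) t.
Proof. by move=> H1 /ccontN; exact: ccontD. Qed.

Lemma ccont_lip M g t : (forall s, nm (g s - g t) <= M * `|s - t|) -> ccont g t.
Proof.
move=> H e e0; have M0 : 0 < `|M| + 1 by rewrite ltr_wpDl.
exists (e / (`|M| + 1)); first by rewrite divr_gt0.
move=> s; rewrite ltr_pdivlMr // => hs; apply: (le_trans (H s)).
apply: le_trans (ltW hs); rewrite mulrC ler_wpM2l // .
by apply: (le_trans (ler_norm M)); rewrite lerDl.
Qed.

Lemma ccont_real t : ccont (fun s => s%:C)%C t.
Proof.
apply: (@ccont_lip 1) => s; rewrite mul1r -nm_real rmorphB //.
Qed.

Definition cont_at (f : C -> C) z := forall e, 0 < e -> exists2 d, 0 < d &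
  forall w, nm (w - z) < d -> nm (f w - f z) <= e.

Lemma cdiff_cont_at f z l : cdiff f z l -> cont_at f z.
Proof.
move=> H e e0; have [d d0 Hd] := H 1 ltr01.
have M0 : 0 < 1 + nm l by rewrite ltr_pwDl // nm_ge0.
exists (Num.min d (e / (1 + nm l))).
  by rewrite lt_min d0 divr_gt0.
move=> w; rewrite lt_min => /andP[/Hd]; rewrite ltr_pdivlMr // => k1 k2.
have -> : f w - f z = (f (z + (w - z)) - f z - (w - z) * l) + (w - z) * l.
  by rewrite [z + _]addrC !subrK.
apply: (le_trans (nmD _ _)); apply: le_trans (ltW k2); rewrite mulrDr mulr1.
by rewrite lerD // ?nmM //; move: k1; rewrite mul1r.
Qed.

Lemma ccont_comp f g t : cont_at f (g t) -> ccont g t -> ccont (fun s => f (g s)) t.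
Proof.
move=> Hf Hg e e0; have [d d0 Hd] := Hf e e0.
have d20 : 0 < d / 2 by rewrite divr_gt0.
have [k k0 Hk] := Hg _ d20; exists k => // s /Hk hs; apply: Hd.
by apply: (le_lt_trans hs); lra.
Qed.

Lemma ccont_nm g t : ccont g t -> {for t, continuous (fun s => nm (g s))}.
Proof.
move=> H; apply/cont_distP => e e0; have [d d0 Hd] := H e e0; exists d => // s /Hd.
apply: le_trans; rewrite ler_norml; apply/andP; split.
  by rewrite lerNl opprB (le_trans (nm_subl _ _)) // nmB.
exact: nm_subl.
Qed.

(** Written componentwise exactly as in [Iop], so that [Iop] is a [cint] by conversion. *)
Definition cint a b g : C :=
  ((\int[mu]_(t in `[a, b]) Re (g t))%R +i* (\int[mu]_(t in `[a, b]) Im (g t))%R)%C.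

Definition ccontI a b g := forall t, a <= t <= b -> ccont g t.

Lemma segment_integrable (u : R -> R) a b :
  (forall t, a <= t <= b -> {for t, continuous u}) ->
  mu.-integrable `[a, b] (EFin \o u).
Proof.
move=> H; apply: continuous_compact_integrable; first exact: segment_compact.
apply: continuous_in_subspaceT => x; rewrite inE /= in_itv /= => hx; exact: H.
Qed.

Lemma ccontI_Re a b g : ccontI a b g ->
  mu.-integrable `[a, b] (EFin \o (fun t => Re (g t))).
Proof. by move=> H; apply: segment_integrable => t /H/ccontP[]. Qed.
Lemma ccontI_Im a b g : ccontI a b g ->
  mu.-integrable `[a, b] (EFin \o (fun t => Im (g t))).
Proof. by move=> H; apply: segment_integrable => t /H/ccontP[]. Qed.

Lemma eq_cint a b g h : (forall t, a <= t <= b -> g t = h t) ->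
  cint a b g = cint a b h.
Proof.
by move=> H; congr (_ +i* _)%C; apply: eq_Rintegral => t; rewrite inE /= in_itv /= => /H ->.
Qed.

Lemma cintD a b g h : ccontI a b g -> ccontI a b h ->
  cint a b (fun t => g t + h t) = cint a b g + cint a b h.
Proof.
move=> Hg Hh; apply/eqP; rewrite eq_complex /=; apply/andP; split; apply/eqP.
  rewrite -RintegralD //; try exact: ccontI_Re.
  by apply: eq_Rintegral => t _; rewrite Re_add.
rewrite -RintegralD //; try exact: ccontI_Im.
by apply: eq_Rintegral => t _; rewrite Im_add.
Qed.

Lemma cintZ a b z g : ccontI a b g -> cint a b (fun t => z * g t) = z * cint a b g.
Proof.
move=> Hg.
have iR := ccontI_Re Hg; have iI := ccontI_Im Hg.
have sc (x : R) (u : R -> R) : mu.-integrable `[a, b] (EFin \o u) ->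
   mu.-integrable `[a, b] (EFin \o (fun t => x * u t)).
  move=> iu; rewrite [X in _.-integrable _ X](_ : _ = (fun t => (x%:E * (EFin \o u) t)%E)) //.
  exact: integrableZl.
apply/eqP; rewrite eq_complex Re_mul Im_mul; apply/andP; split; apply/eqP => /=.
  rewrite -!RintegralZl // -RintegralB //; try exact: sc.
  by apply: eq_Rintegral => t _; rewrite Re_mul.
rewrite -!RintegralZl // -RintegralD //; try exact: sc.
by apply: eq_Rintegral => t _; rewrite Im_mul.
Qed.

Lemma cintN a b g : ccontI a b g -> cint a b (fun t => - g t) = - cint a b g.
Proof.
move=> Hg; rewrite -mulN1r -cintZ //; apply: eq_cint => t _; by rewrite mulN1r.
Qed.

Lemma cintB a b g h : ccontI a b g -> ccontI a b h ->
  cint a b (fun t => g t - h t) = cint a b g - cint a b h.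
Proof.
move=> Hg Hh; rewrite cintD ?cintN // => t /Hh; exact: ccontN.
Qed.

Lemma segment_length a b : a <= b -> fine (mu `[a, b]) = b - a.
Proof.
move=> ab; rewrite lebesgue_measure_itv /= lte_fin.
have [//|ba] := ltP a b; have -> : a = b by apply/eqP; rewrite eq_le ab.
by rewrite subrr.
Qed.

Lemma cint_cst a b z : a <= b -> cint a b (fun=> z) = (b - a)%:C%C * z.
Proof.
move=> ab; rewrite /cint !Rintegral_cst // segment_length //.
by case: z => x y /=; apply/eqP; rewrite eq_complex /=; apply/andP; split; apply/eqP; ring.
Qed.

Lemma cint_split a c b g : a <= c <= b -> ccontI a b g ->
  cint a b g = cint a c g + cint c b g.
Proof.
move=> /andP[ac cb] H.
have s (u : R -> R) : mu.-integrable `[a, b] (EFin \o u) ->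
    \int[mu]_(t in `[a, b]) u t = \int[mu]_(t in `[a, c]) u t + \int[mu]_(t in `[c, b]) u t.
  move=> iu; apply/eqP; rewrite addrC -subr_eq Rintegral_itvB ?bnd_simp //.
  apply/eqP/Rintegral_itv_obnd_cbnd; apply: integrableS iu => //.
  by apply: subset_itvr; rewrite bnd_simp.
by apply/eqP; rewrite eq_complex /=; apply/andP; split; apply/eqP; apply: s;
  [exact: ccontI_Re|exact: ccontI_Im].
Qed.

Lemma nm_integrable a b g : ccontI a b g ->
  mu.-integrable `[a, b] (EFin \o (fun t => nm (g t))).
Proof. by move=> H; apply: segment_integrable => t /H/ccont_nm. Qed.

(** Rotation: a unimodular [u] makes [u * cint a b g] real and nonnegative, so the modulus is the
    integral of [Re (u * g t)], and this real part is at most [nm (g t)]. *)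
Lemma nm_cint_le a b g : ccontI a b g ->
  nm (cint a b g) <= \int[mu]_(t in `[a, b]) nm (g t).
Proof.
move=> H; have [->|c0] := eqVneq (cint a b g) 0.
  by rewrite nm0; apply: Rintegral_ge0 => t _; exact: nm_ge0.
pose u : C := ((nm (cint a b g))%:C)%C / cint a b g.
have nu : nm u = 1.
  by rewrite nmM nmV nm_real ger0_norm ?nm_ge0 // divff // nm_eq0.
have -> : nm (cint a b g) = Re (u * cint a b g) by rewrite divfK.
rewrite -cintZ //= ; apply: le_Rintegral => //.
- by apply: ccontI_Re => t /H; apply: ccontM; exact: ccont_cst.
- exact: nm_integrable.
- move=> t _; apply: (le_trans (ler_norm _)); apply: (le_trans (Re_le_nm _)).
  by rewrite nmM nu mul1r.
Qed.

Lemma nm_cint_bound a b M g : a <= b -> ccontI a b g ->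
  (forall t, a <= t <= b -> nm (g t) <= M) -> nm (cint a b g) <= M * (b - a).
Proof.
move=> ab H HM; apply: (le_trans (nm_cint_le H)).
rewrite -segment_length // -Rintegral_cst //; apply: le_Rintegral => //.
- exact: nm_integrable.
- by apply: segment_integrable => t _; exact: cvg_cst.
Qed.

End CurveIntegral.

(** * Cauchy's theorem on rectangles *)

Section Goursat.
Context {R : realType}.
Local Notation C := R[i].
Local Notation nm := (cabs R).
Implicit Types (f g : C -> C) (a b c d x y : R).

Definition hsegint f a b y : C := cint a b (fun x => f (x +i* y)%C).
Definition vsegint f x c d : C := cint c d (fun y => f (x +i* y)%C).
(** Counterclockwise: bottom, right, minus top, minus left; on vertical sides [dz] is [i dy]. *)
Definition oint f a b c d : C :=
  hsegint f a b c + 'i%C * vsegint f b c d - hsegint f a b d - 'i%C * vsegint f a c d.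

Definition cont_rect f a b c d :=
  forall x y, a <= x <= b -> c <= y <= d -> cont_at f (x +i* y)%C.

Lemma nm_hshift (x s y : R) : nm ((s +i* y)%C - (x +i* y)%C) = `|s - x|.
Proof.
by rewrite -nm_real; congr nm; apply/eqP; rewrite eq_complex /= subrr !eqxx.
Qed.
Lemma nm_vshift (x s y : R) : nm ((x +i* s)%C - (x +i* y)%C) = `|s - y|.
Proof.
rewrite -[RHS]mul1r -nm_real -nm_i -nmM; congr nm; apply/eqP.
by rewrite eq_complex /=; apply/andP; split; apply/eqP; ring.
Qed.

Lemma ccont_hline f x y : cont_at f (x +i* y)%C -> ccont (fun s => f (s +i* y)%C) x.
Proof.
move=> H; apply: (ccont_comp (g := fun s => (s +i* y)%C)) => //.
by apply: (@ccont_lip _ 1) => s; rewrite nm_hshift mul1r.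
Qed.
Lemma ccont_vline f x y : cont_at f (x +i* y)%C -> ccont (fun s => f (x +i* s)%C) y.
Proof.
move=> H; apply: (ccont_comp (g := fun s => (x +i* s)%C)) => //.
by apply: (@ccont_lip _ 1) => s; rewrite nm_vshift mul1r.
Qed.

Lemma cont_rect_h f a b c d y : cont_rect f a b c d -> c <= y <= d ->
  ccontI a b (fun x => f (x +i* y)%C).
Proof. by move=> H hy x hx; apply: ccont_hline; exact: H. Qed.
Lemma cont_rect_v f a b c d x : cont_rect f a b c d -> a <= x <= b ->
  ccontI c d (fun y => f (x +i* y)%C).
Proof. by move=> H hx y hy; apply: ccont_vline; exact: H. Qed.

Lemma cont_rectS f a b c d a' b' c' d' : cont_rect f a b c d ->
  a <= a' -> b' <= b -> c <= c' -> d' <= d -> cont_rect f a' b' c' d'.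
Proof. by move=> H h1 h2 h3 h4 x y hx hy; apply: H; lra. Qed.

Definition bdry a b c d x y :=
  (a <= x <= b /\ (y = c \/ y = d)) \/ (c <= y <= d /\ (x = a \/ x = b)).

(** Continuity is asked on the boundary alone because Cauchy kernels have their pole inside the
    rectangle. *)
Definition cont_bdry f a b c d :=
  forall x y, bdry a b c d x y -> cont_at f (x +i* y)%C.

Lemma bdry_rect a b c d x y : a <= b -> c <= d -> bdry a b c d x y ->
  a <= x <= b /\ c <= y <= d.
Proof. by move=> ab cd [[? [->|->]]|[? [->|->]]]; split; lra. Qed.

Lemma cont_rect_bdry f a b c d : a <= b -> c <= d ->
  cont_rect f a b c d -> cont_bdry f a b c d.
Proof. by move=> ab cd H x y /bdry_rect[]//; exact: H. Qed.

Lemma cont_bdry_h f a b c d y : cont_bdry f a b c d -> y = c \/ y = d ->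
  ccontI a b (fun x => f (x +i* y)%C).
Proof. by move=> H hy x hx; apply: ccont_hline; apply: H; left. Qed.
Lemma cont_bdry_v f a b c d x : cont_bdry f a b c d -> x = a \/ x = b ->
  ccontI c d (fun y => f (x +i* y)%C).
Proof. by move=> H hx y hy; apply: ccont_vline; apply: H; right. Qed.

Lemma oint_vsplit f a m b c d : a <= m <= b ->
  cont_bdry f a m c d -> cont_bdry f m b c d ->
  oint f a b c d = oint f a m c d + oint f m b c d.
Proof.
move=> mab H1 H2.
have h y : y = c \/ y = d -> hsegint f a b y = hsegint f a m y + hsegint f m b y.
  move=> hy; apply: cint_split => // x /andP[ax xb].
  have [xm|/ltW mx] := leP x m.
    by apply: cont_bdry_h H1 hy _ _; rewrite ax.
  by apply: cont_bdry_h H2 hy _ _; rewrite mx.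
by rewrite /oint (h c) ?(h d); [ring|right|left].
Qed.

Lemma oint_hsplit f a b c m d : c <= m <= d ->
  cont_bdry f a b c m -> cont_bdry f a b m d ->
  oint f a b c d = oint f a b c m + oint f a b m d.
Proof.
move=> mab H1 H2.
have v x : x = a \/ x = b -> vsegint f x c d = vsegint f x c m + vsegint f x m d.
  move=> hx; apply: cint_split => // y /andP[ax xb].
  have [xm|/ltW mx] := leP y m.
    by apply: cont_bdry_v H1 hx _ _; rewrite ax.
  by apply: cont_bdry_v H2 hx _ _; rewrite mx.
by rewrite /oint (v a) ?(v b); [ring|right|left].
Qed.

Lemma ointZ (k : C) f a b c d : cont_bdry f a b c d ->
  oint (fun z => k * f z) a b c d = k * oint f a b c d.
Proof.
move=> Hf; rewrite /oint /hsegint /vsegint !cintZ; first ring.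
all: first [apply: cont_bdry_h; [eassumption|by [left|right]]
           |apply: cont_bdry_v; [eassumption|by [left|right]]].
Qed.

Lemma ointB f g a b c d : cont_bdry f a b c d -> cont_bdry g a b c d ->
  oint (fun z => f z - g z) a b c d = oint f a b c d - oint g a b c d.
Proof.
move=> Hf Hg; rewrite /oint /hsegint /vsegint !cintB; first ring.
all: first [apply: cont_bdry_h; [eassumption|by [left|right]]
           |apply: cont_bdry_v; [eassumption|by [left|right]]].
Qed.

Lemma nm_oint_le f a b c d : cont_bdry f a b c d ->
  nm (oint f a b c d) <= nm (hsegint f a b c) + nm (vsegint f b c d) +
    nm (hsegint f a b d) + nm (vsegint f a c d).
Proof.
move=> H; have i v : nm ('i%C * v : C) = nm v by rewrite nmM nm_i mul1r.
have t1 := nmD (hsegint f a b c + 'i%C * vsegint f b c d - hsegint f a b d)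
  (- ('i%C * vsegint f a c d)).
have t2 := nmD (hsegint f a b c + 'i%C * vsegint f b c d) (- hsegint f a b d).
have t3 := nmD (hsegint f a b c) ('i%C * vsegint f b c d).
by move: t1 t2 t3; rewrite /oint !nmN !i; lra.
Qed.

Lemma nm_oint_bound f a b c d M : a <= b -> c <= d -> cont_bdry f a b c d ->
  (forall x y, bdry a b c d x y -> nm (f (x +i* y)%C) <= M) ->
  nm (oint f a b c d) <= M * (2 * ((b - a) + (d - c))).
Proof.
move=> ab cd H HM.
have h y : y = c \/ y = d -> nm (hsegint f a b y) <= M * (b - a).
  move=> hy; apply: nm_cint_bound => //; first exact: (cont_bdry_h H).
  by move=> x hx; apply: HM; left.
have v x : x = a \/ x = b -> nm (vsegint f x c d) <= M * (d - c).
  move=> hx; apply: nm_cint_bound => //; first exact: (cont_bdry_v H).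
  by move=> y hy; apply: HM; right.
have := h c (or_introl erefl); have := h d (or_intror erefl).
have := v a (or_introl erefl); have := v b (or_intror erefl).
by have := nm_oint_le H; lra.
Qed.

Lemma cont_at_id (z : C) : cont_at id z.
Proof. by move=> e e0; exists e => // w /ltW. Qed.

Lemma cont_at_affine (k l z : C) : cont_at (fun z => k + z * l) z.
Proof.
move=> e e0; have M0 : 0 < nm l + 1 by rewrite ltr_wpDl ?nm_ge0.
exists (e / (nm l + 1)); first by rewrite divr_gt0.
move=> w; rewrite ltr_pdivlMr // => h.
rewrite opprD addrACA subrr add0r -mulrBl nmM; apply: le_trans (ltW h).
by rewrite ler_wpM2l ?nm_ge0 // lerDl.
Qed.

Lemma cont_atB f g (z : C) : cont_at f z -> cont_at g z ->
  cont_at (fun z => f z - g z) z.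
Proof.
move=> Hf Hg e e0; have e20 : 0 < e / 2 by rewrite divr_gt0.
have [d1 d10 h1] := Hf _ e20; have [d2 d20 h2] := Hg _ e20.
exists (Num.min d1 d2); first by rewrite lt_min d10.
move=> w; rewrite lt_min => /andP[/h1 k1 /h2 k2].
have -> : f w - g w - (f z - g z) = (f w - f z) - (g w - g z) by ring.
by apply: (le_trans (nmD _ _)); rewrite nmN; lra.
Qed.

(** Opposite sides are paired: there the integrands differ by a constant, and the two contributions
    [i (c - d) (b - a) l] and [i (b - a) (d - c) l] cancel. *)
Lemma oint_affine (k l : C) a b c d : a <= b -> c <= d ->
  oint (fun z => k + z * l) a b c d = 0.
Proof.
move=> ab cd.
have H : cont_rect (fun z => k + z * l) a b c d.
  by move=> x y _ _; exact: cont_at_affine.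
have -> : oint (fun z => k + z * l) a b c d =
   (hsegint (fun z => k + z * l) a b c - hsegint (fun z => k + z * l) a b d) +
   'i%C * (vsegint (fun z => k + z * l) b c d - vsegint (fun z => k + z * l) a c d).
  by rewrite /oint; ring.
rewrite -cintB; [|by apply: cont_rect_h H _; lra|by apply: cont_rect_h H _; lra].
rewrite -cintB; [|by apply: cont_rect_v H _; lra|by apply: cont_rect_v H _; lra].
rewrite (@eq_cint _ _ _ _ (fun=> 'i%C * (c - d)%:C%C * l)); last first.
  move=> x _; rewrite opprD addrACA subrr add0r -mulrBl; congr (_ * _).
  by apply/eqP; rewrite eq_complex /=; apply/andP; split; apply/eqP; ring.
rewrite cint_cst // (@eq_cint _ _ _ _ (fun=> (b - a)%:C%C * l)); last first.
  move=> x _; rewrite opprD addrACA subrr add0r -mulrBl; congr (_ * _).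
  by apply/eqP; rewrite eq_complex /=; apply/andP; split; apply/eqP; ring.
rewrite cint_cst // (_ : (c - d)%:C%C = - (d - c)%:C%C); last first.
  by rewrite -rmorphN opprB.
ring.
Qed.

Definition holo_rect f a b c d :=
  forall x y, a <= x <= b -> c <= y <= d -> exists l, cdiff f (x +i* y)%C l.

Lemma holo_cont f a b c d : holo_rect f a b c d -> cont_rect f a b c d.
Proof. by move=> H x y hx hy; have [l] := H x y hx hy; exact: cdiff_cont_at. Qed.

(** The threshold is quadratic in the size, hence divided by exactly 4 under bisection of both
    sides: one of the four quarters stays bad with the same [e]. *)
Definition bad f e a b c d := e * ((b - a) + (d - c)) ^+ 2 < nm (oint f a b c d).

Lemma bad_quarter f e a b c d : a <= b -> c <= d -> cont_rect f a b c d ->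
  bad f e a b c d -> exists a' c', [/\ a <= a' <= a + (b - a) / 2,
    c <= c' <= c + (d - c) / 2 & bad f e a' (a' + (b - a) / 2) c' (c' + (d - c) / 2)].
Proof.
move=> ab cd H B.
pose w := (b - a) / 2; pose h := (d - c) / 2.
have Ew : b = a + w + w by rewrite /w; field.
have Eh : d = c + h + h by rewrite /h; field.
have w0 : 0 <= w by rewrite divr_ge0 // subr_ge0.
have h0 : 0 <= h by rewrite divr_ge0 // subr_ge0.
rewrite -/w -/h.
have S : oint f a b c d = (oint f a (a + w) c (c + h) + oint f a (a + w) (c + h) d)
   + (oint f (a + w) b c (c + h) + oint f (a + w) b (c + h) d).
  have K a' b' c' d' : a <= a' -> a' <= b' -> b' <= b -> c <= c' -> c' <= d' -> d' <= d ->
      cont_bdry f a' b' c' d'.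
    by move=> *; apply: cont_rect_bdry => //; apply: cont_rectS H _ _ _ _.
  rewrite (oint_vsplit (m := a + w)); [|lra|apply: K; lra|apply: K; lra].
  rewrite (oint_hsplit (m := c + h)); [|lra|apply: K; lra|apply: K; lra].
  by rewrite (oint_hsplit (a := a + w) (m := c + h)); [|lra|apply: K; lra|apply: K; lra].
have [xl xr] : a <= a <= a + w /\ a <= a + w <= a + w by rewrite !lexx lerDl w0.
have [yl yr] : c <= c <= c + h /\ c <= c + h <= c + h by rewrite !lexx lerDl h0.
have [b1|b1] := ltP (e * (w + h) ^+ 2) (nm (oint f a (a + w) c (c + h))).
  exists a, c; split; [done|done|rewrite /bad].
  by rewrite (_ : _ + _ = w + h) //; ring.
have [b2|b2] := ltP (e * (w + h) ^+ 2) (nm (oint f a (a + w) (c + h) d)).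
  exists a, (c + h); split; [done|done|rewrite /bad -Eh].
  by rewrite (_ : _ + _ = w + h) //; rewrite Eh; ring.
have [b3|b3] := ltP (e * (w + h) ^+ 2) (nm (oint f (a + w) b c (c + h))).
  exists (a + w), c; split; [done|done|rewrite /bad -Ew].
  by rewrite (_ : _ + _ = w + h) //; rewrite Ew; ring.
have [b4|b4] := ltP (e * (w + h) ^+ 2) (nm (oint f (a + w) b (c + h) d)).
  exists (a + w), (c + h); split; [done|done|rewrite /bad -Ew -Eh].
  by rewrite (_ : _ + _ = w + h) //; rewrite Ew Eh; ring.
exfalso; move: B; rewrite /bad ltNge => /negP; apply.
rewrite S (_ : (b - a) + (d - c) = 2 * (w + h)); last by rewrite Ew Eh; ring.
rewrite exprMn (_ : e * _ = 4 * (e * (w + h) ^+ 2)); last by ring.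
apply: (le_trans (nmD _ _)); have t1 := nmD (oint f a (a + w) c (c + h)) (oint f a (a + w) (c + h) d).
have t2 := nmD (oint f (a + w) b c (c + h)) (oint f (a + w) b (c + h) d).
move: t1 t2 b1 b2 b3 b4; clear; lra.
Qed.

(** [u] is one coordinate of the lower left corners of nested rectangles. The [u n] increase, the
    opposite ends [u n + w / 2 ^ n] decrease, and the supremum of the former separates them. *)
Lemma nested_point (u : nat -> R) (w : R) : 0 <= w ->
  (forall n, u n <= u n.+1 <= u n + w / 2 ^+ n.+1) ->
  exists x, forall n, u n <= x <= u n + w / 2 ^+ n.
Proof.
move=> w0 H.
have E n : w / 2 ^+ n.+1 + w / 2 ^+ n.+1 = w / 2 ^+ n.
  by rewrite exprS; field; rewrite expf_neq0.
have m1 n k : u n <= u (n + k)%N.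
  elim: k => [|k IH]; first by rewrite addn0.
  by rewrite addnS; apply: (le_trans IH); have /andP[] := H (n + k)%N.
have m2 n k : u (n + k)%N + w / 2 ^+ (n + k) <= u n + w / 2 ^+ n.
  elim: k => [|k IH]; first by rewrite addn0.
  rewrite addnS; apply: le_trans IH; have /andP[_] := H (n + k)%N.
  by move: (E (n + k)%N); lra.
have ub n : ubound (range u) (u n + w / 2 ^+ n).
  move=> _ [k _ <-]; have p m : 0 <= w / 2 ^+ m by rewrite divr_ge0 // exprn_ge0.
  have [nk|/ltnW kn] := leqP n k.
    by apply: (le_trans _ (m2 n (k - n)%N)); rewrite subnKC // lerDl.
  by rewrite -(subnKC kn); apply: (le_trans (m1 k (n - k)%N)); rewrite lerDl.
exists (sup (range u)) => n; apply/andP; split.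
  apply: ub_le_sup; last by exists n.
  by exists (u 0%N + w / 2 ^+ 0); exact: ub.
by apply: ge_sup; [exists (u 0%N); exists 0%N|exact: ub].
Qed.

Lemma goursat f a b c d : a < b -> c < d -> holo_rect f a b c d ->
  oint f a b c d = 0.
Proof.
move=> ab cd H; apply/eqP; rewrite -nm_eq0 -[_ == 0]negbK; apply/negP => n0.
have n1 : 0 < nm (oint f a b c d) by rewrite lt_neqAle eq_sym n0 nm_ge0.
pose L := (b - a) + (d - c).
have L0 : 0 < L by rewrite addr_gt0 // subr_gt0.
(* Half of the critical ratio, so that the initial rectangle is strictly bad. *)
pose e := nm (oint f a b c d) / L ^+ 2 / 2.
have e0 : 0 < e by rewrite !divr_gt0 // exprn_gt0.
have B0 : bad f e a b c d.
  rewrite /bad -/L /e mulrAC divfK ?expf_neq0 ?gt_eqF //; lra.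
pose w n := (b - a) / 2 ^+ n; pose h n := (d - c) / 2 ^+ n.
have w0 n : 0 < w n by rewrite divr_gt0 ?subr_gt0 ?exprn_gt0.
have h0 n : 0 < h n by rewrite divr_gt0 ?subr_gt0 ?exprn_gt0.
have wS n : w n / 2 = w n.+1 by rewrite /w exprS; field; rewrite expf_neq0.
have hS n : h n / 2 = h n.+1 by rewrite /h exprS; field; rewrite expf_neq0.
pose good n (q : R * R) := [/\ a <= q.1, q.1 + w n <= b, c <= q.2, q.2 + h n <= d &
  bad f e q.1 (q.1 + w n) q.2 (q.2 + h n)].
(* The hypothesis [good] sits under the existential so that [choice] yields a successor defined on
   every pair. *)
have step (s : nat * (R * R)) : exists q' : R * R, good s.1 s.2 ->
    [/\ good s.1.+1 q', s.2.1 <= q'.1 <= s.2.1 + w s.1.+1 &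
        s.2.2 <= q'.2 <= s.2.2 + h s.1.+1].
  case: s => n [x y] /=.
  have [[/= g1 g2 g3 g4 g5]|ng] := pselect (good n (x, y)); last by exists (x, y).
  have wn := w0 n; have hn := h0 n.
  have [|||a' [c' [i1 i2 i3]]] := bad_quarter _ _ _ g5; [lra|lra| |].
    by apply: cont_rectS (holo_cont H) _ _ _ _.
  move: i1 i2 i3; rewrite !(addrAC _ _ (- _)) !subrr !add0r wS hS => i1 i2 i3.
  exists (a', c') => _ /=; split => //; rewrite /good /=.
  by split => //; have := wS n; have := hS n; lra.
have [nx Hnx] := choice step.
pose S := fix S n := if n is n'.+1 then nx (n', S n') else (a, c).
have G n : good n (S n).
  elim: n => [|n IH]; last by have [] := Hnx (n, S n) IH.
  by rewrite /good /= /w /h !expr0 !divr1 ![_ + (_ - _)]addrC !subrK.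
have ba0 : 0 <= b - a by rewrite subr_ge0 ltW.
have dc0 : 0 <= d - c by rewrite subr_ge0 ltW.
have [x hx] := @nested_point (fun n => (S n).1) (b - a) ba0
  (fun n => let: And3 _ i _ := Hnx (n, S n) (G n) in i).
have [y hy] := @nested_point (fun n => (S n).2) (d - c) dc0
  (fun n => let: And3 _ _ i := Hnx (n, S n) (G n) in i).
have [l Hl] : exists l, cdiff f (x +i* y)%C l.
  by apply: H; [have := hx 0%N|have := hy 0%N]; rewrite /= expr0 divr1; lra.
have [dl dl0 Hdl] := Hl _ (divr_gt0 e0 (ltr0Sn _ 1)).
have [n Hn] : exists n, w n + h n < dl.
  have [n Hn] : exists n, L / dl < n%:R.
    exists (Num.bound (L / dl)); apply: le_lt_trans (archi_boundP _); first exact: lexx.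
    by rewrite divr_ge0 // ltW.
  exists n; rewrite /w /h -mulrDl ltr_pdivrMr ?exprn_gt0 // -/L mulrC -ltr_pdivrMr //.
  apply: (lt_trans Hn); rewrite -natrX ltr_nat; exact: ltn_expl.
have [g1 g2 g3 g4] := G n; rewrite /bad ltNge => /negP; apply.
set x0 := (S n).1 in g1 g2 *; set y0 := (S n).2 in g3 g4 *.
have wn := w0 n; have hn := h0 n.
have ex : x0 <= x <= x0 + w n := hx n.
have ey : y0 <= y <= y0 + h n := hy n.
have wle : x0 <= x0 + w n by rewrite lerDl ltW.
have hle : y0 <= y0 + h n by rewrite lerDl ltW.
have Cf : cont_bdry f x0 (x0 + w n) y0 (y0 + h n).
  by apply: cont_rect_bdry => //; apply: cont_rectS (holo_cont H) _ _ _ _.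
(* [A] is the affine approximation of [f] at the limit point. Its boundary integral vanishes, and
   the remainder is at most [e / 2 * (w n + h n)] on a boundary of length [2 * (w n + h n)], which
   contradicts badness. *)
pose z : C := (x +i* y)%C; pose A (v : C) := (f z - z * l) + v * l.
have CA : cont_bdry A x0 (x0 + w n) y0 (y0 + h n) by move=> ? ? _; exact: cont_at_affine.
have -> : oint f x0 (x0 + w n) y0 (y0 + h n) =
    oint (fun v => f v - A v) x0 (x0 + w n) y0 (y0 + h n).
  by rewrite ointB ?oint_affine ?subr0.
have -> : x0 + w n - x0 + (y0 + h n - y0) = w n + h n by ring.
have -> : e * (w n + h n) ^+ 2 = (e / 2 * (w n + h n)) *
  (2 * (x0 + w n - x0 + (y0 + h n - y0))) by field.
apply: nm_oint_bound => //.
  by move=> s t hst; apply: cont_atB; [exact: Cf|exact: cont_at_affine].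
move=> s t /bdry_rect[]// hs ht; set v : C := (s +i* t)%C.
have nv : nm (v - z) <= w n + h n.
  apply: (le_trans (nm_le_ReIm _)); rewrite Re_add Im_add Re_opp Im_opp /=; apply: lerD.
    by rewrite ler_norml; lra.
  by rewrite ler_norml; lra.
have := Hdl (v - z) (le_lt_trans nv Hn).
rewrite [X in f X](_ : _ = v); last by rewrite addrC subrK.
have -> : f v - f z - (v - z) * l = f v - A v by rewrite /A; ring.
by move=> /le_trans; apply; rewrite ler_wpM2l // divr_ge0 // ltW.
Qed.

End Goursat.

(** * Fundamental theorem of calculus and a Poisson kernel on a segment *)

Section RealFTC.
Context {R : realType}.
Local Notation C := R[i].
Local Notation nm := (cabs R).
Local Notation mu := (@lebesgue_measure R).
Implicit Types (u F : R -> R) (a b t : R).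

Lemma is_derive_epsP F t (l : R) :
  (forall e, 0 < e -> exists2 d, 0 < d &
     forall h, `|h| < d -> `|F (t + h) - F t - h * l| <= e * `|h|) ->
  is_derive t 1 F l.
Proof.
move=> H.
have E : (fun h : R => h^-1 *: (F (h *: 1 + t) - F t)) @ 0^' --> l.
  apply/cvgrPdist_le => e e0; have [d d0 Hd] := H e e0.
  apply/nbhs_ballP; exists d => //= h; rewrite /ball /= sub0r normrN => hd h0.
  rewrite -(ler_pM2l (_ : 0 < `|h|)) ?normr_gt0 // -normrM.
  rewrite mulrBr -[h^-1 *: _]/(h^-1 * _) mulVKf // distrC [h *: 1]mulr1 (addrC h).
  by rewrite [`|h| * e]mulrC; exact: Hd.
apply: DeriveDef; last by apply: cvg_lim E.
by apply/cvg_ex; exists l.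
Qed.

Lemma ftc_segment F u a b : a <= b ->
  (forall t, a <= t <= b -> {for t, continuous u}) ->
  (forall t, a <= t <= b -> is_derive t 1 F (u t)) ->
  \int[mu]_(t in `[a, b]) u t = F b - F a.
Proof.
rewrite le_eqVlt => /predU1P[-> _ _|ab cu dF].
  by rewrite subrr set_itv1 Rintegral_set1.
have cF t : a <= t <= b -> {for t, continuous F}.
  move=> /dF dt; apply: differentiable_continuous; apply/derivable1_diffP.
  by case: dt.
rewrite /Rintegral (@continuous_FTC2 _ u F a b) //.
- apply: continuous_in_subspaceT => x; rewrite inE /= in_itv /= => hx; exact: cu.
- split.
  + move=> x; rewrite in_itv /= => /andP[ax xb].
    by have [] := dF x (_ : a <= x <= b); rewrite ?(ltW ax) ?(ltW xb).
  + by apply: cvg_at_right_filter; apply: cF; rewrite lexx ltW.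
  + by apply: cvg_at_left_filter; apply: cF; rewrite lexx ltW.
- move=> x; rewrite in_itv /= => /andP[ax xb].
  by rewrite derive1E; have [] := dF x (_ : a <= x <= b); rewrite ?(ltW ax) ?(ltW xb).
Qed.

(** [2 * atan ((t - x) / e)] is a primitive, and the arctangent runs from [- pi / 4] to [pi / 4].
    Each pair of opposite sides of a square contributes this amount to the winding integral. *)
Lemma int_poisson (x e : R) : 0 < e ->
  \int[mu]_(t in `[x - e, x + e]) (2 * e / ((t - x) ^+ 2 + e ^+ 2)) = pi.
Proof.
move=> e0; have p t : 0 < (t - x) ^+ 2 + e ^+ 2.
  by rewrite ltr_wpDl ?sqr_ge0 // exprn_gt0.
pose F t := 2 * atan ((t - x) / e) : R.
transitivity (F (x + e) - F (x - e)).
  apply: (@ftc_segment F); first lra.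
- move=> t _; apply: cvgM; first exact: cvg_cst.
  apply: cvgV; first by rewrite gt_eqF.
  apply: cvgD; last exact: cvg_cst.
  by rewrite /continuous_at; apply: cvgM; apply: cvgB => //; exact: cvg_cst.
- move=> t _.
  have d1 : is_derive t 1 (fun s : R => (s - x) / e) e^-1.
    apply: is_derive_epsP => k k0; exists 1 => // h _.
    rewrite (_ : _ - _ = 0) ?normr0 ?mulr_ge0 ?(ltW k0) //.
    by field; rewrite gt_eqF.
  have d2 := @is_derive1_comp _ (@atan R) (fun s : R => (s - x) / e) t _ _
     (is_derive1_atan _) d1.
  have := @is_deriveZ _ _ _ _ 2 t 1 _ d2; congr is_derive.
  rewrite -[_ *: _]/(2 * _); field; rewrite gt_eqF //=.
  rewrite gt_eqF // ?(ltr_pwDr _ (sqr_ge0 _)) ?exprn_gt0 //.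
rewrite /F [x + e - x]addrAC subrr add0r divff ?gt_eqF //.
rewrite (_ : x - e - x = - e); last by ring.
by rewrite mulNr divff ?gt_eqF // atanN atan1; field.
Qed.

Lemma cint_real u a b : cint a b (fun t => (u t)%:C%C) =
  (\int[mu]_(t in `[a, b]) u t)%:C%C.
Proof.
by apply/eqP; rewrite eq_complex /= eqxx /= Rintegral_cst // mul0r.
Qed.

End RealFTC.

(** * The winding integral around a square *)

Section CauchyFormula.
Context {R : realType}.
Local Notation C := R[i].
Local Notation nm := (cabs R).
Implicit Types (f g : C -> C) (a b c d x y e : R) (z w : C).

Definition twopii : C := 'i%C * (2 * pi)%:C%C.

Lemma nm_twopii : nm twopii = 2 * pi.
Proof. by rewrite nmM nm_i mul1r nm_real ger0_norm // mulr_ge0 // pi_ge0. Qed.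

Lemma twopii_neq0 : twopii != 0.
Proof. by rewrite -nm_eq0 nm_twopii gt_eqF // mulr_gt0 // pi_gt0. Qed.

Lemma cont_at_inv z w : z != w -> cont_at (fun z => (z - w)^-1) z.
Proof.
move=> zw; pose r := nm (z - w).
have r0 : 0 < r by rewrite nm_gt0 subr_eq0.
move=> e e0; exists (Num.min (r / 2) (e * r ^+ 2 / 2)).
  by rewrite lt_min !divr_gt0 // mulr_gt0 // exprn_gt0.
move=> v; rewrite lt_min => /andP[v1 v2].
have v3 : r / 2 <= nm (v - w).
  have := nmD (v - w) (z - v); rewrite addrC subrKA -/r (nmB z) => h.
  by rewrite /r in v1 *; move: v1 h; rewrite -/r; lra.
have v0 : v - w != 0 by rewrite -nm_gt0 (lt_le_trans _ v3) // divr_gt0.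
have z0 : z - w != 0 by rewrite -nm_gt0.
have -> : (v - w)^-1 - (z - w)^-1 = (z - v) / ((v - w) * (z - w)) by field; rewrite ?v0 ?z0.
rewrite nmM nmV nmM nmB -/r ler_pdivrMr ?mulr_gt0 // ?(lt_le_trans _ v3) ?divr_gt0 //.
apply: (le_trans (ltW v2)); rewrite (_ : e * r ^+ 2 / 2 = e * (r / 2 * r)); last by field.
by rewrite ler_pM2l // ler_pM2r.
Qed.

(** Opposite sides are subtracted pointwise. With [v] the coordinate along horizontal sides, [1/(v -
    ie) - 1/(v + ie) = 2ie/(v^2 + e^2)], which is [i] times the kernel of [int_poisson]; the
    vertical sides are analogous. This replaces the complex logarithm. *)
Lemma oint_inv_square x y e : 0 < e ->
  oint (fun z => (z - (x +i* y)%C)^-1) (x - e) (x + e) (y - e) (y + e) = twopii.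
Proof.
move=> e0; set f := fun z => _.
have cont : cont_bdry f (x - e) (x + e) (y - e) (y + e).
  move=> s t hst; apply: cont_at_inv; apply/eqP => -[E1 E2].
  by move: hst; rewrite E1 E2 => -[[_ [E|E]]|[_ [E|E]]]; move: E; lra.
have ch t : t = y - e \/ t = y + e -> ccontI (x - e) (x + e) (fun s => f (s +i* t)%C).
  exact: cont_bdry_h.
have cv s : s = x - e \/ s = x + e -> ccontI (y - e) (y + e) (fun t => f (s +i* t)%C).
  exact: cont_bdry_v.
have -> : oint f (x - e) (x + e) (y - e) (y + e) =
   (hsegint f (x - e) (x + e) (y - e) - hsegint f (x - e) (x + e) (y + e)) +
   'i%C * (vsegint f (x + e) (y - e) (y + e) - vsegint f (x - e) (y - e) (y + e)).
  by rewrite /oint; ring.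
rewrite -cintB; [|by apply: ch; left|by apply: ch; right].
rewrite -cintB; [|by apply: cv; right|by apply: cv; left].
have p u : (u ^+ 2 + e ^+ 2) != 0.
  by rewrite gt_eqF // ltr_wpDl ?sqr_ge0 // exprn_gt0.
pose P (s t : R) := (2 * e / ((t - s) ^+ 2 + e ^+ 2)).
have cP s t : ccont (fun u => (P s u)%:C%C) t.
  apply/ccontP; split; last exact: cvg_cst.
  apply: cvgM; first exact: cvg_cst.
  apply: cvgV; first exact: p.
  apply: cvgD; last exact: cvg_cst.
  by rewrite /continuous_at; apply: cvgM; apply: cvgB => //; exact: cvg_cst.
have sub (a b c d : R) : (a +i* b)%C - (c +i* d)%C = ((a - c) +i* (b - d))%C by [].
rewrite (@eq_cint _ _ _ _ (fun s => 'i%C * (P x s)%:C%C)); last first.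
  move=> s _; rewrite /f /P !sub.
  rewrite (_ : y - e - y = - e); last by ring.
  rewrite (_ : y + e - y = e); last by ring.
  apply/eqP; rewrite eq_complex /= sqrrN.
  by apply/andP; split; apply/eqP; field; exact: p.
rewrite (@eq_cint _ (y - e) _ _ (fun s => (P y s)%:C%C)); last first.
  move=> s _; rewrite /f /P !sub.
  rewrite (_ : x - e - x = - e); last by ring.
  rewrite (_ : x + e - x = e); last by ring.
  apply/eqP; rewrite eq_complex /= sqrrN [e ^+ 2 + _]addrC.
  by apply/andP; split; apply/eqP; field; exact: p.
rewrite (@cintZ _ (x - e) (x + e) 'i%C _ (fun t _ => cP x t)).
rewrite !cint_real /P !int_poisson // /twopii -mulrDr -rmorphD; congr (_ * _%:C%C); ring.
Qed.

End CauchyFormula.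

(** * Product rule, expansion of the Cauchy kernels, Cauchy's formula on rectangles *)

Section CauchyEstimates.
Context {R : realType}.
Local Notation C := R[i].
Local Notation nm := (cabs R).
Implicit Types (f g : C -> C) (a b c d x y e : R) (z w h u l : C).

(** A quadratic remainder is the form that survives integration: the kernel bounds below are uniform
    along a contour, so they pass to the contour integral. *)
Lemma cdiff_quad f z l K r : 0 < r ->
  (forall h, nm h <= r -> nm (f (z + h) - f z - h * l) <= K * nm h ^+ 2) -> cdiff f z l.
Proof.
move=> r0 H e e0; have M0 : 0 < `|K| + 1 by rewrite ltr_wpDl.
exists (Num.min r (e / (`|K| + 1))); first by rewrite lt_min r0 divr_gt0.
move=> h; rewrite lt_min ltr_pdivlMr // => /andP[/ltW/H h1 h2].
apply: (le_trans h1); rewrite expr2 mulrA ler_wpM2r ?nm_ge0 //.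
apply: le_trans (ltW h2); rewrite mulrC ler_wpM2l ?nm_ge0 //.
by apply: (le_trans (ler_norm K)); rewrite lerDl.
Qed.

Lemma cdiffM f g z l m : cdiff f z l -> cdiff g z m ->
  cdiff (fun z => f z * g z) z (l * g z + f z * m).
Proof.
move=> Hf Hg e e0.
pose M := nm (g z) + nm (f z) + nm l + 1.
have M1 : 1 <= M by rewrite lerDr !addr_ge0 ?nm_ge0.
have M0 : 0 < M by apply: lt_le_trans M1.
(* The error splits into three terms, each at most [k * M * nm h]; this is the origin of [3 * M].
   The cap at 1 lets [M] absorb the variation of [g]. *)
have k0 : 0 < Num.min 1 (e / (3 * M)) by rewrite lt_min ltr01 divr_gt0 // mulr_gt0.
set k := Num.min 1 _ in k0.
have k1 : k <= 1 by rewrite ge_min lexx.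
have k2 : k * (3 * M) <= e by rewrite -ler_pdivlMr ?mulr_gt0 // ge_min lexx orbT.
have [d1 d10 h1] := Hf _ k0; have [d2 d20 h2] := Hg _ k0.
have [d3 d30 h3] := cdiff_cont_at Hg k0.
exists (Num.min d1 (Num.min d2 d3)); first by rewrite !lt_min d10 d20.
move=> h; rewrite !lt_min => /and3P[/h1 p1 /h2 p2 p3].
have {}p3 : nm (g (z + h) - g z) <= k by apply: h3; rewrite addrC addKr.
have -> : f (z + h) * g (z + h) - f z * g z - h * (l * g z + f z * m) =
  (f (z + h) - f z - h * l) * (g z + (g (z + h) - g z)) + f z * (g (z + h) - g z - h * m)
  + h * l * (g (z + h) - g z) by ring.
apply: (le_trans (nmD _ _)).
have q1 : nm ((f (z + h) - f z - h * l) * (g z + (g (z + h) - g z))) <= (k * nm h) * M.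
  rewrite nmM; apply: ler_pM => //; try exact: nm_ge0.
  apply: (le_trans (nmD _ _)); rewrite /M.
  by have := nm_ge0 (f z); have := nm_ge0 l; lra.
have q2 : nm (f z * (g (z + h) - g z - h * m)) <= M * (k * nm h).
  rewrite nmM; apply: ler_pM => //; try exact: nm_ge0.
  by rewrite /M; have := nm_ge0 (g z); have := nm_ge0 l; lra.
have q3 : nm (h * l * (g (z + h) - g z)) <= nm h * M * k.
  rewrite !nmM; apply: ler_pM => //; try exact: nm_ge0.
    by rewrite mulr_ge0 ?nm_ge0.
  rewrite ler_wpM2l ?nm_ge0 //.
  by rewrite /M; have := nm_ge0 (g z); have := nm_ge0 (f z); lra.
have t := nmD ((f (z + h) - f z - h * l) * (g z + (g (z + h) - g z)))
   (f z * (g (z + h) - g z - h * m)).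
apply: (@le_trans _ _ (k * (3 * M) * nm h)); first by move: q1 q2 q3 t; lra.
by rewrite ler_wpM2r ?nm_ge0.
Qed.

Lemma cdiff_cst (k : C) z : cdiff (fun=> k) z 0.
Proof.
by apply: (@cdiff_quad _ _ _ 0 1) => // h _; rewrite subrr mulr0 subr0 nm0 mul0r.
Qed.

Lemma kernel_bounds u h r : 0 < r -> r <= nm u -> nm h <= r / 2 ->
  [/\ u != 0, u - h != 0 & nm (u - h)^-1 <= 2 / r].
Proof.
move=> r0 ru hr.
have uh : r / 2 <= nm (u - h) by have := nm_subl u h; lra.
have uh0 : 0 < nm (u - h) by rewrite (lt_le_trans _ uh) // divr_gt0.
split; first by rewrite -nm_gt0 (lt_le_trans r0).
  by rewrite -nm_gt0.
by rewrite nmV -[2 / r]invrK lef_pV2 ?posrE // ?invr_gt0 ?divr_gt0 // invf_div.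
Qed.

Lemma kernel1 u h r : 0 < r -> r <= nm u -> nm h <= r / 2 ->
  nm ((u - h)^-1 - u^-1 - h * u ^- 2) <= 2 / r ^+ 3 * nm h ^+ 2.
Proof.
move=> r0 ru hr; have [u0 uh0 b] := kernel_bounds r0 ru hr.
have -> : (u - h)^-1 - u^-1 - h * u ^- 2 = h ^+ 2 * (u ^-1 ^+ 2 * (u - h)^-1).
  by rewrite exprVn; field; rewrite u0 uh0.
rewrite nmM nmX nmM nmX nmV mulrC ler_wpM2r ?exprn_ge0 ?nm_ge0 //.
have -> : 2 / r ^+ 3 = (r^-1 ^+ 2) * (2 / r) by field; rewrite gt_eqF.
apply: ler_pM => //; rewrite ?exprn_ge0 ?invr_ge0 ?nm_ge0 //.
by rewrite lerXn2r ?nnegrE ?invr_ge0 ?nm_ge0 ?(ltW r0) // lef_pV2 ?posrE // (lt_le_trans r0).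
Qed.

Lemma nm_nat (n : nat) : nm n%:R = n%:R.
Proof. by rewrite -(rmorph_nat (real_complex R)) nm_real ger0_norm. Qed.

(** The remainder is exactly [h^2 (3 - 2h/u) / (u^2 (u - h)^2)]. The 16 is [3 + 2 * (1/2) = 4] from
    the numerator times [2^2] from [nm (u - h) >= r / 2]. *)
Lemma kernel2 u h r : 0 < r -> r <= nm u -> nm h <= r / 2 ->
  nm ((u - h) ^- 2 - u ^- 2 - h * (2 * u ^- 3)) <= 16 / r ^+ 4 * nm h ^+ 2.
Proof.
move=> r0 ru hr; have [u0 uh0 b] := kernel_bounds r0 ru hr.
have -> : (u - h) ^- 2 - u ^- 2 - h * (2 * u ^- 3) =
    h ^+ 2 * ((3 - 2 * (h * u^-1)) * (u^-1 ^+ 2 * (u - h)^-1 ^+ 2)).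
  by rewrite !exprVn; field; rewrite u0 uh0.
rewrite nmM nmX nmM nmM !nmX nmV mulrC ler_wpM2r ?exprn_ge0 ?nm_ge0 //.
have ri : r^-1 >= 0 by rewrite invr_ge0 ltW.
have iu : (nm u)^-1 <= r^-1 by rewrite lef_pV2 ?posrE // (lt_le_trans r0).
have n3 : nm (3 - 2 * (h / u)) <= 4.
  have hu : nm (h / u) <= 1 / 2.
    rewrite nmM nmV ler_pdivrMr ?(lt_le_trans r0) //; lra.
  apply: (le_trans (nmD _ _)); rewrite nmN nmM.
  by rewrite (nm_nat 3) (nm_nat 2); lra.
have -> : 16 / r ^+ 4 = 4 * (r^-1 ^+ 2 * (2 / r) ^+ 2) by field; rewrite gt_eqF.
apply: ler_pM => //; rewrite ?mulr_ge0 ?exprn_ge0 ?invr_ge0 ?nm_ge0 //.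
apply: ler_pM => //; rewrite ?mulr_ge0 ?exprn_ge0 ?invr_ge0 ?nm_ge0 //.
  by rewrite lerXn2r ?nnegrE ?ri ?iu ?invr_ge0 ?nm_ge0.
by rewrite lerXn2r ?nnegrE ?divr_ge0 ?nm_ge0 ?(ltW r0).
Qed.

Lemma cdiff_inv z w : z != w -> cdiff (fun z => (z - w)^-1) z (- (z - w) ^- 2).
Proof.
move=> zw; have r0 : 0 < nm (z - w) by rewrite nm_gt0 subr_eq0.
apply: (@cdiff_quad _ _ _ (2 / nm (z - w) ^+ 3) (nm (z - w) / 2)); first by rewrite divr_gt0.
move=> h hr; have := @kernel1 (z - w) (- h) _ r0 (lexx _).
by rewrite nmN => /(_ hr); rewrite mulrN -mulNr opprK [z - w + h]addrAC.
Qed.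

Lemma cdiff_invX z w m : z != w -> exists l, cdiff (fun z => (z - w) ^- m) z l.
Proof.
move=> zw; have -> : (fun z => (z - w) ^- m) = (fun z => (z - w)^-1 ^+ m).
  by apply/funext => v; rewrite exprVn.
elim: m => [|m [l IH]]; first by exists 0; exact: cdiff_cst.
have -> : (fun z => (z - w)^-1 ^+ m.+1) = (fun z => (z - w)^-1 * (z - w)^-1 ^+ m).
  by apply/funext => v; rewrite exprS.
by eexists; apply: cdiffM IH; exact: cdiff_inv.
Qed.

(** Left and right strips are cut off, then the bottom and top of the middle strip. The pole lies
    strictly outside each of the four pieces, so [goursat] removes them. *)
Lemma oint_excise f a b c d x y e : 0 < e ->
  a < x - e -> x + e < b -> c < y - e -> y + e < d ->
  (forall s t, a <= s <= b -> c <= t <= d -> (s +i* t)%C != (x +i* y)%C ->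
     exists l, cdiff f (s +i* t)%C l) ->
  oint f a b c d = oint f (x - e) (x + e) (y - e) (y + e).
Proof.
move=> e0 h1 h2 h3 h4 H.
have ne s t : s <> x \/ t <> y -> (s +i* t)%C != (x +i* y)%C.
  by move=> K; apply/eqP => -[E1 E2]; case: K.
have K a' b' c' d' : a <= a' -> b' <= b -> c <= c' -> d' <= d -> a' <= b' -> c' <= d' ->
    a' <> x -> b' <> x -> c' <> y -> d' <> y -> cont_bdry f a' b' c' d'.
  move=> i1 i2 i3 i4 i5 i6 j1 j2 j3 j4 s t st; have [r1 r2] := bdry_rect i5 i6 st.
  have nst : s <> x \/ t <> y.
    by case: st => [[_ [->|->]]|[_ [->|->]]]; [right|right|left|left].
  have [||l Hl] := H s t _ _ (ne _ _ nst); [lra|lra|exact: cdiff_cont_at Hl].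
have G a' b' c' d' : a <= a' -> b' <= b -> c <= c' -> d' <= d -> a' < b' -> c' < d' ->
    (b' < x \/ x < a') \/ (d' < y \/ y < c') -> oint f a' b' c' d' = 0.
  move=> i1 i2 i3 i4 i5 i6 L; apply: goursat => // s t hs ht.
  apply: H; [lra|lra|apply: ne].
  by case: L => [[?|?]|[?|?]]; [left|left|right|right] => E; subst; lra.
have Gl : oint f a (x - e) c d = 0 by apply: G; try lra; left; left; lra.
have Gr : oint f (x + e) b c d = 0 by apply: G; try lra; left; right; lra.
have Gb : oint f (x - e) (x + e) c (y - e) = 0 by apply: G; try lra; right; left; lra.
have Gt : oint f (x - e) (x + e) (y + e) d = 0 by apply: G; try lra; right; right; lra.
rewrite (@oint_vsplit _ f _ (x - e)); [|lra|by apply: K; lra|by apply: K; lra].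
rewrite Gl add0r.
rewrite (@oint_vsplit _ f _ (x + e)); [|lra|by apply: K; lra|by apply: K; lra].
rewrite Gr addr0.
rewrite (@oint_hsplit _ f _ _ _ (y - e)); [|lra|by apply: K; lra|by apply: K; lra].
rewrite Gb add0r.
rewrite (@oint_hsplit _ f _ _ _ (y + e)); [|lra|by apply: K; lra|by apply: K; lra].
by rewrite Gt addr0.
Qed.

(** Differentiability at the pole bounds the difference quotient by [M = 1 + nm l], so replacing
    [f z] by [f w] on a small square costs at most [M] times its perimeter [8 * e], which is
    arbitrarily small. *)
Lemma cauchy_formula f a b c d x y : a < x < b -> c < y < d -> holo_rect f a b c d ->
  oint (fun z => f z * (z - (x +i* y)%C)^-1) a b c d = twopii * f (x +i* y)%C.
Proof.
move=> /andP[ax xb] /andP[cy yd] H; set w := (x +i* y)%C.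
have [l Hl] : exists l, cdiff f w l by apply: H; rewrite !ltW.
have [dl dl0 Hdl] := Hl _ ltr01.
pose M := 1 + nm l; have M0 : 0 < M by rewrite ltr_pwDl // nm_ge0.
apply/eqP; rewrite -subr_eq0 -nm_eq0 eq_le nm_ge0 andbT.
apply/ler_addgt0Pl => k k0; rewrite addr0.
pose m := Num.min (Num.min (x - a) (b - x)) (Num.min (y - c) (d - y)).
pose e := Num.min (m / 2) (Num.min (dl / 3) (k / (8 * M))).
have m0 : 0 < m by rewrite !lt_min !subr_gt0 ax xb cy yd.
have e0 : 0 < e by rewrite !lt_min !divr_gt0 // mulr_gt0.
have em : e < m.
  have : e <= m / 2 by rewrite ge_min lexx.
  by move: m0; lra.
have ed : 2 * e < dl.
  have : e <= dl / 3 by rewrite !ge_min lexx orbT.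
  by move: dl0; lra.
have ek : M * (8 * e) <= k.
  have : e <= k / (8 * M) by rewrite !ge_min lexx !orbT.
  by rewrite ler_pdivlMr ?mulr_gt0 //; lra.
move: em; rewrite !lt_min => /andP[/andP[m1 m2] /andP[m3 m4]].
have D s t : a <= s <= b -> c <= t <= d -> (s +i* t)%C != w ->
    exists l, cdiff (fun z => f z * (z - w)^-1) (s +i* t)%C l.
  move=> hs ht ne; have [l' Hl'] := H _ _ hs ht.
  by eexists; apply: cdiffM Hl' _; exact: cdiff_inv.
rewrite (@oint_excise _ _ _ _ _ x y e) //; try lra.
have B s t : bdry (x - e) (x + e) (y - e) (y + e) s t ->
    [/\ a <= s <= b, c <= t <= d, e <= nm ((s +i* t)%C - w) & nm ((s +i* t)%C - w) <= 2 * e].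
  move=> st; have [||i1 i2] := bdry_rect _ _ st; [lra|lra|].
  split; [lra|lra| |].
    case: st => [[_ E]|[_ E]].
      apply: le_trans (Im_le_nm _); rewrite /=; case: E => ->.
        by rewrite addrAC subrr add0r normrN gtr0_norm.
      by rewrite addrAC subrr add0r gtr0_norm.
    apply: le_trans (Re_le_nm _); rewrite /=; case: E => ->.
      by rewrite addrAC subrr add0r normrN gtr0_norm.
    by rewrite addrAC subrr add0r gtr0_norm.
  apply: (le_trans (nm_le_ReIm _)); rewrite /=.
  have : `|s - x| <= e by rewrite ler_norml; lra.
  have : `|t - y| <= e by rewrite ler_norml; lra.
  lra.
have N s t : bdry (x - e) (x + e) (y - e) (y + e) s t -> (s +i* t)%C != w.
  by move=> /B[_ _ h _]; rewrite -subr_eq0 -nm_gt0 (lt_le_trans e0).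
have C1 : cont_bdry (fun z => f z * (z - w)^-1) (x - e) (x + e) (y - e) (y + e).
  move=> s t st; have [i1 i2 _ _] := B _ _ st.
  by have [l' Hl'] := D _ _ i1 i2 (N _ _ st); exact: cdiff_cont_at Hl'.
have C2 : cont_bdry (fun z => (z - w)^-1) (x - e) (x + e) (y - e) (y + e).
  by move=> s t st; apply: cdiff_cont_at; exact: cdiff_inv (N _ _ st).
have C3 : cont_bdry (fun z => f w * (z - w)^-1) (x - e) (x + e) (y - e) (y + e).
  move=> s t st; apply: cdiff_cont_at; apply: cdiffM; first exact: cdiff_cst.
  exact: cdiff_inv (N _ _ st).
rewrite -(oint_inv_square x y e0) mulrC -ointZ // -ointB //.
apply: le_trans ek; apply: le_trans.
  apply: (@nm_oint_bound _ _ _ _ _ _ M); [lra|lra| |].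
    by move=> s t st; apply: cont_atB; [exact: C1|exact: C3].
  move=> s t st; have [_ _ i3 i4] := B _ _ st; rewrite -mulrBl nmM nmV.
  have p : 0 < nm ((s +i* t)%C - w) by apply: lt_le_trans i3.
  rewrite ler_pdivrMr //; set v := (s +i* t)%C in i3 i4 p *.
  have := Hdl (v - w); rewrite [w + _]addrC subrK => /(_ (le_lt_trans i4 ed)).
  rewrite mul1r => q.
  rewrite -(subrK ((v - w) * l) (f v - f w)); apply: (le_trans (nmD _ _)).
  by rewrite nmM /M [(1 + nm l) * _]mulrDl mul1r [nm l * _]mulrC lerD2r.
by rewrite ler_wpM2l ?(ltW M0) //; lra.
Qed.

End CauchyEstimates.

(** * Derivatives of analytic functions on the disc *)

Section DiscDerivatives.
Context {R : realType}.
Local Notation C := R[i].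
Local Notation nm := (cabs R).
Implicit Types (f g : C -> C) (a b c d x y r S : R) (z w h l : C).

(** Unnormalised Cauchy integral: for [m >= 1] and [w] inside, [2 pi i / (m - 1)!] times the
    derivative of order [m - 1] of a holomorphic [f]. *)
Definition kint f a b c d (m : nat) w := oint (fun z => f z * (z - w) ^- m) a b c d.

Lemma kint_cont f a b c d m w r : a <= b -> c <= d -> holo_rect f a b c d -> 0 < r ->
  (forall x y, bdry a b c d x y -> r <= nm ((x +i* y)%C - w)) ->
  cont_bdry (fun z => f z * (z - w) ^- m) a b c d.
Proof.
move=> ab cd H r0 Hr x y hxy; have [h1 h2] := bdry_rect ab cd hxy.
have [l Hl] := H _ _ h1 h2.
have ne : (x +i* y)%C != w by rewrite -subr_eq0 -nm_gt0 (lt_le_trans r0) // Hr.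
have [l' Hl'] := cdiff_invX m ne.
exact: cdiff_cont_at (cdiffM Hl Hl').
Qed.

(** Differentiation under the integral sign. The kernel estimate is a hypothesis, so that the same
    statement serves [m = 1] with [kernel1] and [m = 2] with [kernel2]. *)
Lemma kint_expand f a b c d w h r S (m : nat) (k : R) :
  a <= b -> c <= d -> holo_rect f a b c d -> 0 < r ->
  (forall x y, bdry a b c d x y -> r <= nm ((x +i* y)%C - w)) ->
  (forall x y, bdry a b c d x y -> nm (f (x +i* y)%C) <= S) -> 0 <= k ->
  nm h <= r / 2 ->
  (forall u, r <= nm u -> nm ((u - h) ^- m - u ^- m - h * (m%:R * u ^- m.+1)) <= k) ->
  nm (kint f a b c d m (w + h) - kint f a b c d m w - h * (m%:R * kint f a b c d m.+1 w))
    <= S * k * (2 * ((b - a) + (d - c))).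
Proof.
move=> ab cd H r0 Hr HS k0 hr Hk; rewrite /kint.
have Hr' x y : bdry a b c d x y -> r / 2 <= nm ((x +i* y)%C - (w + h)).
  move=> /Hr q; rewrite opprD addrA; have := nm_subl ((x +i* y)%C - w) h; lra.
have c1 := kint_cont m ab cd H (divr_gt0 r0 (ltr0Sn _ 1)) Hr'.
have c2 n := @kint_cont f a b c d n w r ab cd H r0 Hr.
have c3 : cont_bdry (fun z => h * m%:R * (f z * (z - w) ^- m.+1)) a b c d.
  move=> x y hxy; have [h1 h2] := bdry_rect ab cd hxy.
  have [l Hl] := H _ _ h1 h2.
  have ne : (x +i* y)%C != w by rewrite -subr_eq0 -nm_gt0 (lt_le_trans r0) // Hr.
  have [l' Hl'] := cdiff_invX m.+1 ne.
  exact: cdiff_cont_at (cdiffM (cdiff_cst _ _) (cdiffM Hl Hl')).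
have c4 : cont_bdry (fun z => f z * (z - (w + h)) ^- m - f z * (z - w) ^- m) a b c d.
  by move=> x y hxy; apply: cont_atB; [exact: c1|exact: c2].
rewrite mulrA -ointZ // -ointB // -ointB //.
apply: nm_oint_bound => //.
  by move=> x y hxy; apply: cont_atB; [exact: c4|exact: c3].
move=> x y hxy; set z := (x +i* y)%C.
have -> : f z * (z - (w + h)) ^- m - f z * (z - w) ^- m - h * m%:R * (f z * (z - w) ^- m.+1) =
   f z * ((z - w - h) ^- m - (z - w) ^- m - h * (m%:R * (z - w) ^- m.+1)).
  by rewrite [z - (w + h)](_ : _ = z - w - h); ring.
rewrite nmM; apply: ler_pM; rewrite ?nm_ge0 //; first exact: HS.
exact/Hk/Hr.
Qed.

(** The derivative is carried as a second function, so that iterated [cderiv] and primitives built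
    by [Iop] fit one predicate. *)
Definition deriv_on_disc f g := forall z, nm z < 1 -> cdiff f z (g z).

Lemma nm_square x y s t d : `|s - x| <= d -> `|t - y| <= d ->
  nm (s +i* t)%C <= nm (x +i* y)%C + 2 * d.
Proof.
move=> hs ht; have -> : (s +i* t)%C = (x +i* y)%C + ((s - x) +i* (t - y))%C.
  by apply/eqP; rewrite eq_complex /=; apply/andP; split; apply/eqP; ring.
apply: (le_trans (nmD _ _)); rewrite lerD2l; apply: (le_trans (nm_le_ReIm _)) => /=; lra.
Qed.

Lemma holo_square f g x y d : deriv_on_disc f g -> nm (x +i* y)%C + 2 * d < 1 ->
  holo_rect f (x - d) (x + d) (y - d) (y + d).
Proof.
move=> H hd s t hs ht; exists (g (s +i* t)%C); apply: H; apply: le_lt_trans hd.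
by apply: nm_square; rewrite ler_norml; lra.
Qed.

Lemma bdry_square_dist x y d (h : C) s t : 0 < d -> nm h <= d / 2 ->
  bdry (x - d) (x + d) (y - d) (y + d) s t ->
  d <= nm ((s +i* t)%C - (x +i* y)%C) /\ d / 2 <= nm ((s +i* t)%C - ((x +i* y)%C + h)).
Proof.
move=> d0 hd st.
have A : d <= nm ((s +i* t)%C - (x +i* y)%C).
  case: st => [[_ E]|[_ E]].
    apply: le_trans (Im_le_nm _); rewrite /=; case: E => ->.
      by rewrite addrAC subrr add0r normrN gtr0_norm.
    by rewrite addrAC subrr add0r gtr0_norm.
  apply: le_trans (Re_le_nm _); rewrite /=; case: E => ->.
    by rewrite addrAC subrr add0r normrN gtr0_norm.
  by rewrite addrAC subrr add0r gtr0_norm.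
split => //; rewrite opprD addrA.
by have := nm_subl ((s +i* t)%C - (x +i* y)%C) h; lra.
Qed.

Lemma kint_cauchy f g x y d h : deriv_on_disc f g -> 0 < d -> nm (x +i* y)%C + 2 * d < 1 ->
  nm h <= d / 2 -> 
  kint f (x - d) (x + d) (y - d) (y + d) 1 ((x +i* y)%C + h) = twopii * f ((x +i* y)%C + h).
Proof.
move=> H d0 hd hh; rewrite /kint.
have -> : (fun z : C => f z * (z - ((x +i* y)%C + h)) ^- 1) =
          (fun z : C => f z * (z - ((x +i* y)%C + h))^-1).
  by apply/funext => z; rewrite expr1.
move: (Re_le_nm h) (Im_le_nm h) hh; case: h => p q /= hp hq hh.
have -> : (x +i* y)%C + (p +i* q)%C = ((x + p) +i* (y + q))%C by [].
move: hp hq; rewrite !ler_norml => hp hq.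
apply: cauchy_formula; [lra|lra|exact: holo_square H hd].
Qed.

(** From [pi >= 2], dividing by [2 pi i] gains at least a factor 4. *)
Lemma twopii_bound (k : C) (M : R) : nm (twopii * k) <= 4 * M -> nm k <= M.
Proof.
rewrite nmM nm_twopii => h; rewrite -(ler_pM2l (ltr0Sn R 3)).
by apply: le_trans h; rewrite ler_wpM2r ?nm_ge0 //; have := @pi_ge2 R; lra.
Qed.

(** Cauchy integrals over the square of half side [d]: the kernel bounds [1 / d^2] and [2 / d^3]
    times the perimeter [8 * d], divided by [4 <= 2 pi], give the constants [2 / d] and [4 / d^2].
    Uniqueness of derivatives identifies [g] with the integral of order 2. *)
Lemma cauchy_taylor f g x y d S : deriv_on_disc f g -> 0 < d ->
  nm (x +i* y)%C + 2 * d < 1 ->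
  (forall s t, `|s - x| <= d -> `|t - y| <= d -> nm (f (s +i* t)%C) <= S) ->
  nm (g (x +i* y)%C) <= 2 * S / d /\
  forall h, nm h <= d / 2 ->
   nm (f ((x +i* y)%C + h) - f (x +i* y)%C - h * g (x +i* y)%C) <= 4 * S / d ^+ 2 * nm h ^+ 2.
Proof.
move=> H d0 hd HS; set w := (x +i* y)%C.
have xd : x - d <= x + d by lra.
have yd : y - d <= y + d by lra.
have HB s t : bdry (x - d) (x + d) (y - d) (y + d) s t -> nm (f (s +i* t)%C) <= S.
  by move=> /(bdry_rect xd yd)[h1 h2]; apply: HS; rewrite ler_norml; lra.
have hol := holo_square H hd.
have z0 : nm (0 : C) <= d / 2 by rewrite nm0 divr_ge0 // ltW.
have D0 s t (st : bdry (x - d) (x + d) (y - d) (y + d) s t) :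
   d <= nm ((s +i* t)%C - w) by have [] := bdry_square_dist d0 z0 st.
have P : (x + d - (x - d) + (y + d - (y - d))) = 4 * d by ring.
pose l := twopii^-1 * kint f (x - d) (x + d) (y - d) (y + d) 2 w.
have E h : nm h <= d / 2 -> nm (f (w + h) - f w - h * l) <= 4 * S / d ^+ 2 * nm h ^+ 2.
  move=> hh; apply: twopii_bound.
  rewrite [twopii * _]mulrBr [twopii * (_ - _)]mulrBr [twopii * (h * l)]mulrCA mulVKf ?twopii_neq0 //.
  have k0 : 0 <= 2 / d ^+ 3 * nm h ^+ 2.
    by rewrite mulr_ge0 ?divr_ge0 ?exprn_ge0 ?nm_ge0 ?(ltW d0).
  have := @kint_expand f _ _ _ _ w h d S 1 _ xd yd hol d0 D0 HB k0 hh.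
  rewrite P (kint_cauchy H) // -[in X in _ - kint _ _ _ _ _ _ X](addr0 w) (kint_cauchy H) // addr0.
  rewrite mul1r.
  have -> : 4 * (4 * S / d ^+ 2 * nm h ^+ 2) = S * (2 / d ^+ 3 * nm h ^+ 2) * (2 * (4 * d)).
    by field; rewrite gt_eqF.
  by apply => u du; rewrite expr1 mul1r; exact: kernel1.
have gl : g w = l.
  apply: (@cdiff_uniq _ f w); first by apply: H; move: hd d0; rewrite -/w; lra.
  exact: cdiff_quad (divr_gt0 d0 (ltr0Sn _ 1)) E.
rewrite gl; split => //; apply: twopii_bound; rewrite /l mulVKf ?twopii_neq0 //.
apply: le_trans (nm_oint_bound (M := S / d ^+ 2) xd yd _ _) _.
- exact: kint_cont D0.
- move=> s t st; rewrite nmM nmV nmX.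
  have dd := D0 _ _ st.
  apply: ler_pM; rewrite ?nm_ge0 ?invr_ge0 ?exprn_ge0 ?nm_ge0 //; first exact: HB.
  rewrite lef_pV2 ?posrE ?exprn_gt0 // ?(lt_le_trans d0) //.
  by rewrite lerXn2r ?nnegrE ?nm_ge0 ?(ltW d0).
rewrite P le_eqVlt; apply/orP; left; apply/eqP; field; rewrite gt_eqF //.
Qed.

(** Near [w] the derivative [g] is itself given by [kint] of order 2, by expanding the order 1
    integral around each [w + h]; expanding order 2 at [w] then differentiates [g]. *)
Lemma deriv_disc_holo f g : deriv_on_disc f g -> forall w, nm w < 1 -> exists l, cdiff g w l.
Proof.
move=> H [x y]; set w := (x +i* y)%C => w1.
pose d := (1 - nm w) / 4.
have d0 : 0 < d by rewrite divr_gt0 // subr_gt0.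
have hd : nm w + 2 * d < 1 by rewrite /d; lra.
have xd : x - d <= x + d by lra.
have yd : y - d <= y + d by lra.
have hol := holo_square H hd.
have [S [S0 HB]] : exists S, 0 <= S /\ forall s t, bdry (x - d) (x + d) (y - d) (y + d) s t ->
    nm (f (s +i* t)%C) <= S.
  have ev (u : R) (F : R -> C) : ccontI (u - d) (u + d) F ->
      exists S, 0 <= S /\ forall s, u - d <= s <= u + d -> nm (F s) <= S.
    move=> cF; have ud : u - d <= u + d by lra.
    have [|p pu Hp] := @EVT_max R (fun s => nm (F s)) _ _ ud.
      apply: continuous_in_subspaceT => s; rewrite inE /= in_itv /= => hs.
      exact/ccont_nm/cF.
    by exists (nm (F p)); split; [exact: nm_ge0|move=> s hs; apply: Hp; rewrite in_itv].
  have cb := cont_rect_bdry xd yd (holo_cont hol).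
  have [S1 [S10 H1]] := ev _ _ (cont_bdry_h cb (or_introl erefl)).
  have [S2 [S20 H2]] := ev _ _ (cont_bdry_h cb (or_intror erefl)).
  have [S3 [S30 H3]] := ev _ _ (cont_bdry_v cb (or_introl erefl)).
  have [S4 [S40 H4]] := ev _ _ (cont_bdry_v cb (or_intror erefl)).
  exists (S1 + S2 + S3 + S4); split; first by lra.
  move=> s t [[hs [->|->]]|[ht [->|->]]].
  - by have := H1 _ hs; lra.
  - by have := H2 _ hs; lra.
  - by have := H3 _ ht; lra.
  - by have := H4 _ ht; lra.
have d20 : 0 < d / 2 by rewrite divr_gt0.
(* With [nm h <= d / 4] the sides stay at distance at least [d / 2] from [w + h], and a second
   increment of size [d / 4] is half of that, as [kernel1] requires. *)
have G h : nm h <= d / 4 -> g (w + h) = twopii^-1 * kint f (x - d) (x + d) (y - d) (y + d) 2 (w + h).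
  move=> hh; apply: (@cdiff_uniq _ f (w + h)).
    by apply: H; have := nmD w h; lra.
  apply: (@cdiff_quad _ _ _ _ (S * 2 / (d / 2) ^+ 3 * (2 * (4 * d)) / 4) (d / 4)).
    by rewrite divr_gt0.
  move=> k hk; apply: twopii_bound.
  rewrite [twopii * _]mulrBr [twopii * (_ - _)]mulrBr [twopii * (k * _)]mulrCA mulVKf ?twopii_neq0 //.
  have D0 s t (st : bdry (x - d) (x + d) (y - d) (y + d) s t) :
     d / 2 <= nm ((s +i* t)%C - (w + h)).
    by have [] := bdry_square_dist (h := h) d0 _ st => //; lra.
  have k0 : 0 <= 2 / (d / 2) ^+ 3 * nm k ^+ 2.
    by rewrite mulr_ge0 ?divr_ge0 ?exprn_ge0 ?nm_ge0 ?(ltW d20).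
  have kd : nm k <= d / 2 / 2 by lra.
  have := @kint_expand f _ _ _ _ (w + h) k (d / 2) S 1 _ xd yd hol d20 D0 HB k0 kd.
  rewrite -[w + h + k]addrA (kint_cauchy H) //; last by have := nmD h k; lra.
  rewrite (kint_cauchy H) //; last by lra.
  rewrite mul1r.
  move=> Q; apply: le_trans (Q _) _.
    by move=> u du; rewrite expr1 mul1r; exact: kernel1.
  by rewrite le_eqVlt; apply/orP; left; apply/eqP; field; rewrite gt_eqF.
exists (twopii^-1 * (2 * kint f (x - d) (x + d) (y - d) (y + d) 3 w)).
apply: (@cdiff_quad _ _ _ _ (S * 16 / d ^+ 4 * (2 * (4 * d)) / 4) (d / 4)).
  by rewrite divr_gt0.
move=> h hh; apply: twopii_bound.
have g0 : g w = twopii^-1 * kint f (x - d) (x + d) (y - d) (y + d) 2 w.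
  by have := G 0; rewrite addr0; apply; rewrite nm0 divr_ge0 // ltW.
rewrite G // g0.
have D0 s t (st : bdry (x - d) (x + d) (y - d) (y + d) s t) : d <= nm ((s +i* t)%C - w).
  by have [] := bdry_square_dist (h := 0) d0 _ st => //; rewrite nm0 divr_ge0 // ltW.
have k0 : 0 <= 16 / d ^+ 4 * nm h ^+ 2.
  by rewrite mulr_ge0 ?divr_ge0 ?exprn_ge0 ?nm_ge0 ?(ltW d0).
have hd2 : nm h <= d / 2 by lra.
have Q := @kint_expand f _ _ _ _ w h d S 2 _ xd yd hol d0 D0 HB k0 hd2.
rewrite [twopii * _]mulrBr [twopii * (_ - _)]mulrBr [twopii * (h * _)]mulrCA !mulVKf ?twopii_neq0 //.
apply: le_trans (Q _) _; first by move=> u du; exact: kernel2.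
by rewrite le_eqVlt; apply/orP; left; apply/eqP; field; rewrite gt_eqF.
Qed.

End DiscDerivatives.

(** * Bounds on closed discs, and differentiation of the integration operator *)

Section Primitives.
Context {R : realType}.
Local Notation C := R[i].
Local Notation nm := (cabs R).
Implicit Types (f g : C -> C) (x y r S t : R) (z w h l : C).

Lemma in_disc z : (z \in disc R) = (nm z < 1).
Proof. by rewrite /disc; apply/idP/idP => [/set_mem //|H]; apply/mem_set. Qed.

Lemma analytic_deriv (f : cfun R) : analytic_on_disc R f ->
  deriv_on_disc f (derive1 f).
Proof. by move=> H z z1; apply: derivable_cdiff; apply: H; rewrite in_disc. Qed.

Lemma cderiv_deriv (f : cfun R) k : analytic_on_disc R f ->
  deriv_on_disc (cderiv R k f) (cderiv R k.+1 f).
Proof.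
move=> Hf; elim: k => [|k IH]; first exact: analytic_deriv.
move=> z z1; apply: derivable_cdiff; have [l] := deriv_disc_holo IH z1.
by case/cdiff_derivable.
Qed.

Lemma cont_at_plane f x y : cont_at f (x +i* y)%C ->
  {for (x, y), continuous (fun p : R * R => nm (f (p.1 +i* p.2)%C))}.
Proof.
move=> H; apply/cvgrPdist_le => e e0; have [d d0 Hd] := H e e0.
apply/(@nbhs_ballP R (R * R)%type); exists (d / 2); first by rewrite /= divr_gt0.
move=> -[s t]; rewrite /ball /= /ball /= => -[h1 h2].
have : nm (f (s +i* t)%C - f (x +i* y)%C) <= e.
  apply: Hd; apply: (le_lt_trans (nm_le_ReIm _)) => /=.
  have {}h1 : `|x - s| < d / 2 := h1; have {}h2 : `|y - t| < d / 2 := h2.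
  by rewrite (distrC s) (distrC t); lra.
apply: le_trans; rewrite ler_norml; apply/andP; split.
  by have := nm_subl (f (s +i* t)%C) (f (x +i* y)%C); lra.
by rewrite nmB; exact: nm_subl.
Qed.

Lemma nm_plane_continuous : continuous (fun p : R * R => nm (p.1 +i* p.2)%C).
Proof.
by move=> [x y]; apply: (@cont_at_plane id); exact: cont_at_id.
Qed.

Lemma closed_disc_compact r : compact [set p : R * R | nm (p.1 +i* p.2)%C <= r].
Proof.
apply: (@subclosed_compact _ _ (`[- r, r]%classic `*` `[- r, r]%classic)).
- apply: (@preimage_closed _ _ (fun p : R * R => nm (p.1 +i* p.2)%C) [set x | x <= r]).
    by move=> p _; exact: nm_plane_continuous.
  exact: closed_le.
- by apply: compact_setX; exact: segment_compact.
- move=> [x y] /= h; split; rewrite /= in_itv /= -ler_norml.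
    by apply: le_trans h; exact: (Re_le_nm (x +i* y)%C).
  by apply: le_trans h; exact: (Im_le_nm (x +i* y)%C).
Qed.

Lemma bounded_closed_disc f r : r < 1 -> (forall z, nm z < 1 -> cont_at f z) ->
  exists2 S, 0 <= S & forall z, nm z <= r -> nm (f z) <= S.
Proof.
move=> r1 H; have [r0|r0] := leP 0 r; last first.
  by exists 0 => // z hz; have := nm_ge0 z; lra.
have [||p _ Hp] := @compact_EVT_max _ R (fun p : R * R => nm (f (p.1 +i* p.2)%C)) _ _
   (@closed_disc_compact r).
- by exists (0, 0); change (nm (0 : C) <= r); rewrite nm0.
- apply: continuous_in_subspaceT => -[s t]; rewrite inE /= => hs.
  by apply: cont_at_plane; apply: H; apply: le_lt_trans r1.
- exists (nm (f (p.1 +i* p.2)%C)); first exact: nm_ge0.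
  by move=> [s t] hz; apply: (Hp (s, t)); rewrite inE.
Qed.

Lemma deriv_cont f g z : deriv_on_disc f g -> nm z < 1 -> cont_at f z.
Proof. by move=> H /H/cdiff_cont_at. Qed.

Lemma deriv_cont' f g z : deriv_on_disc f g -> nm z < 1 -> cont_at g z.
Proof. by move=> H /(deriv_disc_holo H)[l] /cdiff_cont_at. Qed.

Lemma cdiff_Re f t l : cdiff f t%:C%C l -> is_derive t 1 (fun s => Re (f s%:C%C)) (Re l).
Proof.
move=> H; apply: is_derive_epsP => e e0; have [d d0 Hd] := H e e0; exists d => // h hd.
have := Hd h%:C%C; rewrite nm_real => /(_ hd); apply: le_trans; rewrite -rmorphD.
apply: le_trans (Re_le_nm _); rewrite !Re_add !Re_opp Re_mul /=.
by rewrite mul0r subr0.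
Qed.

Lemma cdiff_Im f t l : cdiff f t%:C%C l -> is_derive t 1 (fun s => Im (f s%:C%C)) (Im l).
Proof.
move=> H; apply: is_derive_epsP => e e0; have [d d0 Hd] := H e e0; exists d => // h hd.
have := Hd h%:C%C; rewrite nm_real => /(_ hd); apply: le_trans; rewrite -rmorphD.
apply: le_trans (Im_le_nm _); rewrite !Im_add !Im_opp Im_mul /=.
by rewrite mul0r addr0.
Qed.

Lemma cint_ftc f g a b : a <= b -> ccontI a b (fun t => g t%:C%C) ->
  (forall t, a <= t <= b -> cdiff f t%:C%C (g t%:C%C)) ->
  cint a b (fun t => g t%:C%C) = f b%:C%C - f a%:C%C.
Proof.
move=> ab cg H; apply/eqP; rewrite eq_complex Re_add Im_add Re_opp Im_opp /=; apply/andP; split; apply/eqP.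
  apply: (@ftc_segment _ (fun s => Re (f s%:C%C))) => // t ht; last exact/cdiff_Re/H.
  by have /ccontP[] := cg _ ht.
apply: (@ftc_segment _ (fun s => Im (f s%:C%C))) => // t ht; last exact/cdiff_Im/H.
by have /ccontP[] := cg _ ht.
Qed.

Lemma cdiff_scale f z w l : cdiff f (w * z) l -> cdiff (fun s => f (s * z)) w (z * l).
Proof.
move=> H e e0; have M0 : 0 < nm z + 1 by rewrite ltr_wpDl ?nm_ge0.
have [d d0 Hd] := H _ (divr_gt0 e0 M0).
exists (d / (nm z + 1)); first by rewrite divr_gt0.
move=> h; rewrite ltr_pdivlMr // => hd.
have hz : nm (h * z) <= nm h * (nm z + 1).
  by rewrite nmM ler_wpM2l ?nm_ge0 // lerDl.
rewrite mulrDl mulrA; apply: (le_trans (Hd _ (le_lt_trans hz hd))).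
by rewrite -mulrA ler_wpM2l ?(ltW e0) // ler_pdivrMl // [_ * nm h]mulrC.
Qed.

Lemma cdiff_id z : cdiff id z 1.
Proof.
apply: (@cdiff_quad _ _ _ _ 0 1) => // h _.
by rewrite /= mulr1 [z + h]addrC addrK subrr nm0 mul0r.
Qed.

Lemma segment_disc z t : 0 <= t <= 1 -> nm (t%:C%C * z) <= nm z.
Proof.
move=> /andP[t0 t1]; rewrite nmM nm_real ger0_norm //.
by rewrite -[X in _ <= X]mul1r ler_wpM2r ?nm_ge0.
Qed.

Lemma ccont_ray f z t : cont_at f (t%:C%C * z) -> ccont (fun t => f (t%:C%C * z)) t.
Proof.
move=> H; apply: (ccont_comp (g := fun t => t%:C%C * z)) => //.
by apply: ccontM; [exact: ccont_real|exact: ccont_cst].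
Qed.

(** The integrand is the derivative of [t * f (t * z)] in [t]. It is also the derivative in [z] of
    [z * f (t * z)], the integrand of [Iop], so this identity evaluates the derivative of [Iop]
    taken under the integral. *)
Lemma ray_ftc f g z : deriv_on_disc f g -> nm z < 1 ->
  cint 0 1 (fun t => f (t%:C%C * z) + t%:C%C * (z * g (t%:C%C * z))) = f z.
Proof.
move=> H z1; have r t : 0 <= t <= 1 -> nm (t%:C%C * z) < 1.
  by move=> ht; apply: le_lt_trans z1; exact: segment_disc.
rewrite (@cint_ftc (fun s => s * f (s * z)) (fun s => f (s * z) + s * (z * g (s * z)))) //.
- by rewrite rmorph1 rmorph0 mul1r mul0r subr0 mul1r.
- move=> t ht; apply: ccontD; first by apply: ccont_ray; exact: deriv_cont H (r t ht).
  apply: ccontM; first exact: ccont_real.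
  apply: ccontM; first exact: ccont_cst.
  by apply: ccont_ray; exact: deriv_cont' H (r t ht).
- move=> t ht; rewrite -{1}[f _]mul1r; apply: cdiffM; first exact: cdiff_id.
  by apply: cdiff_scale; apply: H; exact: r.
Qed.

Lemma Iop_deriv f g : deriv_on_disc f g -> deriv_on_disc (Iop R f) f.
Proof.
move=> H z z1; pose d := (1 - nm z) / 4.
have d0 : 0 < d by rewrite divr_gt0 // subr_gt0.
have [S S0 HS] := @bounded_closed_disc f (nm z + 2 * d) (ltac:(rewrite /d; lra))
  (fun w => deriv_cont (z := w) H).
have IE w : Iop R f w = cint 0 1 (fun t => w * f (t%:C%C * w)) by [].
(* The Taylor bound must be uniform in [t]: [S] bounds [f] on a disc containing the squares of half
   side [d] about all points of the ray. *)
have T t : 0 <= t <= 1 -> nm (g (t%:C%C * z)) <= 2 * S / d /\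
    forall h, nm h <= d / 2 -> nm (f (t%:C%C * z + h) - f (t%:C%C * z) - h * g (t%:C%C * z))
       <= 4 * S / d ^+ 2 * nm h ^+ 2.
  move=> ht; have tz := @segment_disc z t ht.
  case E : (t%:C%C * z) tz => [x y] tz.
  apply: (@cauchy_taylor _ _ _ _ _ _ S) => //; first by rewrite /d in d0 *; lra.
  move=> u v hu hv; apply: HS; apply: le_trans (nm_square hu hv) _; lra.
apply: (@cdiff_quad _ _ _ _ (2 * (4 * S / d ^+ 2) + 2 * S / d) (d / 2)).
  by rewrite divr_gt0.
move=> h hd; rewrite -(ray_ftc H z1) !IE.
have dd : d < 1 by have := nm_ge0 z; rewrite /d; lra.
have nzh : nm (z + h) < 1 by have := nmD z h; rewrite /d in hd; lra.
have r t : 0 <= t <= 1 -> nm (t%:C%C * z) < 1.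
  by move=> ht; apply: le_lt_trans z1; exact: segment_disc.
have r' t : 0 <= t <= 1 -> nm (t%:C%C * (z + h)) < 1.
  by move=> ht; apply: le_lt_trans nzh; exact: segment_disc.
have c1 : ccontI 0 1 (fun t => (z + h) * f (t%:C%C * (z + h))).
  move=> t ht; apply: ccontM; first exact: ccont_cst.
  by apply: ccont_ray; exact: deriv_cont H (r' t ht).
have c2 : ccontI 0 1 (fun t => z * f (t%:C%C * z)).
  move=> t ht; apply: ccontM; first exact: ccont_cst.
  by apply: ccont_ray; exact: deriv_cont H (r t ht).
have c3 : ccontI 0 1 (fun t => f (t%:C%C * z) + t%:C%C * (z * g (t%:C%C * z))).
  move=> t ht; apply: ccontD; first by apply: ccont_ray; exact: deriv_cont H (r t ht).
  apply: ccontM; first exact: ccont_real.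
  apply: ccontM; first exact: ccont_cst.
  by apply: ccont_ray; exact: deriv_cont' H (r t ht).
have c4 : ccontI 0 1 (fun t => h * (f (t%:C%C * z) + t%:C%C * (z * g (t%:C%C * z)))).
  by move=> t ht; apply: ccontM; [exact: ccont_cst|exact: c3].
have c5 : ccontI 0 1 (fun t => (z + h) * f (t%:C%C * (z + h)) - z * f (t%:C%C * z)).
  by move=> t ht; apply: ccontB; [exact: c1|exact: c2].
rewrite -cintZ // -cintB // -cintB // -[X in _ <= X]mulr1 -[X in _ <= _ * X](subr0 1).
apply: nm_cint_bound => //; first by move=> t ht; apply: ccontB; [exact: c5|exact: c4].
move=> t ht; have [g1 g2] := T t ht; set w := t%:C%C * z in g1 g2 *.
have -> : (z + h) * f (t%:C%C * (z + h)) - z * f w - h * (f w + t%:C%C * (z * g w)) =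
    (z + h) * (f (w + t%:C%C * h) - f w - t%:C%C * h * g w) + h * (t%:C%C * h) * g w.
  by rewrite mulrDr -/w; ring.
have th : nm (t%:C%C * h) <= nm h.
  rewrite nmM nm_real -[X in _ <= X]mul1r ler_wpM2r ?nm_ge0 // ger0_norm; lra.
apply: (le_trans (nmD _ _)); rewrite [(_ + _) * nm h ^+ 2]mulrDl; apply: lerD.
  rewrite nmM -[X in _ <= X]mulrA; apply: ler_pM; rewrite ?nm_ge0 //; first by lra.
  apply: (le_trans (g2 _ (le_trans th hd))); rewrite ler_wpM2l //.
    by apply: divr_ge0; [exact: mulr_ge0|apply: exprn_ge0; exact: ltW].
  by rewrite lerXn2r ?nnegrE ?nm_ge0.
rewrite !nmM mulrC; apply: ler_pM; rewrite ?mulr_ge0 ?nm_ge0 //.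
by rewrite expr2 -nmM ler_wpM2l ?nm_ge0.
Qed.

End Primitives.

(** * Local area-mean inequalities *)

Section PlaneMeasure.
Context {R : realType}.
Local Notation C := R[i].
Local Notation nm := (cabs R).
Local Notation mu := (@lebesgue_measure R).
Local Notation mu2 := (mu \x mu)%E.
Implicit Types (f g : C -> C) (d r e : R) (q z : R * R).

Definition toC (q : R * R) : C := (q.1 +i* q.2)%C.
Definition sq (q : R * R) d : set (R * R) :=
  `[q.1 - d, q.1 + d]%classic `*` `[q.2 - d, q.2 + d]%classic.
Definition Dr r : set (R * R) := [set q | nm (toC q) < r].

Lemma sqP q d z : sq q d z <-> `|z.1 - q.1| <= d /\ `|z.2 - q.2| <= d.
Proof.
rewrite /sq /= !in_itv /= !ler_norml; split => -[h1 h2]; lra.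
Qed.

Lemma sq_measurable q d : measurable (sq q d).
Proof. by apply: measurableX; exact: measurable_itv. Qed.

(** The sigma-algebra on [R * R] is the product one, so an open set is written as a countable union
    of boxes with rational centres and half sides [1 / (n + 1)], discarding those that leave [A]. *)
Lemma open2_measurable (A : set (R * R)) : open A -> measurable A.
Proof.
move=> oA.
pose box (a b : rat) (n : nat) : set (R * R) :=
  `]ratr a - n.+1%:R^-1, ratr a + n.+1%:R^-1[%classic `*`
  `]ratr b - n.+1%:R^-1, ratr b + n.+1%:R^-1[%classic.
pose F a b n := if `[< box a b n `<=` A >] then box a b n else set0.
have -> : A = \bigcup_(a : rat) \bigcup_(b : rat) \bigcup_(n : nat) F a b n.
  apply/seteqP; split; last first.
    by move=> p [a _ [b _ [n _]]]; rewrite /F; case: asboolP => // h; exact: h.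
  move=> [x y] /[dup] pA.
  rewrite openE in oA => /oA; rewrite /interior => /(@nbhs_ballP R (R * R)%type)[/= e e0 He].
  have [n ne] : exists n : nat, n.+1%:R^-1 < e / 2.
    have [n Hn] := @ltr_add_invr R 0 (e / 2) (divr_gt0 e0 (ltr0Sn _ 1)).
    by exists n; rewrite add0r in Hn.
  pose k : R := n.+1%:R^-1.
  have k0 : 0 < k by rewrite invr_gt0.
  have [a] := @rat_in_itvoo R (x - k) (x + k) (ltac:(lra)).
  rewrite in_itv /= => /andP[a1 a2].
  have [b] := @rat_in_itvoo R (y - k) (y + k) (ltac:(lra)).
  rewrite in_itv /= => /andP[b1 b2].
  exists a => //; exists b => //; exists n => //.
  have -> : F a b n = box a b n.
    rewrite /F; case: asboolP => // -[] [s t] [] /=.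
    rewrite !in_itv /= -/k => /andP[s1 s2] /andP[t1 t2]; apply: He.
    by split; rewrite /ball /= ltr_norml -/k in ne *; apply/andP; split; lra.
  by split; rewrite /= in_itv /= -/k; apply/andP; split; lra.
apply: bigcupT_measurable_rat => a; apply: bigcupT_measurable_rat => b.
apply: bigcupT_measurable => n; rewrite /F; case: asboolP => _ //.
by apply: measurableX; exact: measurable_itv.
Qed.

Lemma Dr_open r : open (Dr r).
Proof.
apply: (@open_comp _ _ (fun q : R * R => nm (q.1 +i* q.2)%C) [set x | x < r]).
  by move=> p _; exact: nm_plane_continuous.
exact: open_lt.
Qed.

Lemma Dr_measurable r : measurable (Dr r).
Proof. by apply: open2_measurable; exact: Dr_open. Qed.

Lemma continuous2_measurable (U : set (R * R)) (u : R * R -> R) : open U ->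
  (forall q, U q -> {for q, continuous u}) -> measurable_fun U u.
Proof.
move=> oU cu; apply: (measurability _ (RGenOInfty.measurableE R)).
move=> _ [_ [a ->] <-]; apply: open2_measurable.
rewrite openE => q [Uq /=]; rewrite in_itv /= andbT => aq.
rewrite /interior; apply: filterI; first exact: open_nbhs_nbhs.
by apply: (cu q Uq); apply: open_nbhs_nbhs; split; [exact: interval_open|rewrite /= in_itv /= aq].
Qed.

Definition modulus f (q : R * R) : R := nm (f (toC q)).

Lemma modulus_ge0 f q : 0 <= modulus f q. Proof. exact: nm_ge0. Qed.

Lemma modulus_continuous f q : cont_at f (toC q) -> {for q, continuous (modulus f)}.
Proof. by case: q => x y; exact: cont_at_plane. Qed.

Lemma modulus_measurable f (D : set (R * R)) : (forall w : C, nm w < 1 -> cont_at f w) ->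
  D `<=` Dr 1 -> measurable D -> measurable_fun D (modulus f).
Proof.
move=> cf D1 mD; apply: (measurable_funS (Dr_measurable 1)) => //.
apply: continuous2_measurable; first exact: Dr_open.
by move=> q hq; apply: modulus_continuous; exact: cf.
Qed.

Lemma modulus_powR_measurable f (p : R) (D : set (R * R)) :
  (forall w : C, nm w < 1 -> cont_at f w) ->
  D `<=` Dr 1 -> measurable D -> measurable_fun D (fun q => modulus f q `^ p).
Proof.
move=> cf D1 mD; apply: (@measurableT_comp _ _ _ _ _ _ (@powR R ^~ p)).
  exact: measurable_powR.
exact: modulus_measurable.
Qed.

Lemma nm_toC_sq q d z : sq q d z -> nm (toC z) <= nm (toC q) + 2 * d.
Proof. by case: q z => x y [s t] /sqP[h1 h2]; exact: nm_square. Qed.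

Lemma sq_sub_disc q d : nm (toC q) + 2 * d < 1 -> sq q d `<=` Dr 1.
Proof. by move=> h z /nm_toC_sq hz; rewrite /Dr /=; apply: le_lt_trans h. Qed.

Lemma mu2_sq q d : 0 <= d -> mu2 (sq q d) = ((2 * d) ^+ 2)%:E.
Proof.
move=> d0; rewrite product_measure1E //; try exact: measurable_itv.
have E (x : R) : mu `[x - d, x + d] = (2 * d)%:E.
  rewrite lebesgue_measure_itv /= lte_fin; case: ltP => h.
    by rewrite -EFinB; congr EFin; ring.
  by have -> : d = 0 by [lra]; rewrite mulr0.
transitivity ((2 * d)%:E * (2 * d)%:E)%E; last by rewrite -EFinM expr2.
by congr (_ * _)%E; exact: E.
Qed.

Local Open Scope ereal_scope.

(** The slack [e] makes the contradiction strict: if [u] exceeded the bound everywhere, its integral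
    would be at least [I + e]. *)
Lemma exists_le_average (a b : R) (u : R -> \bar R) (I e : R) : (a < b)%R -> (0 < e)%R ->
  measurable_fun `[a, b] u -> (forall x, 0 <= u x) ->
  \int[mu]_(x in `[a, b]) u x <= I%:E ->
  exists2 x, (a <= x <= b)%R & u x <= ((I + e) / (b - a))%:E.
Proof.
move=> ab e0 mu_ u0 hI; apply: contrapT => H.
have ba : (0 < b - a)%R by rewrite subr_gt0.
have : ((I + e) / (b - a) * (b - a))%:E <= I%:E.
  apply: (le_trans _ hI).
  have -> : ((I + e) / (b - a) * (b - a))%:E =
      \int[mu]_(x in `[a, b]) (cst ((I + e) / (b - a))%:E x).
    rewrite integral_cst // EFinM; congr (_ * _)%E; apply: esym.
    by apply: (etrans (lebesgue_measure_itv _)); rewrite /= lte_fin ab -EFinB.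
  have I0 : (0 <= (I + e) / (b - a))%R.
    rewrite divr_ge0 ?(ltW ba) // addr_ge0 ?(ltW e0) //.
    by rewrite -lee_fin; apply: (le_trans _ hI); apply: integral_ge0.
  apply: ge0_le_integral => //.
  move=> x; rewrite /= in_itv /= => hx; rewrite leNgt; apply/negP => /ltW h; apply: H.
  by exists x.
by rewrite divfK ?gt_eqF // lee_fin; lra.
Qed.

End PlaneMeasure.

(** * Sub-mean-value inequality for the modulus *)

Section SubMean.
Context {R : realType}.
Local Notation C := R[i].
Local Notation nm := (cabs R).
Local Notation mu := (@lebesgue_measure R).
Local Notation mu2 := (mu \x mu)%E.
Implicit Types (f g : C -> C) (d r e : R) (q z : R * R).

Lemma fine_le_real (J : \bar R) (r : R) : (0 <= J)%E -> (J <= r%:E)%E -> fine J <= r.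
Proof. by case: J => [j| |] //=; rewrite ?lee_fin. Qed.

Lemma Rintegral_segment_mono (u : R -> R) (a b a' b' : R) : a <= a' -> b' <= b ->
  (forall t, 0 <= u t) -> mu.-integrable `[a, b] (EFin \o u) ->
  \int[mu]_(t in `[a', b']) u t <= \int[mu]_(t in `[a, b]) u t.
Proof.
move=> aa bb u0 iu; have sub : `[a', b'] `<=` `[a, b].
  by apply: subset_itv; rewrite bnd_simp.
apply: fine_le.
- by apply: integrable_fin_num => //; apply: integrableS iu.
- exact: integrable_fin_num.
- apply: ge0_subset_integral => //; last by move=> x _; rewrite lee_fin.
  exact: (measurable_int mu).
Qed.

(** Fubini in both orders, for the modulus extended by zero outside the square. The inner integral
    runs along the whole side of the large square, so it also bounds the shorter side of whichever
    rectangle is chosen. *)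
Lemma exists_small_sides f g q d (a b e I : R) : deriv_on_disc f g -> 0 < d ->
  nm (toC q) + 2 * d < 1 ->
  (\int[mu2]_(z in sq q d) (modulus f z)%:E)%E = I%:E -> 0 < e -> a < b ->
  (q.1 - d <= a -> b <= q.1 + d -> exists2 x, a <= x <= b &
     \int[mu]_(y in `[q.2 - d, q.2 + d]) nm (f (x +i* y)%C) <= (I + e) / (b - a)) /\
  (q.2 - d <= a -> b <= q.2 + d -> exists2 y, a <= y <= b &
     \int[mu]_(x in `[q.1 - d, q.1 + d]) nm (f (x +i* y)%C) <= (I + e) / (b - a)).
Proof.
move=> H d0 hd hI e0 ab.
have cf (w : C) : nm w < 1 -> cont_at f w by exact: (deriv_cont H).
pose F := (fun z => (modulus f z)%:E) \_ (sq q d).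
have mF : measurable_fun setT F.
  apply/(measurable_restrictT _ (sq_measurable _ _)).
  apply/measurable_EFinP; apply: modulus_measurable cf _ _; last exact: sq_measurable.
  exact: sq_sub_disc.
have F0 z : (0 <= F z)%E.
  by rewrite /F patchE; case: ifP => // _; rewrite lee_fin modulus_ge0.
have hF : (\int[mu2]_z F z)%E = I%:E by rewrite -hI -integral_mkcond.
have T1 : (\int[mu2]_z F z = \int[mu]_x fubini_F mu F x)%E by exact: fubini_tonelli1.
have T2 : (\int[mu2]_z F z = \int[mu]_x fubini_G mu F x)%E by exact: fubini_tonelli2.
have inF x y : q.1 - d <= x <= q.1 + d -> q.2 - d <= y <= q.2 + d ->
    F (x, y) = (nm (f (x +i* y)%C))%:E.
  by move=> hx hy; rewrite /F patchE mem_set //; split; rewrite /= in_itv.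
split => h1 h2.
  have := @exists_le_average R a b (fubini_F mu F) I e ab e0.
  case=> [|x||x hx hV].
  - by apply: measurable_funTS; exact: measurable_fun_fubini_tonelli_F.
  - exact: integral_ge0.
  - rewrite -hF T1; apply: ge0_subset_integral => //.
    + exact: measurable_fun_fubini_tonelli_F.
    + by move=> x _; exact: integral_ge0.
  exists x => //; apply: fine_le_real; first by apply: integral_ge0 => y _; rewrite lee_fin nm_ge0.
  apply: le_trans hV; rewrite /fubini_F integral_mkcond le_eqVlt; apply/orP; left; apply/eqP.
  apply: eq_integral => y _; rewrite patchE; case: ifPn => hy.
    by rewrite inF //; [lra|move: hy; rewrite inE /= in_itv].
  rewrite /F patchE ifF //; apply/negbTE; apply: contra hy.
  by rewrite !inE => -[].
have := @exists_le_average R a b (fubini_G mu F) I e ab e0.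
case=> [|x||y hy hV].
- by apply: measurable_funTS; exact: measurable_fun_fubini_tonelli_G.
- exact: integral_ge0.
- rewrite -hF T2; apply: ge0_subset_integral => //.
  + exact: measurable_fun_fubini_tonelli_G.
  + by move=> x _; exact: integral_ge0.
exists y => //; apply: fine_le_real; first by apply: integral_ge0 => x _; rewrite lee_fin nm_ge0.
apply: le_trans hV; rewrite /fubini_G integral_mkcond le_eqVlt; apply/orP; left; apply/eqP.
apply: eq_integral => x _; rewrite patchE; case: ifPn => hx.
  by rewrite inF //; [move: hx; rewrite inE /= in_itv|lra].
rewrite /F patchE ifF //; apply/negbTE; apply: contra hx.
by rewrite !inE => -[].
Qed.

(* The sides of the rectangle are chosen so that the integral of |f| over each
   side is at most its average over the parallel sides. *)
Lemma submean f g q d : deriv_on_disc f g -> 0 < d -> nm (toC q) + 2 * d < 1 ->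
  ((d ^+ 2 * modulus f q)%:E <= 4%:E * \int[mu2]_(z in sq q d) (modulus f z)%:E)%E.
Proof.
move=> H d0 hd.
set J := (\int[mu2]_(z in sq q d) _)%E.
have J0 : (0 <= J)%E by apply: integral_ge0 => z _; rewrite lee_fin modulus_ge0.
case EJ : J J0 => [I| |] // I0; last by rewrite gt0_muley ?leey // lte_fin.
rewrite -EFinM lee_fin; apply/ler_addgt0Pl => e1 e10.
pose e := e1 / 4; have e0 : 0 < e by rewrite divr_gt0.
have := fun a b => @exists_small_sides f g q d a b e I H d0 hd EJ e0.
case: q hd @J EJ => x y hd J EJ; rewrite /= => SS.
have [x1 hx1 V1] := (SS (x - d) (x - d / 2) (ltac:(lra))).1 (ltac:(lra)) (ltac:(lra)).
have [x2 hx2 V2] := (SS (x + d / 2) (x + d) (ltac:(lra))).1 (ltac:(lra)) (ltac:(lra)).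
have [y1 hy1 W1] := (SS (y - d) (y - d / 2) (ltac:(lra))).2 (ltac:(lra)) (ltac:(lra)).
have [y2 hy2 W2] := (SS (y + d / 2) (y + d) (ltac:(lra))).2 (ltac:(lra)) (ltac:(lra)).
set w : C := (x +i* y)%C.
have hol : holo_rect f (x - d) (x + d) (y - d) (y + d) := holo_square H hd.
have holr : holo_rect f x1 x2 y1 y2 by move=> s t hs ht; apply: hol; lra.
have CF := @cauchy_formula R f x1 x2 y1 y2 x y (ltac:(lra)) (ltac:(lra)) holr.
have x12 : x1 <= x2 by lra.
have y12 : y1 <= y2 by lra.
have far s t : bdry x1 x2 y1 y2 s t -> d / 2 <= nm ((s +i* t)%C - w).
  case=> [[_ E]|[_ E]].
    apply: le_trans (Im_le_nm _) => /=.
    by case: E => ->; [rewrite ler0_norm|rewrite ger0_norm]; lra.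
  apply: le_trans (Re_le_nm _) => /=.
  by case: E => ->; [rewrite ler0_norm|rewrite ger0_norm]; lra.
have cb : cont_bdry (fun z : C => f z * (z - w)^-1) x1 x2 y1 y2.
  move=> s t st; have [hs ht] := bdry_rect x12 y12 st; have [l Hl] := holr _ _ hs ht.
  apply: cdiff_cont_at (cdiffM Hl (cdiff_inv _)).
  by rewrite -subr_eq0 -nm_gt0; apply: lt_le_trans (far _ _ st); rewrite divr_gt0.
have cr : cont_rect f (x - d) (x + d) (y - d) (y + d) := holo_cont hol.
have pt s t : bdry x1 x2 y1 y2 s t ->
    nm (f (s +i* t)%C * ((s +i* t)%C - w)^-1) <= 2 / d * nm (f (s +i* t)%C).
  move=> /far hf; rewrite nmM nmV mulrC ler_wpM2r ?nm_ge0 //.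
  rewrite -[2 / d]invrK invf_div lef_pV2 ?posrE ?divr_gt0 //.
  by apply: lt_le_trans hf; rewrite divr_gt0.
have hside t : t = y1 \/ t = y2 -> nm (hsegint (fun z : C => f z * (z - w)^-1) x1 x2 t) <=
    2 / d * \int[mu]_(s in `[x - d, x + d]) nm (f (s +i* t)%C).
  move=> ht; have ht' : y - d <= t <= y + d by case: ht => ->; lra.
  have c0 := cont_rect_h cr ht'.
  have c1 : ccontI x1 x2 (fun s => f (s +i* t)%C) by move=> s hs; apply: c0; lra.
  apply: (le_trans (nm_cint_le (cont_bdry_h cb ht))).
  apply: (@le_trans _ _ (2 / d * \int[mu]_(s in `[x1, x2]) nm (f (s +i* t)%C))).
    rewrite -RintegralZl //; last exact: nm_integrable.
    apply: le_Rintegral => //; first exact: (nm_integrable (cont_bdry_h cb ht)).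
      apply: segment_integrable => s hs; apply: cvgM; first exact: cvg_cst.
      exact/ccont_nm/c1.
    by move=> s; rewrite /= in_itv /= => hs; apply: pt; left.
  rewrite ler_pM2l ?divr_gt0 //; apply: Rintegral_segment_mono; try lra.
    by move=> s; exact: nm_ge0.
  exact: nm_integrable.
have vside s : s = x1 \/ s = x2 -> nm (vsegint (fun z : C => f z * (z - w)^-1) s y1 y2) <=
    2 / d * \int[mu]_(t in `[y - d, y + d]) nm (f (s +i* t)%C).
  move=> hs; have hs' : x - d <= s <= x + d by case: hs => ->; lra.
  have c0 := cont_rect_v cr hs'.
  have c1 : ccontI y1 y2 (fun t => f (s +i* t)%C) by move=> t ht; apply: c0; lra.
  apply: (le_trans (nm_cint_le (cont_bdry_v cb hs))).
  apply: (@le_trans _ _ (2 / d * \int[mu]_(t in `[y1, y2]) nm (f (s +i* t)%C))).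
    rewrite -RintegralZl //; last exact: nm_integrable.
    apply: le_Rintegral => //; first exact: (nm_integrable (cont_bdry_v cb hs)).
      apply: segment_integrable => t ht; apply: cvgM; first exact: cvg_cst.
      exact/ccont_nm/c1.
    by move=> t; rewrite /= in_itv /= => ht; apply: pt; right.
  rewrite ler_pM2l ?divr_gt0 //; apply: Rintegral_segment_mono; try lra.
    by move=> t; exact: nm_ge0.
  exact: nm_integrable.
have N := nm_oint_le cb; rewrite CF nmM nm_twopii in N.
have h1 := hside _ (or_introl erefl); have h2 := hside _ (or_intror erefl).
have v1 := vside _ (or_introl erefl); have v2 := vside _ (or_intror erefl).
(* Each side contributes at most [T]: the kernel is at most [2 / d] because the sides lie in the
   outer strips, and these strips have width [d / 2]. Four sides against [2 pi >= 4] leave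
   [nm (f w) <= T], and [d ^ 2 * T = 4 * I + e1]. *)
pose T := 2 / d * (2 / d * (I + e)).
have q1 (u : R) (a b : R) : b - a = d / 2 -> u <= (I + e) / (b - a) -> 2 / d * u <= T.
  move=> ba; rewrite ba invf_div [(I + e) * _]mulrC => hu.
  by rewrite ler_pM2l ?divr_gt0.
have V1' := q1 _ (x - d) (x - d / 2) (ltac:(by field)) V1.
have V2' := q1 _ (x + d / 2) (x + d) (ltac:(by field)) V2.
have W1' := q1 _ (y - d) (y - d / 2) (ltac:(by field)) W1.
have W2' := q1 _ (y + d / 2) (y + d) (ltac:(by field)) W2.
have p2 := @pi_ge2 R.
have P : 4 * nm (f w) <= 4 * T.
  apply: (@le_trans _ _ (2 * pi * nm (f w))).
    by rewrite ler_wpM2r ?nm_ge0 //; move: p2; clear; lra.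
  apply: (le_trans N); move: h1 h2 v1 v2 V1' V2' W1' W2'; clear; lra.
have {}P : nm (f w) <= T by rewrite -(ler_pM2l (ltr0Sn R 3)).
rewrite /modulus /toC /=; apply: (@le_trans _ _ (d ^+ 2 * T)).
  by rewrite ler_wpM2l ?exprn_ge0 ?(ltW d0).
rewrite le_eqVlt; apply/orP; left; apply/eqP; rewrite /T /e; field; rewrite gt_eqF //.
Qed.

End SubMean.

(** * Sub-mean-value inequality for all positive powers of the modulus *)

Section HardyLittlewood.
Context {R : realType}.
Local Notation C := R[i].
Local Notation nm := (cabs R).
Local Notation mu := (@lebesgue_measure R).
Local Notation mu2 := (mu \x mu)%E.
Implicit Types (f g : C -> C) (d r e p : R) (q z : R * R).

Lemma powR_div x y p : 0 <= x -> 0 < y -> (x / y) `^ p = x `^ p / y `^ p.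
Proof.
move=> x0 y0; rewrite powRM ?invr_ge0 ?(ltW y0) //; congr (_ * _).
by rewrite -[y^-1]powR_inv1 ?(ltW y0) // -powRrM mulN1r powRN.
Qed.

Lemma ler_powR_root x y p : 0 < p -> 0 <= x -> 0 <= y -> x `^ p <= y -> x <= y `^ p^-1.
Proof.
move=> p0 x0 y0 h; rewrite -(powRr1 x0) -(divff (lt0r_neq0 p0)) powRrM.
by apply: ge0_ler_powR => //; rewrite ?nnegrE ?powR_ge0 // invr_ge0 ltW.
Qed.

Lemma ler_powRl x y p : 0 < p -> 0 <= x -> x <= y -> x `^ p <= y `^ p.
Proof.
move=> p0 x0 xy; apply: ge0_ler_powR => //; rewrite ?nnegrE ?(ltW p0) //.
exact: le_trans xy.
Qed.

Lemma powR_rootK y p : 0 < p -> 0 <= y -> (y `^ p^-1) `^ p = y.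
Proof. by move=> p0 y0; rewrite -powRrM mulVf ?gt_eqF // powRr1. Qed.

(** Either [a <= e], or [(a / e)^p >= 1] and the second term alone exceeds [B]. An upper bound on
    [a] thus trades its first power for the power [p], also when [p < 1]. *)
Lemma linear_le_powR (a B e p : R) : 0 < p -> 0 < e -> 0 <= a <= B ->
  a <= e + B * e `^ (- p) * a `^ p.
Proof.
move=> p0 e0 /andP[a0 aB]; have B0 : 0 <= B by apply: le_trans aB.
have t0 : 0 <= B * e `^ (- p) * a `^ p by rewrite !mulr_ge0 ?powR_ge0.
have [ae|ea] := leP a e; first by rewrite (le_trans ae) // lerDl.
apply: (le_trans aB); apply: (@le_trans _ _ (B * e `^ (- p) * a `^ p)); last first.
  by rewrite lerDr ltW.
rewrite -mulrA -[X in X <= _]mulr1 ler_wpM2l // powRN mulrC ler_pdivlMr ?powR_gt0 //.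
by rewrite mul1r ler_powRl // ltW.
Qed.

Definition Ip f p (D : set (R * R)) : \bar R :=
  (\int[mu2]_(z in D) (modulus f z `^ p)%:E)%E.

Lemma Ip_ge0 f p D : (0 <= Ip f p D)%E.
Proof. by apply: integral_ge0 => z _; rewrite lee_fin powR_ge0. Qed.

Lemma Ip_subset f g p (A B : set (R * R)) : deriv_on_disc f g -> measurable A ->
  measurable B -> B `<=` Dr 1 -> A `<=` B -> (Ip f p A <= Ip f p B)%E.
Proof.
move=> H mA mB B1 AB; apply: ge0_subset_integral => //.
  apply/measurable_EFinP; apply: modulus_powR_measurable => // w.
  exact: (deriv_cont H).
by move=> z _; rewrite lee_fin powR_ge0.
Qed.

(** [8 ^ (1/p)] bounds the modulus relative to its value at the nearly maximal point; [1/32] is the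
    part of that value absorbed in the sub-mean inequality, which leaves the factor 32;
    near-maximality doubles it to 64. *)
Definition HLc p := 64 * ((8 `^ p^-1) * (32^-1 `^ (- p))) : R.

Lemma HLc_gt0 p : 0 < HLc p.
Proof. by rewrite !mulr_gt0 ?powR_gt0 ?invr_gt0. Qed.

(* q0 nearly maximises |f|^p dist^2, so |f| <= 8^(1/p) |f(q0)| near q0, and there
   the first power in the submean inequality can be traded for the p-th power. *)
Lemma hl_center f g q d p : 0 < p -> deriv_on_disc f g -> 0 < d ->
  nm (toC q) + 2 * d < 1 ->
  ((modulus f q `^ p * d ^+ 2)%:E <= (HLc p)%:E * Ip f p (sq q d))%E.
Proof.
move=> p0 H d0 hd.
case EI : (Ip f p (sq q d)) (Ip_ge0 f p (sq q d)) => [I| |] // I0; last first.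
  by rewrite gt0_muley ?leey // lte_fin HLc_gt0.
rewrite -EFinM lee_fin; move: I0; rewrite lee_fin => I0.
have [f0|fq] := eqVneq (modulus f q) 0.
  by rewrite f0 powR0 ?gt_eqF // mul0r mulr_ge0 // ltW // HLc_gt0.
have {}fq : 0 < modulus f q by rewrite lt_neqAle eq_sym fq modulus_ge0.
have [S S0 HS] := @bounded_closed_disc R f (nm (toC q) + 2 * d) hd (fun w => deriv_cont (z := w) H).
have HS' z : sq q d z -> modulus f z <= S by move=> /nm_toC_sq; exact: HS.
pose N z := Num.max `|z.1 - q.1| `|z.2 - q.2|.
have Nle z (t : R) : (N z <= t) = (`|z.1 - q.1| <= t) && (`|z.2 - q.2| <= t).
  by rewrite ge_max.
have N0 z : 0 <= N z by rewrite le_max normr_ge0.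
have sN z : sq q d z <-> N z <= d by rewrite Nle; split=> [/sqP[-> ->]|/andP[? ?]] //; apply/sqP.
pose P z := modulus f z `^ p * (d - N z) ^+ 2.
have P0 z : 0 <= P z by rewrite mulr_ge0 ?powR_ge0 ?sqr_ge0.
have Nq : N q = 0 by rewrite /N !subrr normr0 maxxx.
have sqq : sq q d q by apply/sN; rewrite Nq ltW.
have hsP : has_sup (P @` sq q d).
  split; first by exists (P q); exists q.
  exists (S `^ p * d ^+ 2) => _ [z sz <-]; apply: ler_pM; rewrite ?powR_ge0 ?sqr_ge0 //.
    by apply: ler_powRl => //; [exact: modulus_ge0|exact: HS'].
  have := N0 z; have := (sN z).1 sz => h1 h2.
  by rewrite lerXn2r ?nnegrE; lra.
pose M := sup (P @` sq q d).
have PM z : sq q d z -> P z <= M by move=> sz; apply: ub_le_sup; [case: hsP|exists z].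
have Pq : 0 < P q by rewrite /P Nq subr0 mulr_gt0 ?powR_gt0 // exprn_gt0.
have M0 : 0 < M by apply: lt_le_trans Pq _; exact: PM.
have [_ [q0 sq0 <-] hq0] := sup_adherent (divr_gt0 M0 (ltr0Sn R 1)) hsP.
have {}hq0 : M / 2 < P q0 by move: hq0; rewrite -/M; lra.
pose D := d - N q0; pose a := modulus f q0.
have D0 : 0 < D.
  rewrite lt_neqAle subr_ge0 (sN q0).1 // andbT; apply/eqP => E.
  by move: hq0; rewrite /P -/D -E expr0n mulr0; lra.
have a0 : 0 < a.
  rewrite lt_neqAle modulus_ge0 andbT; apply/eqP => E.
  by move: hq0; rewrite /P -/a -E powR0 ?gt_eqF // mul0r; lra.
have D20 : 0 < D / 2 by rewrite divr_gt0.
have near z : sq q0 (D / 2) z -> N z <= d - D / 2.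
  move=> /sqP[h1 h2]; have := (lexx (N q0)); rewrite {1}Nle => /andP[h3 h4].
  rewrite Nle; apply/andP; split.
    rewrite -(subrK q0.1 z.1) -addrA; apply: (le_trans (ler_normD _ _)).
    by move: h1 h3; rewrite /D; lra.
  rewrite -(subrK q0.2 z.2) -addrA; apply: (le_trans (ler_normD _ _)).
  by move: h2 h4; rewrite /D; lra.
have sub : sq q0 (D / 2) `<=` sq q d by move=> z /near h; apply/sN; lra.
(* On the half-size square the distance to the boundary is at least [D / 2], and [P z <= 2 * P q0]:
   the 8 is this 2 times [2^2]. *)
have fz z : sq q0 (D / 2) z -> modulus f z <= 8 `^ p^-1 * a.
  move=> hz; have Pz := PM _ (sub _ hz); have nz := near _ hz.
  have : modulus f z `^ p <= 8 * a `^ p.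
    rewrite -(ler_pM2r (exprn_gt0 2 D20)); apply: (@le_trans _ _ (P z)).
      by rewrite ler_wpM2l ?powR_ge0 // lerXn2r ?nnegrE ?(ltW D20) //; lra.
    have E : 8 * a `^ p * (D / 2) ^+ 2 = 2 * P q0 by rewrite /P -/D -/a; field.
    by rewrite E; apply: (le_trans Pz); move: hq0; clear; lra.
  have -> : 8 `^ p^-1 * a = (8 * a `^ p) `^ p^-1.
    by rewrite powRM ?powR_ge0 // -[(a `^ p) `^ _]powRrM divff ?gt_eqF // powRr1 // ltW.
  by move=> h; apply: ler_powR_root; rewrite ?modulus_ge0 // mulr_ge0 ?powR_ge0.
have Dlow : nm (toC q0) + 2 * (D / 2) < 1.
  have := nm_toC_sq (_ : sq q (N q0) q0); rewrite /D => /(_ _) h.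
  have : nm (toC q0) <= nm (toC q) + 2 * N q0.
    by apply: h; apply/sqP; split; rewrite /N le_max lexx ?orbT.
  by move: hd D0; rewrite /D; lra.
have sd := sq_sub_disc Dlow.
have cf (w : C) : nm w < 1 -> cont_at f w by exact: (deriv_cont H).
have msq := @sq_measurable R q0 (D / 2).
pose K := 8 `^ p^-1 * 32^-1 `^ (- p) : R.
have K0 : 0 < K by rewrite mulr_gt0 ?powR_gt0 // invr_gt0.
pose k := a * K / a `^ p.
have k0 : 0 < k by rewrite divr_gt0 ?powR_gt0 // mulr_gt0.
have pt z : sq q0 (D / 2) z -> modulus f z <= a / 32 + k * (modulus f z `^ p).
  move=> hz; have := @linear_le_powR (modulus f z / a) (8 `^ p^-1) 32^-1 p p0.
  rewrite invr_gt0 ltr0n => /(_ isT); rewrite divr_ge0 ?modulus_ge0 ?(ltW a0) //=.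
  rewrite ler_pdivrMr // fz // => /(_ isT).
  rewrite ler_pdivrMr // powR_div ?modulus_ge0 // => h; apply: (le_trans h).
  rewrite le_eqVlt; apply/orP; left; apply/eqP; rewrite /k /K; field.
  by rewrite gt_eqF // powR_gt0.
have SM := submean H D20 Dlow.
have IL : (\int[mu2]_(z in sq q0 (D / 2)) (modulus f z)%:E <=
    (a / 32 * D ^+ 2)%:E + k%:E * I%:E)%E.
  apply: (@le_trans _ _ (\int[mu2]_(z in sq q0 (D / 2))
     ((a / 32)%:E + k%:E * (modulus f z `^ p)%:E))%E).
    apply: ge0_le_integral => //.
    - by move=> z _; rewrite lee_fin modulus_ge0.
    - by apply/measurable_EFinP; exact: modulus_measurable.
    - apply: emeasurable_funD; first exact: measurable_cst.
      apply/measurable_EFinP; apply: measurable_funM; first exact: measurable_cst.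
      exact: modulus_powR_measurable.
  rewrite ge0_integralD //; last 3 first.
  - by move=> z _; rewrite lee_fin divr_ge0 ?ltW.
  - by move=> z _; rewrite -EFinM lee_fin mulr_ge0 ?powR_ge0 ?ltW.
  - apply/measurable_EFinP; apply: measurable_funM; first exact: measurable_cst.
    exact: modulus_powR_measurable.
  apply: leeD.
    apply: (@le_trans _ _ ((a / 32)%:E * mu2 (sq q0 (D / 2)))%E); first by rewrite integral_cst.
    rewrite (mu2_sq q0 (ltW D20)) -EFinM lee_fin le_eqVlt; apply/orP; left.
    by apply/eqP; field.
  rewrite ge0_integralZl_EFin ?(ltW k0) //.
  - by rewrite lee_pmul2l ?lte_fin // -EI; apply: (Ip_subset _ H) => //;
      [exact: sq_measurable|exact: sq_sub_disc].
  - by move=> z _; rewrite lee_fin powR_ge0.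
  - by apply/measurable_EFinP; exact: modulus_powR_measurable.
have {}SM : (D / 2) ^+ 2 * a <= 4 * (a / 32 * D ^+ 2 + k * I).
  rewrite -lee_fin; apply: (le_trans SM).
  by rewrite EFinM lee_pmul2l ?lte_fin // EFinD EFinM.
have {}SM : D ^+ 2 * a <= 32 * k * I by move: SM; lra.
have ap0 : 0 < a `^ p by rewrite powR_gt0.
have {}SM : a `^ p * D ^+ 2 <= 32 * K * I.
  rewrite -(ler_pM2l (divr_gt0 a0 ap0)) (_ : a / a `^ p * (a `^ p * D ^+ 2) = D ^+ 2 * a).
    by apply: (le_trans SM); rewrite /k le_eqVlt; apply/orP; left; apply/eqP; field; rewrite gt_eqF.
  by field; rewrite gt_eqF.
have Pq2 : P q <= 2 * P q0 by have := PM _ sqq; lra.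
move: Pq2; rewrite /HLc -/K /P Nq subr0 -/a -/D; move: SM; clear; lra.
Qed.

End HardyLittlewood.

(** * Derivatives and increments bounded by local integrals *)

Section PointwiseBounds.
Context {R : realType}.
Local Notation C := R[i].
Local Notation nm := (cabs R).
Local Notation mu := (@lebesgue_measure R).
Local Notation mu2 := (mu \x mu)%E.
Implicit Types (f g : C -> C) (d r e p : R) (q z : R * R).

Lemma deriv_exists f g : deriv_on_disc f g -> exists g1, deriv_on_disc g g1.
Proof.
move=> H; have [|g1 Hg1] := @choice C C (fun w l => nm w < 1 -> cdiff g w l).
  move=> w; have [w1|w1] := pselect (nm w < 1); last by exists 0.
  by have [l Hl] := deriv_disc_holo H w1; exists l.
by exists g1.
Qed.

Lemma hl_sup f g q d p z : 0 < p -> deriv_on_disc f g -> 0 < d ->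
  nm (toC q) + 4 * d < 1 -> sq q d z ->
  ((modulus f z `^ p * d ^+ 2)%:E <= (HLc p)%:E * Ip f p (sq q (2 * d)))%E.
Proof.
move=> p0 H d0 hd hz; have nz := nm_toC_sq hz.
apply: (le_trans (hl_center p0 H d0 _)); first by lra.
rewrite lee_pmul2l ?lte_fin ?HLc_gt0 //.
apply: (Ip_subset _ H); [exact: sq_measurable|exact: sq_measurable| |].
  by apply: sq_sub_disc; lra.
move=> w /sqP[h1 h2]; move/sqP: hz => [h3 h4]; apply/sqP; split.
  rewrite -(subrK z.1 w.1) -addrA; apply: (le_trans (ler_normD _ _)); lra.
rewrite -(subrK z.2 w.2) -addrA; apply: (le_trans (ler_normD _ _)); lra.
Qed.

(** The root is extracted because Cauchy's estimate and the mean value inequality are linear in the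
    supremum [S]. *)
Lemma hl_sup_root f g q d p I : 0 < p -> deriv_on_disc f g -> 0 < d ->
  nm (toC q) + 4 * d < 1 -> Ip f p (sq q (2 * d)) = I%:E ->
  exists S, [/\ 0 <= S, S `^ p = HLc p * I / d ^+ 2 &
    forall z, sq q d z -> modulus f z <= S].
Proof.
move=> p0 H d0 hd EI.
have I0 : 0 <= I by rewrite -lee_fin -EI Ip_ge0.
have K0 : 0 <= HLc p * I / d ^+ 2.
  by rewrite divr_ge0 ?mulr_ge0 ?exprn_ge0 ?(ltW (HLc_gt0 _)) ?(ltW d0).
exists ((HLc p * I / d ^+ 2) `^ p^-1); split; first exact: powR_ge0.
  by rewrite powR_rootK.
move=> z hz; apply: ler_powR_root => //; first exact: modulus_ge0.
rewrite ler_pdivlMr ?exprn_gt0 //.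
by have := hl_sup p0 H d0 hd hz; rewrite EI -EFinM lee_fin.
Qed.

Lemma pw_deriv f g q d p : 0 < p -> deriv_on_disc f g -> 0 < d ->
  nm (toC q) + 4 * d < 1 ->
  (((modulus g q * d) `^ p * d ^+ 2)%:E <= (2 `^ p * HLc p)%:E * Ip f p (sq q (2 * d)))%E.
Proof.
move=> p0 H d0 hd.
case EI : (Ip f p (sq q (2 * d))) (Ip_ge0 f p (sq q (2 * d))) => [I| |] // _; last first.
  by rewrite gt0_muley ?leey // lte_fin mulr_gt0 ?powR_gt0 ?HLc_gt0.
have [S [S0 ES HS]] := hl_sup_root p0 H d0 hd EI.
have [||hg _] := @cauchy_taylor R f g q.1 q.2 d S H d0.
- by rewrite -/(toC q); lra.
- by move=> s t hs ht; apply: (HS (s, t)); apply/sqP.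
rewrite -EFinM lee_fin (_ : _ * _ * I = 2 `^ p * (S `^ p) * d ^+ 2); last first.
  by rewrite ES; field; rewrite gt_eqF.
rewrite ler_wpM2r ?exprn_ge0 ?(ltW d0) // -powRM //.
apply: ler_powRl => //; first by rewrite mulr_ge0 ?modulus_ge0 ?(ltW d0).
by rewrite -ler_pdivlMr.
Qed.

Lemma mean_value f g (w v : C) S : deriv_on_disc f g ->
  (forall t, 0 <= t <= 1 -> nm (w + t%:C%C * (v - w)) < 1 /\ nm (g (w + t%:C%C * (v - w))) <= S) ->
  nm (f v - f w) <= S * nm (v - w).
Proof.
move=> H HS; pose k := v - w.
have D t : 0 <= t <= 1 -> cdiff (fun s => f (w + s * k)) t%:C%C (k * g (w + t%:C%C * k)).
  move=> ht; apply: (@cdiff_scale _ (fun u => f (w + u))) => e e0.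
  have [d d0 Hd] := H _ (HS t ht).1 e e0; exists d => // h hh.
  by rewrite addrA; exact: Hd.
have c t : 0 <= t <= 1 -> ccont (fun s => k * g (w + s%:C%C * k)) t.
  move=> ht; apply: ccontM; first exact: ccont_cst.
  apply: (ccont_comp (g := fun s => w + s%:C%C * k)).
    exact: deriv_cont' H (HS t ht).1.
  apply: ccontD; first exact: ccont_cst.
  by apply: ccontM; [exact: ccont_real|exact: ccont_cst].
have := @cint_ftc _ (fun s => f (w + s * k)) (fun s => k * g (w + s * k)) 0 1 ler01 c D.
rewrite rmorph1 rmorph0 mul1r mul0r addr0 [w + k]addrC subrK => <-.
rewrite -[X in _ <= X]mulr1 -[X in _ <= _ * X](subr0 1).
apply: nm_cint_bound => // t ht.
by rewrite nmM mulrC ler_wpM2r ?nm_ge0 //; exact: (HS t ht).2.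
Qed.

(** The mean value inequality bounds the increment through the supremum of [g] over the square. The
    resulting [d ^ p] is the source of the gain [(k + 1)^(-p)] in the Hardy inequality. *)
Lemma pw_diff f g q d p z : 0 < p -> deriv_on_disc f g -> 0 < d ->
  nm (toC q) + 4 * d < 1 -> sq q d z ->
  ((nm (f (toC z) - f (toC q)) `^ p * d ^+ 2)%:E <=
     (2 `^ p * HLc p * d `^ p)%:E * Ip g p (sq q (2 * d)))%E.
Proof.
move=> p0 H d0 hd hz; have [g1 H1] := deriv_exists H.
case EI : (Ip g p (sq q (2 * d))) (Ip_ge0 g p (sq q (2 * d))) => [I| |] // _; last first.
  by rewrite gt0_muley ?leey // lte_fin !mulr_gt0 ?powR_gt0 ?HLc_gt0.
have [S [S0 ES HS]] := hl_sup_root p0 H1 d0 hd EI.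
have zq : nm (toC z - toC q) <= 2 * d.
  have [h1 h2] := (sqP q d z).1 hz.
  by apply: (le_trans (nm_le_ReIm _)); rewrite /toC /=; lra.
have MV : nm (f (toC z) - f (toC q)) <= S * nm (toC z - toC q).
  apply: mean_value H _ => t ht.
  pose v : R * R := (q.1 + t * (z.1 - q.1), q.2 + t * (z.2 - q.2)).
  have -> : toC q + t%:C%C * (toC z - toC q) = toC v.
    by rewrite /toC /v; apply/eqP; rewrite eq_complex /=; apply/andP; split; apply/eqP; ring.
  have hv : sq q d v.
    have [h1 h2] := (sqP q d z).1 hz; move: ht => /andP[t0 t1].
    apply/sqP; rewrite /v /= !(addrC (_ : R) (t * _)) !addrK !normrM (ger0_norm t0).
    by split; [apply: le_trans h1|apply: le_trans h2]; rewrite ler_piMl.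
  split; last exact: HS.
  by have := nm_toC_sq hv; lra.
rewrite -EFinM lee_fin (_ : _ * _ * I = 2 `^ p * (S `^ p) * (d `^ p) * d ^+ 2); last first.
  by rewrite ES; field; rewrite gt_eqF.
rewrite ler_wpM2r ?exprn_ge0 ?(ltW d0) //.
rewrite -!powRM ?mulr_ge0 ?(ltW d0) //.
apply: ler_powRl => //; first exact: nm_ge0.
apply: (le_trans MV); rewrite [2 * S]mulrC -mulrA ler_wpM2l //.
Qed.

End PointwiseBounds.

(** * Weighted Hardy inequalities on the disc *)

Section WhitneyTonelli.
Context {R : realType}.
Local Notation C := R[i].
Local Notation nm := (cabs R).
Local Notation mu := (@lebesgue_measure R).
Local Notation mu2 := (mu \x mu)%E.
Implicit Types (d r p a : R) (q z w : R * R).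

Lemma plane_sigma_finite : sigma_finite [set: R * R] mu2.
Proof.
exists (fun n : nat => sq (0, 0) n%:R).
  apply/esym; rewrite -subTset => -[x y] _.
  exists (Num.truncn (`|x| + `|y|)).+1 => //; apply/sqP; rewrite /= !subr0.
  have h : `|x| + `|y| < (Num.truncn (`|x| + `|y|)).+1%:R.
    by rewrite truncnS_gt.
  by have := normr_ge0 x; have := normr_ge0 y; split; lra.
move=> n; split; first exact: sq_measurable.
by rewrite mu2_sq ?ltry.
Qed.

(** Tonelli on [(R * R) * (R * R)] takes a bundled sigma-finite measure; squares about the origin
    witness sigma-finiteness of the product. *)
Definition plane_measure : {sigma_finite_measure set (measurableTypeR R * measurableTypeR R)%type -> \bar R} :=
  HB.pack mu2 (Measure_isSigmaFinite.Build _ _ _ mu2 plane_sigma_finite).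

Lemma plane_tonelli (G : (R * R) * (R * R) -> \bar R) : measurable_fun setT G ->
  (forall zw, 0 <= G zw)%E ->
 (\int[mu2]_z \int[mu2]_w G (z, w) = \int[mu2]_w \int[mu2]_z G (z, w))%E.
Proof.
move=> mG G0; exact: (@fubini_tonelli _ _ _ _ R plane_measure plane_measure G mG G0).
Qed.
Lemma plane_tonelli_m (G : (R * R) * (R * R) -> \bar R) : measurable_fun setT G ->
  (forall zw, 0 <= G zw)%E ->
 measurable_fun setT (fun w => \int[mu2]_z G (z, w))%E.
Proof.
move=> mG G0; exact: (@measurable_fun_fubini_tonelli_G _ _ _ _ R plane_measure G mG G0).
Qed.

Lemma bernoulli_half (m : nat) : (0 < m)%N -> 1 / 2 <= (1 - (2 * m%:R)^-1) ^+ m :> R.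
Proof.
move=> m0; have m0' : 0 < m%:R :> R by rewrite ltr0n.
set x := (2 * m%:R)^-1; have x0 : 0 <= x by rewrite invr_ge0 mulr_ge0.
have x1 : x <= 1.
  by rewrite invf_le1 ?mulr_gt0 //; have : 1 <= m%:R :> R by [rewrite ler1n]; lra.
have B k : 1 - k%:R * x <= (1 - x) ^+ k.
  elim: k => [|k IH]; first by rewrite mul0r subr0 expr0.
  rewrite exprS; apply: (@le_trans _ _ ((1 - x) * (1 - k%:R * x))).
    rewrite -natr1; have : 0 <= k%:R * x * x by rewrite !mulr_ge0.
    by lra.
  by rewrite ler_wpM2l // subr_ge0.
apply: le_trans (B m); rewrite /x; rewrite (_ : m%:R * _ = 1 / 2); first lra.
by field; rewrite gt_eqF.
Qed.

Lemma nm_toC_sub q z d : sq q d z -> `|nm (toC z) - nm (toC q)| <= 2 * d.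
Proof.
move=> /sqP[h1 h2].
have h : nm (toC z - toC q) <= 2 * d.
  by apply: (le_trans (nm_le_ReIm _)); rewrite /toC /=; lra.
rewrite ler_norml; have := nm_subl (toC z) (toC q); have := nm_subl (toC q) (toC z).
by rewrite (nmB (toC q)); lra.
Qed.

Lemma powR_sub2 (t a : R) : 0 < t -> t `^ (a - 2) = t `^ a / t ^+ 2.
Proof.
move=> t0; rewrite powRB; last by rewrite (gt_eqF t0) implybT.
by rewrite -(powR_mulrn 2 (ltW t0)).
Qed.

(** A square of half side [2 * wdelta m * t] changes [|z|] by at most [4 * wdelta m * t], and
    [4 * wdelta m] is the [1 / (2 m)] of [bernoulli_half]. *)
Definition wdelta (m : nat) : R := (8 * m%:R)^-1.

Lemma wdelta_bounds m : (0 < m)%N -> 0 < wdelta m <= 1 / 8.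
Proof.
move=> m0; have m1 : 1 <= m%:R :> R by rewrite ler1n.
have p8 : 0 < 8 * m%:R :> R by lra.
by rewrite /wdelta invr_gt0 p8 /= div1r lef_pV2 ?posrE //; lra.
Qed.

(* Neighbouring points have comparable weights because the scale wdelta m
   shrinks like the inverse of the exponent of the weight. *)
Lemma weight_compare (m : nat) r p a z w : (0 < m)%N -> 0 < p -> 0 <= a <= m%:R * p ->
  Dr r z -> sq z (2 * (wdelta m * (r - nm (toC z)))) w ->
  let s := r - nm (toC z) in let t := r - nm (toC w) in
  [/\ 0 < t, s <= 2 * t, t <= 2 * s & s `^ (a - 2) <= 4 * 2 `^ p * t `^ (a - 2)].
Proof.
move=> m0 p0 /andP[a0 am] Dz hw s t; have m0' : 0 < m%:R :> R by rewrite ltr0n.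
have s0 : 0 < s by rewrite subr_gt0.
have /andP[w0 w8] := wdelta_bounds m0.
have hst : `|t - s| <= 4 * (wdelta m * s).
  have := nm_toC_sub hw; rewrite -/s => h; rewrite distrC.
  have -> : s - t = nm (toC w) - nm (toC z) by rewrite /s /t; ring.
  by move: h; rewrite mulrA; lra.
have w8s : wdelta m * s <= 1 / 8 * s by rewrite ler_pM2r.
have t_low : s / 2 <= t by move: hst; rewrite ler_norml; lra.
have t0 : 0 < t by move: s0 t_low; clear; lra.
have t_up : t <= 2 * s by move: hst; rewrite ler_norml; lra.
split => //; first by move: t_low; clear; lra.
pose b : R := 1 - (2 * m%:R)^-1.
have Eb : b = 1 - 4 * wdelta m by rewrite /b /wdelta; field; rewrite gt_eqF.
have b0 : 0 < b by rewrite Eb; move: w8; clear; lra.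
have b1 : b <= 1 by rewrite Eb; move: w0; clear; lra.
have bs : b * s <= t by move: hst; rewrite ler_norml Eb => /andP[h _]; move: h; clear; lra.
have bp : 2 `^ (- p) <= b `^ a.
  apply: (@le_trans _ _ (b `^ (m%:R * p))); last by apply: ger_powR am; rewrite b0.
  rewrite powRrM powR_mulrn ?(ltW b0) // powRN -[X in _ <= X]invrK lef_pV2 ?posrE ?invr_gt0 ?powR_gt0 ?exprn_gt0 //.
  rewrite -(powR_inv1 (powR_ge0 _ _)) -powRrM mulrC powRrM powR_inv1 ?exprn_ge0 ?(ltW b0) //.
  apply: ler_powRl => //; first by rewrite invr_ge0 exprn_ge0 ?(ltW b0).
  rewrite -[X in _ <= X]invrK lef_pV2 ?posrE ?invr_gt0 ?exprn_gt0 //.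
  by have := bernoulli_half m0; rewrite -/b; clear; lra.
have sa : s `^ a <= 2 `^ p * t `^ a.
  rewrite -(ler_pM2l (powR_gt0 (- p) (ltr0Sn R 1))) mulrA -powRD ?addNr ?powRr0 ?mul1r; last first.
    by rewrite eqxx /= pnatr_eq0.
  apply: (@le_trans _ _ (b `^ a * s `^ a)); first by rewrite ler_wpM2r ?powR_ge0.
  rewrite -powRM ?(ltW b0) ?(ltW s0) //; apply: ge0_ler_powR => //; rewrite nnegrE ?(ltW t0) //.
  by rewrite mulr_ge0 ?(ltW b0) ?(ltW s0).
rewrite !powR_sub2 // ler_pdivrMr ?exprn_gt0 //.
apply: (le_trans sa); rewrite [X in _ <= X](_ : _ = (2 `^ p * t `^ a) * ((2 * s) ^+ 2 / t ^+ 2)); last first.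
  by field; rewrite gt_eqF.
rewrite -[X in X <= _]mulr1 ler_wpM2l ?mulr_ge0 ?powR_ge0 //.
by rewrite ler_pdivlMr ?exprn_gt0 // mul1r lerXn2r ?nnegrE ?mulr_ge0 ?(ltW s0) ?(ltW t0).
Qed.

Lemma toC_measurable : measurable_fun [set: R * R] (fun z => nm (toC z)).
Proof.
by apply: continuous2_measurable; [exact: openT|move=> q _; exact: nm_plane_continuous].
Qed.

(** After exchanging the integrals, the points [z] whose square contains a given [w] lie in the
    square about [w] of half side [4 * wdelta m * t w]. Its area [64 * wdelta m ^ 2 * t w ^ 2]
    cancels the exponent [- 2], and the factor [4 * 2 ^ p] of [weight_compare] completes the 256. *)
Lemma whitney_tonelli (m : nat) r p a (phi : R * R -> R) : (0 < m)%N -> 0 < p ->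
  0 <= a <= m%:R * p -> (forall z, 0 <= phi z) -> measurable_fun (Dr r) phi ->
  let F z := (((r - nm (toC z)) `^ (a - 2))%:E *
     \int[mu2]_(w in sq z (2 * (wdelta m * (r - nm (toC z))))) (phi w)%:E)%E in
  measurable_fun (Dr r) F /\
  (\int[mu2]_(z in Dr r) F z <= (256 * 2 `^ p * wdelta m ^+ 2)%:E *
     \int[mu2]_(w in Dr r) (phi w * (r - nm (toC w)) `^ a)%:E)%E.
Proof.
move=> m0 p0 am phi0 mphi F; have /andP[w0 w8] := wdelta_bounds m0.
pose t z := r - nm (toC z).
pose psi := phi \_ (Dr r).
have mpsi : measurable_fun setT psi by apply/(measurable_restrictT _ (Dr_measurable r)).
have psi0 z : 0 <= psi z by rewrite /psi patchE; case: ifP.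
pose cond (zw : (R * R) * (R * R)) := [&& `|zw.2.1 - zw.1.1| <= 2 * (wdelta m * t zw.1),
  `|zw.2.2 - zw.1.2| <= 2 * (wdelta m * t zw.1) & nm (toC zw.1) < r].
pose G zw : \bar R := (if cond zw then t zw.1 `^ (a - 2) * psi zw.2 else 0)%:E.
have mt : measurable_fun setT (fun zw : (R * R) * (R * R) => t zw.1).
  apply: measurable_funB; first exact: measurable_cst.
  by apply: (measurableT_comp toC_measurable); exact: measurable_fst.
have m2t : measurable_fun setT (fun zw : (R * R) * (R * R) => 2 * (wdelta m * t zw.1)).
  by do 2 (apply: measurable_funM; first exact: measurable_cst).
have mG : measurable_fun setT G.
  apply/measurable_EFinP; apply: measurable_fun_ifT.
  - apply: measurable_and; [|apply: measurable_and].
    + apply: measurable_fun_ler => //; apply: measurableT_comp => //; apply: measurable_funB.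
        by apply: measurableT_comp; [exact: measurable_fst|exact: measurable_snd].
      by apply: measurableT_comp; [exact: measurable_fst|exact: measurable_fst].
    + apply: measurable_fun_ler => //; apply: measurableT_comp => //; apply: measurable_funB.
        by apply: measurableT_comp; [exact: measurable_snd|exact: measurable_snd].
      by apply: measurableT_comp; [exact: measurable_snd|exact: measurable_fst].
    + apply: measurable_fun_ltr; last exact: measurable_cst.
      by apply: (measurableT_comp toC_measurable); exact: measurable_fst.
  - apply: measurable_funM; last by apply: (measurableT_comp mpsi); exact: measurable_snd.
    by apply: (@measurableT_comp _ _ _ _ _ _ (@powR R ^~ (a - 2))) => //; exact: measurable_powR.
  - exact: measurable_cst.
have G0 zw : (0 <= G zw)%E.
  by rewrite /G lee_fin; case: ifP => // _; rewrite mulr_ge0 ?powR_ge0.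
have condP z w : cond (z, w) <-> (Dr r z /\ sq z (2 * (wdelta m * t z)) w).
  rewrite /cond /=; split; first by move=> /and3P[? ? ?]; split => //; apply/sqP.
  by move=> [D1 /sqP[h1 h2]]; apply/and3P.
have L0 z : Dr r z -> F z = (\int[mu2]_w G (z, w))%E.
  move=> hz; rewrite /F.
  rewrite -ge0_integralZl_EFin ?powR_ge0 //; last 3 first.
  - exact: sq_measurable.
  - by move=> w _; rewrite lee_fin.
  - apply/measurable_EFinP; apply: (measurable_funS (Dr_measurable r)) => // w hw.
    have [h _ _ _] := weight_compare m0 p0 am hz hw.
    by move: h; rewrite subr_gt0.
  rewrite integral_mkcond; apply: eq_integral => w _; rewrite patchE /G.
  case: ifPn => hw.
    rewrite inE in hw; rewrite ifT; last exact/condP.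
    rewrite -EFinM /psi patchE ifT // inE.
    have [h _ _ _] := weight_compare m0 p0 am hz hw.
    by move: h; rewrite subr_gt0.
  by rewrite ifF //; apply/negbTE; apply: contra hw => /condP[_ h]; rewrite inE.
have L1 : (\int[mu2]_(z in Dr r) F z = \int[mu2]_z \int[mu2]_w G (z, w))%E.
  rewrite integral_mkcond; apply: eq_integral => z _; rewrite patchE; case: ifPn => hz.
    by rewrite inE in hz; rewrite L0.
  rewrite integral0_eq // => w _; rewrite /G ifF //; apply/negbTE.
  by apply: contra hz => /condP[h _]; rewrite inE.
split.
  apply: (@eq_measurable_fun _ _ _ _ _ (fun z => \int[mu2]_w G (z, w))%E).
    by move=> z; rewrite inE => hz; rewrite L0.
  apply: (measurable_funS measurableT) => //.
  exact: (@measurable_fun_fubini_tonelli_F _ _ _ _ R plane_measure G mG G0).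
have TT : (\int[mu2]_z \int[mu2]_w G (z, w) = \int[mu2]_w \int[mu2]_z G (z, w))%E.
  exact: plane_tonelli.
rewrite {}L1 {}TT.
have K0 : 0 <= 256 * 2 `^ p * wdelta m ^+ 2.
  apply: mulr_ge0; last exact/exprn_ge0/ltW.
  by apply: mulr_ge0; [exact: ler0n|exact: powR_ge0].
have mW : measurable_fun (Dr r) (fun w => phi w * t w `^ a).
  apply: measurable_funM => //.
  apply: (@measurableT_comp _ _ _ _ _ _ (@powR R ^~ a)); first exact: measurable_powR.
  apply: measurable_funB; first exact: measurable_cst.
  by apply: (measurable_funS measurableT) => //; exact: toC_measurable.
rewrite -ge0_integralZl_EFin //; last 3 first.
- exact: Dr_measurable.
- by move=> w _; rewrite lee_fin mulr_ge0 ?powR_ge0.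
- exact/measurable_EFinP.
rewrite [X in (_ <= X)%E]integral_mkcond.
apply: ge0_le_integral => //.
- by move=> w _; apply: integral_ge0.
- exact: plane_tonelli_m.
- apply/(measurable_restrictT _ (Dr_measurable r)); apply/measurable_EFinP.
  by apply: measurable_funM; first exact: measurable_cst.
move=> w _; rewrite patchE; case: ifPn => hw; last first.
  rewrite integral0_eq // => z _; rewrite /G; case: ifP => // _.
  by rewrite /psi patchE (negbTE hw) mulr0.
rewrite inE in hw; have tw0 : 0 < t w by rewrite subr_gt0.
pose k := 4 * 2 `^ p * t w `^ (a - 2) * phi w.
have k0 : 0 <= k by rewrite !mulr_ge0 ?powR_ge0.
apply: (@le_trans _ _ (k%:E * mu2 (sq w (4 * (wdelta m * t w))))%E).
  rewrite -integral_cst; last exact: sq_measurable.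
  rewrite [X in (_ <= X)%E]integral_mkcond; apply: ge0_le_integral => //.
  - exact: measurableT_comp mG (measurable_pair2 w).
  - apply/(measurable_restrictT _ (sq_measurable _ _)); exact: measurable_cst.
  move=> z _; rewrite patchE /G; case: ifPn => hz; last first.
    by case: ifP => // _; rewrite lee_fin.
  have [h1 h2] := (condP z w).1 hz.
  have [_ st ts wc] := weight_compare m0 p0 am h1 h2.
  rewrite ifT.
    rewrite lee_fin /= /psi patchE mem_set // /k ler_wpM2r //.
  rewrite inE; move/sqP: h2 => [h2 h3]; apply/sqP.
  have q : 2 * (wdelta m * t z) <= 4 * (wdelta m * t w).
    have : wdelta m * t z <= wdelta m * (2 * t w) by rewrite ler_pM2l.
    by clear; lra.
  by rewrite !(distrC z.1) !(distrC z.2); split; [apply: (le_trans h2)|apply: (le_trans h3)].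
rewrite mu2_sq; last by rewrite !mulr_ge0 ?(ltW w0) ?(ltW tw0).
rewrite -!EFinM lee_fin le_eqVlt; apply/orP; left; apply/eqP.
by rewrite /k powR_sub2 //; field; rewrite gt_eqF.
Qed.

End WhitneyTonelli.

(** * Affine change of variables on the line *)

Section Affine.
Context {R : realType}.
Local Notation mu := (@lebesgue_measure R).
Local Open Scope ereal_scope.

Lemma affine_measurable (c b : R) :
  measurable_fun [set: measurableTypeR R] (fun x => (c * x + b)%R : measurableTypeR R).
Proof. by apply: measurable_funD => //; apply: measurable_funM. Qed.

Lemma affine_preimage_itv (c b s t : R) : (c != 0)%R ->
  `|c|%:E * mu ((fun x => c * x + b)%R @^-1` `]s, t]) = mu `]s, t].
Proof.
move=> c0; have [c1|c1] : (0 < c)%R \/ (c < 0)%R.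
  by have [c1|c1|c1] := ltgtP c 0%R; [right|left|rewrite c1 eqxx in c0].
- have -> : (fun x => c * x + b)%R @^-1` `]s, t] = `]((s - b) / c)%R, ((t - b) / c)%R]%classic.
    apply/seteqP; split=> x; rewrite /= !in_itv /= ltr_pdivrMr // ler_pdivlMr //;
      by rewrite ltrBlDr lerBrDr (mulrC x).
  rewrite !lebesgue_measure_itv /= !lte_fin ltr_pM2r ?invr_gt0 // ltrD2r.
  case: ifP => _; last by rewrite mule0.
  rewrite -!EFinB -EFinM (gtr0_norm c1); congr EFin; field; exact: c0.
- have -> : (fun x => c * x + b)%R @^-1` `]s, t] = `[((t - b) / c)%R, ((s - b) / c)%R[%classic.
    apply/seteqP; split=> x; rewrite /= !in_itv /= ltr_ndivlMr // ler_ndivrMr //;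
      by rewrite ltrBlDr lerBrDr (mulrC x) andbC.
  rewrite !lebesgue_measure_itv /= !lte_fin ltr_nM2r ?invr_lt0 // ltrD2r.
  case: ifP => _; last by rewrite mule0.
  rewrite -!EFinB -EFinM (ltr0_norm c1); congr EFin; field; exact: c0.
Qed.

(** Uniqueness of Lebesgue measure: [mu] agrees with [|c|] times its image under the affine map on
    half-open intervals, whose preimages are closed on the other end when [c < 0]. *)
Lemma affine_subst (c b : R) (g : R -> \bar R) : (c != 0)%R ->
  measurable_fun setT g -> (forall x, 0 <= g x) ->
  \int[mu]_x g (c * x + b)%R = `|c|^-1%:E * \int[mu]_x g x.
Proof.
move=> c0 mg g0; have nc0 : (0 <= `|c|)%R by [].
pose phi := fun x : measurableTypeR R => (c * x + b)%R : measurableTypeR R.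
pose nu0 := mscale (NngNum nc0) (pushforward mu phi).
pose nu := nu0 (affine_measurable c b).
have E A : measurable A -> mu A = nu A.
  apply: lebesgue_measure_unique => _ [[s t] _ <-].
  exact/esym/affine_preimage_itv.
have -> : \int[mu]_x g x = \int[nu]_x g x by apply: eq_measure_integral => A mA _; exact: E.
rewrite ge0_integral_mscale // muleA -EFinM mulVf ?normr_eq0 // mul1e.
rewrite (@ge0_integral_pushforward _ _ _ _ _ phi (affine_measurable c b) mu setT g) //.
Qed.

End Affine.

(** * Change of variables for the radial contraction *)

Section RadialContraction.
Context {R : realType}.
Local Notation C := R[i].
Local Notation nm := (cabs R).
Local Notation mu := (@lebesgue_measure R).
Local Notation mu2 := (mu \x mu)%E.
Implicit Types (d r u x : R) (z w : R * R).

(** Takes the place of polar coordinates: on each line [y = x * u] through the origin a radial map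
    acts on [x] alone. The substitution [y = x * u] fails only at [x = 0], a null set. *)
Lemma slope_coordinates (h : R * R -> \bar R) : measurable_fun setT h ->
  (forall z, 0 <= h z)%E ->
  (\int[mu2]_z h z = \int[mu]_u \int[mu]_x (`|x|%:E * h (x, x * u)%R))%E.
Proof.
move=> mh h0.
pose K (z : R * R) : \bar R := (`|z.1|%:E * h (z.1, z.1 * z.2)%R)%E.
have mK : measurable_fun setT K.
  apply: emeasurable_funM.
    by apply/measurable_EFinP; apply: measurableT_comp => //; exact: measurable_fst.
  apply: (measurableT_comp mh); apply: measurable_fun_pair; first exact: measurable_fst.
  by apply: measurable_funM; [exact: measurable_fst|exact: measurable_snd].
have K0 z : (0 <= K z)%E by rewrite mule_ge0 // lee_fin.
have T1 : (\int[mu2]_z h z = \int[mu]_x fubini_F mu h x)%E by exact: fubini_tonelli1.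
have T2 : (\int[mu]_x fubini_F mu K x = \int[mu]_u \int[mu]_x K (x, u))%E.
  by exact: (@fubini_tonelli _ _ _ _ R mu mu K mK K0).
rewrite {}T1 -[RHS]T2 {T2}.
apply: ge0_ae_eq_integral => //.
- exact: measurable_fun_fubini_tonelli_F.
- exact: measurable_fun_fubini_tonelli_F.
- by move=> x _; exact: integral_ge0.
- by move=> x _; exact: integral_ge0.
exists [set 0]; split => //.
  exact: lebesgue_measure_set1.
move=> x /= H; apply: contrapT => /eqP x0; apply: H => _.
rewrite /fubini_F /K /=.
have mhx : measurable_fun [set: R] (fun y => h (x, y)).
  exact: measurableT_comp mh (measurable_pair1 x).
transitivity (`|x|%:E * \int[mu]_u h (x, x * u + 0)%R)%E.
  rewrite (@affine_subst R x 0 (fun y => h (x, y))) // muleA -EFinM.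
  by rewrite divff ?normr_eq0 // mul1e.
rewrite -ge0_integralZl_EFin //.
  by apply: eq_integral => u _; rewrite addr0.
by apply: (measurableT_comp mhx); apply: measurable_funD => //; exact: measurable_funM.
Qed.

(* Moves z towards the origin so that r - |z| is multiplied by 1 + d. *)
Definition radial d r z : R * R :=
  let l := 1 + d - d * r * (nm (toC z)) `^ (-1) in (l * z.1, l * z.2).

Lemma radial_measurable d r : measurable_fun setT (radial d r).
Proof.
have ml : measurable_fun [set: R * R] (fun z => 1 + d - d * r * (nm (toC z)) `^ (-1)).
  apply: measurable_funB; first exact: measurable_cst.
  apply: measurable_funM; first exact: measurable_cst.
  apply: (@measurableT_comp _ _ _ _ _ _ (@powR R ^~ (-1))); first exact: measurable_powR.
  exact: toC_measurable.
apply: measurable_fun_pair; apply: measurable_funM => //.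
Qed.

Lemma nm_scale (l : R) z : nm (toC (l * z.1, l * z.2)) = `|l| * nm (toC z).
Proof.
have -> : toC (l * z.1, l * z.2) = l%:C%C * toC z.
  by rewrite /toC; apply/eqP; rewrite eq_complex /=; apply/andP; split; apply/eqP; ring.
by rewrite nmM nm_real.
Qed.

(* In the coordinates (x, x u) the map is affine on each half-line, with
   derivative 1 + d; the Jacobian |x| varies by a factor at most
   (1 + d) / (1 + d/2). *)
Lemma radial_contraction d r (g : R * R -> \bar R) : 0 < d <= 1 / 8 -> 0 < r <= 1 ->
  measurable_fun setT g -> (forall z, 0 <= g z)%E ->
  (\int[mu2]_(z in ~` Dr (3 / 4)) g (radial d r z) <=
     ((1 + d / 2)^-1)%:E * \int[mu2]_z g z)%E.
Proof.
move=> /andP[d0 d8] /andP[r0 r1] mg g0.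
have d1 : 0 < 1 + d by rewrite addr_gt0.
have d2 : 0 < 1 + d / 2 by rewrite addr_gt0 ?divr_gt0.
have k0 : 0 <= (1 + d / 2)^-1 by rewrite invr_ge0 ltW.
have mA : measurable (~` Dr (3 / 4) : set (R * R)) by apply: measurableC; exact: Dr_measurable.
pose h := (fun z => g (radial d r z)) \_ (~` Dr (3 / 4)).
have mgr : measurable_fun setT (fun z => g (radial d r z)).
  exact: measurableT_comp mg (radial_measurable d r).
have mh : measurable_fun setT h.
  by apply/(measurable_restrictT _ mA); exact: (measurable_funS measurableT).
have h0 z : (0 <= h z)%E by rewrite /h patchE; case: ifP.
rewrite integral_mkcond -/h (slope_coordinates mh h0) (slope_coordinates mg g0).
have m1 (f : R * R -> \bar R) : measurable_fun setT f ->
    measurable_fun [set: R * R] (fun z => `|z.1|%:E * f (z.1, z.1 * z.2)%R)%E.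
  move=> mf; apply: emeasurable_funM.
    by apply/measurable_EFinP; apply: measurableT_comp => //; exact: measurable_fst.
  apply: (measurableT_comp mf); apply: measurable_fun_pair; first exact: measurable_fst.
  by apply: measurable_funM; [exact: measurable_fst|exact: measurable_snd].
have p1 (f : R * R -> \bar R) : (forall z, 0 <= f z)%E ->
    (forall z : R * R, 0 <= `|z.1|%:E * f (z.1, z.1 * z.2)%R)%E.
  by move=> f0 z; rewrite mule_ge0 // lee_fin.
have mF (f : R * R -> \bar R) (mf : measurable_fun setT f) (f0 : (forall z, 0 <= f z)%E) :
    measurable_fun [set: R] (fun u => \int[mu]_x (`|x|%:E * f (x, x * u)%R))%E.
  exact: (@measurable_fun_fubini_tonelli_G _ _ _ _ R mu _ (m1 f mf) (p1 f f0)).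
rewrite -ge0_integralZl_EFin //; last 2 first.
- by move=> u _; apply: integral_ge0 => x _; rewrite mule_ge0 // lee_fin.
- exact: mF.
apply: ge0_le_integral => //.
- by move=> u _; apply: integral_ge0 => x _; rewrite mule_ge0 // lee_fin.
- exact: mF.
- by apply: emeasurable_funM; [exact: measurable_cst|exact: mF].
move=> u _.
pose c := nm (toC (1, u)).
have c0 : 0 < c.
  by rewrite nm_gt0 /toC /=; apply/eqP => -[/eqP]; rewrite oner_eq0.
have nc x : nm (toC (x, x * u)) = `|x| * c by rewrite -nm_scale /= mulr1.
pose k x : \bar R := (`|x|%:E * g (x, x * u)%R)%E.
have mk : measurable_fun [set: R] k by exact: measurableT_comp (m1 g mg) (measurable_pair2 u).
have kk0 x : (0 <= k x)%E by rewrite mule_ge0 // lee_fin.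
(* The map is affine on each half-line, with intercept [- b] or [b]. Cutting [k] at 0 lets both
   affine substitutions run over the whole line, and the two halves add up to at most [k]. *)
pose kp := k \_ [set x | 0 < x]; pose kn := k \_ [set x | x < 0].
have mpos : measurable [set x : R | 0 < x].
  by rewrite (_ : [set x | _] = `]0, +oo[%classic) //; apply/seteqP; split=> x; rewrite /= in_itv /= andbT.
have mneg : measurable [set x : R | x < 0].
  by rewrite (_ : [set x | _] = `]-oo, 0[%classic) //; apply/seteqP; split=> x; rewrite /= in_itv.
have mkp : measurable_fun setT kp.
  by apply/(measurable_restrictT _ mpos); exact: (measurable_funS measurableT).
have mkn : measurable_fun setT kn.
  by apply/(measurable_restrictT _ mneg); exact: (measurable_funS measurableT).
have kp0 x : (0 <= kp x)%E by rewrite /kp patchE; case: ifP.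
have kn0 x : (0 <= kn x)%E by rewrite /kn patchE; case: ifP.
pose K := (1 + d / 2)^-1 * (1 + d).
have K0 : 0 <= K by rewrite mulr_ge0 ?(ltW d1).
pose b := d * r / c.
pose al x := (1 + d) * x + - b; pose be x := (1 + d) * x + b.
have mal : measurable_fun [set: R] al by apply: measurable_funD => //; exact: measurable_funM.
have mbe : measurable_fun [set: R] be by apply: measurable_funD => //; exact: measurable_funM.
have rad x : x != 0 -> radial d r (x, x * u) =
    (((1 + d) * `|x| - b) / `|x| * x, ((1 + d) * `|x| - b) / `|x| * x * u).
  move=> x0; rewrite /radial nc powR_inv1 ?mulr_ge0 ?(ltW c0) //=.
  have -> : 1 + d - d * r * (`|x| * c)^-1 = ((1 + d) * `|x| - b) / `|x|.
    by rewrite /b; field; rewrite normr_eq0 x0 gt_eqF.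
  by rewrite mulrA.
(* The Jacobian comparison, where the radius 3/4 enters: cleared of denominators it is
   [(1 + d) d r <= d (3/2 + d) y c], which follows from [y c >= 3/4], [r <= 1] and [d <= 1/8]. The
   factor [1 + d] of [K] is later cancelled by [affine_subst]. *)
have main y : 3 / 4 <= y * c -> 0 < (1 + d) * y - b /\ y <= K * ((1 + d) * y - b).
  move=> hy; have E : b * c = d * r by rewrite /b divfK ?gt_eqF.
  have P : 0 < (1 + d) * y - b.
    rewrite -(pmulr_lgt0 _ c0) mulrBl E.
    have : d * r <= d by rewrite ler_piMr // ltW.
    have : d * (3 / 4) <= d * (y * c) by rewrite ler_pM2l.
    by move: hy d8; clear; lra.
  split => //.
  rewrite /K -mulrA -(ler_pM2l d2) mulVKf ?gt_eqF // -(ler_pM2r c0) -!mulrA mulrBl E.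
  have : (1 + d) * (d * r) <= (1 + d) * d by rewrite ler_pM2l // ler_piMr // ltW.
  have : (3 / 2 + d) * (d * (3 / 4)) <= (3 / 2 + d) * (d * (y * c)).
    by rewrite ler_pM2l ?ler_pM2l // addr_gt0.
  have : d * d <= d * (1 / 8) by rewrite ler_pM2l.
  by move: d0; clear; lra.
have pt x : (`|x|%:E * h (x, x * u)%R <= K%:E * (kp (al x) + kn (be x)))%E.
  have R0 : (0 <= K%:E * (kp (al x) + kn (be x)))%E by rewrite mule_ge0 ?lee_fin ?adde_ge0.
  rewrite /h patchE; case: ifPn => hx; last by rewrite mule0.
  move: hx; rewrite inE => hx0; have {hx0}hx : 3 / 4 <= `|x| * c.
    by rewrite -nc leNgt; apply/negP => hlt; exact: (hx0 hlt).
  have x0 : x != 0.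
    by apply/eqP => E; move: hx; rewrite E normr0 mul0r; lra.
  have [P1 P2] := main _ hx.
  rewrite rad //; have [xp|xn] : 0 < x \/ x < 0.
  + by have [?|?|?] := ltgtP x 0; [right|left|subst; rewrite eqxx in x0].
  - rewrite (gtr0_norm xp) in P1 P2 *; rewrite divfK //.
    have -> : (1 + d) * x - b = al x by [].
    apply: (@le_trans _ _ (K%:E * kp (al x))%E); last first.
      by rewrite lee_wpmul2l ?lee_fin // leeDl.
    rewrite /kp patchE mem_set // /k muleA -EFinM lee_wpmul2r // lee_fin.
    by rewrite (gtr0_norm P1).
  - rewrite (ltr0_norm xn) in P1 P2 *.
    have -> : ((1 + d) * - x - b) / - x * x = be x.
      by rewrite /be; field; rewrite x0.
    have Eb : be x = - ((1 + d) * - x - b) by rewrite /be; ring.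
    have bn : be x < 0 by rewrite Eb oppr_lt0.
    apply: (@le_trans _ _ (K%:E * kn (be x))%E); last first.
      by rewrite lee_wpmul2l ?lee_fin // leeDr.
    rewrite /kn patchE mem_set // /k muleA -EFinM lee_wpmul2r // lee_fin.
    by rewrite (ltr0_norm bn) Eb opprK.
have mkpa : measurable_fun [set: R] (fun x => kp (al x)) by exact: measurableT_comp mkp mal.
have mknb : measurable_fun [set: R] (fun x => kn (be x)) by exact: measurableT_comp mkn mbe.
apply: (@le_trans _ _ (\int[mu]_x (K%:E * (kp (al x) + kn (be x))))%E).
  apply: ge0_le_integral => //.
  - by move=> x _; rewrite mule_ge0 // lee_fin.
  - exact: measurableT_comp (m1 h mh) (measurable_pair2 u).
  - by apply: emeasurable_funM; [exact: measurable_cst|exact: emeasurable_funD].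
rewrite ge0_integralZl_EFin //; last 2 first.
- by move=> x _; rewrite adde_ge0.
- exact: emeasurable_funD.
rewrite ge0_integralD // !affine_subst ?gt_eqF // -ge0_muleDr ?integral_ge0 //.
rewrite muleA -EFinM (gtr0_norm d1) mulfK ?gt_eqF //.
rewrite lee_wpmul2l ?lee_fin // -ge0_integralD //.
apply: ge0_le_integral => //.
- by move=> x _; rewrite adde_ge0.
- exact: emeasurable_funD.
move=> x _; rewrite /kp /kn !patchE.
case: ifPn => [|_]; last by rewrite add0e; case: ifP => _; [exact: lexx|exact: kk0].
rewrite inE /= => xp; rewrite ifF ?adde0 //.
by apply/negbTE/negP; rewrite inE /= => xn; move: (lt_trans xp xn); rewrite ltxx.
Qed.

End RadialContraction.

(** * The weighted inequalities between a function and its derivative *)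

Section WeightedNorms.
Context {R : realType}.
Local Notation C := R[i].
Local Notation nm := (cabs R).
Local Notation mu := (@lebesgue_measure R).
Local Notation mu2 := (mu \x mu)%E.
Implicit Types (f g : C -> C) (d r p a : R) (z w : R * R).

Definition Xw f p r a : \bar R :=
  (\int[mu2]_(z in Dr r) (modulus f z `^ p * (r - nm (toC z)) `^ a)%:E)%E.

Lemma Xw_ge0 f p r a : (0 <= Xw f p r a)%E.
Proof. by apply: integral_ge0 => z _; rewrite lee_fin mulr_ge0 ?powR_ge0. Qed.

Lemma Dr_sub r : r <= 1 -> @Dr R r `<=` Dr 1.
Proof. by move=> r1 z; rewrite /Dr /= => h; apply: lt_le_trans r1. Qed.

Lemma dist_measurable r a (D : set (R * R)) :
  measurable_fun D (fun z => (r - nm (toC z)) `^ a).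
Proof.
apply: (@measurableT_comp _ _ _ _ _ _ (@powR R ^~ a)); first exact: measurable_powR.
apply: measurable_funB; first exact: measurable_cst.
by apply: (measurable_funS measurableT) => //; exact: toC_measurable.
Qed.

Lemma deriv_powR_measurable f g p r : deriv_on_disc f g -> r <= 1 ->
  measurable_fun (Dr r) (fun z => modulus f z `^ p).
Proof.
move=> H r1; apply: modulus_powR_measurable; [|exact: Dr_sub|exact: Dr_measurable].
by move=> w; exact: (deriv_cont H).
Qed.

Lemma Xw_measurable f g p r a : deriv_on_disc f g -> r <= 1 ->
  measurable_fun (Dr r) (fun z => modulus f z `^ p * (r - nm (toC z)) `^ a).
Proof.
move=> H r1; apply: measurable_funM; last exact: dist_measurable.
exact: deriv_powR_measurable H r1.
Qed.

Lemma mu2_Dr r : r <= 1 -> (mu2 (@Dr R r) < +oo)%E.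
Proof.
move=> r1; apply: (@le_lt_trans _ _ (mu2 (sq (0, 0) 1))).
  apply: le_measure; rewrite ?inE; [exact: Dr_measurable|exact: sq_measurable|].
  move=> z; rewrite /Dr /= => hz; apply/sqP; rewrite /= !subr0.
  have := Re_le_nm (toC z); have := Im_le_nm (toC z); rewrite {1 3}/toC /=; lra.
by rewrite mu2_sq ?ltry.
Qed.

Lemma Xw_fin f g p r a : 0 < p -> deriv_on_disc f g -> r < 1 -> 0 <= a ->
  (Xw f p r a < +oo)%E.
Proof.
move=> p0 H r1 a0.
have [S S0 HS] := @bounded_closed_disc R f r r1 (fun w : C => deriv_cont (z := w) H).
apply: (@le_lt_trans _ _ (\int[mu2]_(z in Dr r) (cst (S `^ p)%:E z))%E).
  apply: ge0_le_integral => //.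
  - exact: Dr_measurable.
  - by move=> z _; rewrite lee_fin mulr_ge0 ?powR_ge0.
  - by apply/measurable_EFinP; apply: Xw_measurable H _; exact: ltW.
  move=> z hz; rewrite lee_fin -[X in _ <= X]mulr1; apply: ler_pM; rewrite ?powR_ge0 //.
    by apply: ler_powRl => //; [exact: modulus_ge0|apply: HS; exact: ltW].
  have [->|] := eqVneq a 0; first by rewrite powRr0.
  move=> an0; have one : 1 = 1 `^ a :> R by rewrite powR1.
  rewrite {}one.
  apply: ler_powRl; first by rewrite lt_neqAle eq_sym an0.
    by rewrite subr_ge0 ltW.
  by have := nm_ge0 (toC z); move: r1; clear; lra.
rewrite integral_cst; last exact: Dr_measurable.
apply: lte_mul_pinfty; [by rewrite lee_fin powR_ge0|by []|].
by apply: mu2_Dr; exact: ltW.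
Qed.

Lemma disc_room (m : nat) r z : (0 < m)%N -> r <= 1 -> Dr r z ->
  0 < wdelta m * (r - nm (toC z)) /\ nm (toC z) + 4 * (wdelta m * (r - nm (toC z))) < 1.
Proof.
move=> m0 r1 hz; have /andP[w0 w8] := @wdelta_bounds R m m0.
have t0 : 0 < r - nm (toC z) by rewrite subr_gt0.
split; first by rewrite mulr_gt0.
have : wdelta m * (r - nm (toC z)) <= 1 / 8 * (r - nm (toC z)) by rewrite ler_pM2r.
by move: t0 r1; clear; lra.
Qed.

Lemma powR_wM (x y a : R) : 0 < x -> 0 <= y -> (x * y) `^ a = x `^ a * y `^ a.
Proof. by move=> x0 y0; rewrite powRM // ltW. Qed.

(* |g|^p is dominated by the average of |f|^p over a square of side comparable
   to the distance to the boundary. *)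
Lemma deriv_weighted (p : R) (k : nat) : 0 < p -> exists2 K, 0 <= K &
  forall f g r, deriv_on_disc f g -> 0 < r < 1 ->
  (Xw g p r (k.+1%:R * p) <= K%:E * Xw f p r (k%:R * p))%E.
Proof.
(* [k.+1] keeps the scale meaningful for [k = 0]. The resulting constant grows with [k], which is
   harmless: the lemma serves only to bound the term with [F]. *)
move=> p0; pose m := k.+1; have m0 : (0 < m)%N by [].
have /andP[w0 w8] := @wdelta_bounds R m m0.
pose K1 := 2 `^ p * HLc p * wdelta m `^ (- p) / wdelta m ^+ 2.
have K10 : 0 <= K1.
  by rewrite divr_ge0 ?mulr_ge0 ?powR_ge0 ?exprn_ge0 ?(ltW w0) ?(ltW (HLc_gt0 _)).
have K20 : 0 <= 256 * 2 `^ p * wdelta m ^+ 2 :> R.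
  apply: mulr_ge0; last exact/exprn_ge0/ltW.
  by apply: mulr_ge0; [exact: ler0n|exact: powR_ge0].
exists (K1 * (256 * 2 `^ p * wdelta m ^+ 2)); first exact: mulr_ge0.
move=> f g r H /andP[r0 r1]; have [g1 Hg] := deriv_exists H.
have am : 0 <= k%:R * p <= m%:R * p.
  by rewrite mulr_ge0 ?(ltW p0) //= ler_pM2r // ler_nat.
pose phi z := modulus f z `^ p.
have mphi : measurable_fun (Dr r) phi.
  exact: deriv_powR_measurable H (ltW r1).
have pt z : Dr r z -> ((modulus g z `^ p * (r - nm (toC z)) `^ (k.+1%:R * p))%:E <=
    K1%:E * (((r - nm (toC z)) `^ (k%:R * p - 2))%:E *
     \int[mu2]_(w in sq z (2 * (wdelta m * (r - nm (toC z))))) (phi w)%:E))%E.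
  move=> hz; have [d0 hd] := disc_room m0 (ltW r1) hz.
  have t0 : 0 < r - nm (toC z) by rewrite subr_gt0.
  have := pw_deriv p0 H d0 hd; rewrite -/(Ip f p _).
  set t := r - nm (toC z) in t0 d0 hd *.
  case: (Ip f p _) (Ip_ge0 f p (sq z (2 * (wdelta m * t)))) => [I| |] //.
    rewrite -!EFinM !lee_fin => I0 h.
    rewrite powR_sub2 // -natr1 mulrDl mul1r powRD; last by rewrite (gt_eqF t0) implybT.
    rewrite -(ler_pM2r (exprn_gt0 2 d0)) -(ler_pM2l (powR_gt0 p w0)).
    apply: (@le_trans _ _ (t `^ (k%:R * p) * ((modulus g z * (wdelta m * t)) `^ p * (wdelta m * t) ^+ 2))).
      rewrite (powRM _ (modulus_ge0 _ _)) ?(ltW d0) // (powR_wM _ w0 (ltW t0)).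
      by rewrite le_eqVlt; apply/orP; left; apply/eqP; ring.
    apply: (@le_trans _ _ (t `^ (k%:R * p) * (2 `^ p * HLc p * I))).
      by rewrite ler_wpM2l ?powR_ge0.
    rewrite /K1 powRN le_eqVlt; apply/orP; left; apply/eqP; field.
    by rewrite !gt_eqF // powR_gt0.
  have K1p : 0 < K1 by rewrite divr_gt0 ?mulr_gt0 ?powR_gt0 ?exprn_gt0 ?HLc_gt0.
  by move=> _ _; rewrite !gt0_muley ?leey ?lte_fin ?powR_gt0.
have [mF W] := whitney_tonelli m0 p0 am (fun z => powR_ge0 (modulus f z) p) mphi.
have F0 z : (0 <= ((r - nm (toC z)) `^ (k%:R * p - 2))%:E *
     \int[mu2]_(w in sq z (2 * (wdelta m * (r - nm (toC z))))) (phi w)%:E)%E.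
  by rewrite mule_ge0 ?lee_fin ?powR_ge0 //; exact: Ip_ge0.
rewrite EFinM -muleA; apply: le_trans (lee_wpmul2l _ W); last by rewrite lee_fin.
rewrite -ge0_integralZl_EFin //; last exact: Dr_measurable.
apply: ge0_le_integral => //.
- exact: Dr_measurable.
- by move=> z _; rewrite lee_fin mulr_ge0 ?powR_ge0.
- by apply/measurable_EFinP; exact: Xw_measurable Hg (ltW r1).
- by apply: emeasurable_funM; first exact: measurable_cst.
Qed.

(** The two regimes of [decay_step]: for [k = 0] only the Jacobian gains, by
    [1 / (1 + 1/16) = 16/17]; for [k > 0] the weight gains, since [k * wdelta k.+1 >= 1/16] and
    Bernoulli's inequality give [(16/17)^p]. *)
Definition decay p : R := Num.max (16 / 17) ((16 / 17) `^ p).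

Lemma decay_lt1 p : 0 < p -> 0 < decay p < 1.
Proof.
move=> p0; rewrite /decay lt_max gt_max divr_gt0 //=.
have l1 : 16 / 17 < 1 :> R by lra.
rewrite l1 /=; have := @gt0_ltr_powR R p p0 (16 / 17) 1.
by rewrite !nnegrE powR1; apply => //; lra.
Qed.

Lemma decay_step p (k : nat) : 0 < p ->
  (1 + wdelta k.+1) `^ (- (k%:R * p)) * (1 + wdelta k.+1 / 2)^-1 <= decay p.
Proof.
move=> p0; have /andP[w0 w8] := @wdelta_bounds R k.+1 isT.
have l1 : 1 < 1 + wdelta k.+1 :> R by rewrite ltrDl.
have i1 : (1 + wdelta k.+1 / 2 : R)^-1 <= 1 by rewrite invf_le1; lra.
have i0 : 0 <= (1 + wdelta k.+1 / 2 : R)^-1 by rewrite invr_ge0; lra.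
case: k w0 w8 l1 i1 i0 => [|k] w0 w8 l1 i1 i0.
  rewrite mul0r oppr0 powRr0 mul1r /decay le_max; apply/orP; left.
  by rewrite /wdelta mulr1 (_ : 16 / 17 = (1 + 8^-1 / 2)^-1) //; field.
rewrite /decay le_max; apply/orP; right.
rewrite -[X in _ <= X]mulr1; apply: ler_pM => //; first exact: powR_ge0.
rewrite -mulrN mulrC mulNr powRN powRrM.
have B : 17 / 16 <= (1 + wdelta k.+2) ^+ k.+1 :> R.
  have Be (x : R) n : 0 <= x -> 1 + n%:R * x <= (1 + x) ^+ n.
    move=> x0; elim: n => [|n IH]; first by rewrite mul0r addr0 expr0.
    rewrite exprS; apply: (@le_trans _ _ ((1 + x) * (1 + n%:R * x))); last first.
      by rewrite ler_wpM2l // addr_ge0.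
    rewrite -natr1; have : 0 <= n%:R * x * x by rewrite !mulr_ge0.
    by move: (x0); clear; lra.
  apply: le_trans (Be _ k.+1 (ltW w0)).
  pose n : R := k%:R; have n0 : 0 <= n by [].
  have E1 : k.+1%:R = n + 1 :> R by rewrite -addn1 natrD.
  have E2 : k.+2%:R = n + 2 :> R by rewrite -addn2 natrD.
  rewrite /wdelta E1 E2 (_ : 17 / 16 = 1 + 1 / 16); last by field.
  by rewrite lerD2l ler_pdivlMr; lra.
rewrite [X in (X)^-1](_ : _ = ((1 + wdelta k.+2) ^+ k.+1) `^ p); last first.
  by rewrite -powRrM [p * _]mulrC powRrM powR_mulrn // ltW // (lt_trans ltr01).
rewrite -powR_inv1 ?powR_ge0 // -powRrM mulrC powRrM powR_inv1; last first.
  by rewrite exprn_ge0 // ltW // (lt_trans ltr01).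
apply: ler_powRl => //; first by rewrite invr_ge0 exprn_ge0 // ltW // (lt_trans ltr01).
by rewrite -[16 / 17]invf_div lef_pV2 ?posrE // exprn_gt0 // (lt_trans ltr01).
Qed.

(** Compare [c] with [eta * b]. It holds for every [p > 0], and the coefficient of [b ^ p] can be
    taken arbitrarily close to 1, as the absorption in the Hardy inequality demands. *)
Lemma split_powR (p eta a b c : R) : 0 < p -> 0 < eta -> 0 <= a -> 0 <= b -> 0 <= c ->
  a <= b + c -> a `^ p <= (1 + eta) `^ p * b `^ p + (1 + eta^-1) `^ p * c `^ p.
Proof.
move=> p0 e0 a0 b0 c0 h; have e1 : 0 < 1 + eta by rewrite addr_gt0.
have e2 : 0 < 1 + eta^-1 by rewrite addr_gt0 ?invr_gt0.
rewrite -!powRM ?(ltW e1) ?(ltW e2) //.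
have [cb|bc] := leP c (eta * b).
  apply: (@le_trans _ _ (((1 + eta) * b) `^ p)); last by rewrite lerDl powR_ge0.
  by apply: ler_powRl => //; apply: (le_trans h); rewrite mulrDl mul1r lerD2l.
apply: (@le_trans _ _ (((1 + eta^-1) * c) `^ p)); last by rewrite lerDr powR_ge0.
apply: ler_powRl => //; apply: (le_trans h); rewrite mulrDl mul1r addrC lerD2l.
by rewrite ler_pdivlMl // ltW.
Qed.

Lemma radial_facts d r z : 0 < d <= 1 / 8 -> 0 < r <= 1 -> 3 / 4 <= nm (toC z) < r ->
  sq z (d * (r - nm (toC z))) (radial d r z) /\
  r - nm (toC (radial d r z)) = (1 + d) * (r - nm (toC z)).
Proof.
move=> /andP[d0 d8] /andP[r0 r1] /andP[s34 sr].
pose l := 1 + d - d * r * nm (toC z) `^ (-1).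
have -> : radial d r z = (l * z.1, l * z.2) by [].
set s := nm (toC z) in s34 sr *.
have s0 : 0 < s by move: s34; clear; lra.
have El : l = 1 - d * (r - s) / s.
  by rewrite /l -/s powR_inv1 ?(ltW s0) //; field; rewrite gt_eqF.
have q : d * (r - s) / s <= 1.
  rewrite ler_pdivrMr // mul1r; have : d * (r - s) <= 1 / 8 * (r - s) by rewrite ler_pM2r // subr_gt0.
  by move: s34 r1; clear; lra.
have l0 : 0 <= l by rewrite El subr_ge0.
split; last first.
  by rewrite nm_scale -/s ger0_norm // El; field; rewrite gt_eqF.
have k0 : 0 <= d * (r - s) by rewrite mulr_ge0 ?(ltW d0) // subr_ge0 ltW.
have E (x : R) : `|x| <= s -> `|l * x - x| <= d * (r - s).
  move=> hx; rewrite -{2}[x]mul1r -mulrBl El addrAC subrr add0r normrM normrN.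
  rewrite (@ger0_norm _ (d * (r - s) / s)) ?divr_ge0 ?(ltW s0) //.
  rewrite mulrAC ler_pdivrMr // ler_wpM2l //.
apply/sqP; split => /=; apply: E; [exact: (Re_le_nm (toC z))|exact: (Im_le_nm (toC z))].
Qed.

Lemma wdeltaE (k : nat) p : (wdelta k.+1 : R) `^ p = 8 `^ (- p) * k.+1%:R `^ (- p).
Proof.
by rewrite /wdelta -powR_inv1 ?mulr_ge0 // -powRrM mulN1r powRM.
Qed.

(* Comparing f at z with f at the radially contracted point bounds the integral
   over Dr r by itself times a factor below 1, plus terms with g; as the integral is
   finite for r < 1, it can be absorbed. *)
Lemma hardy_step p : 0 < p -> exists2 K, 0 < K &
  forall (k : nat) f g r, deriv_on_disc f g -> 0 < r < 1 ->
  (Xw f p r (k%:R * p) <= K%:E * (Ip f p (Dr (3 / 4)) +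
     (k.+1%:R `^ (- p))%:E * Xw g p r (k.+1%:R * p)))%E.
Proof.
move=> p0; have /andP[D0 D1] := decay_lt1 p0.
(* [th] is halfway between [decay p] and 1, and [eta] is tuned so that [(1 + eta)^p * decay p = th]:
   splitting the increment off uses up half of the margin. *)
pose th := (1 + decay p) / 2.
have th1 : 0 < 1 - th by rewrite /th; move: D1; clear; lra.
pose eta := (th / decay p) `^ p^-1 - 1.
have ratio : 1 < th / decay p by rewrite ltr_pdivlMr // mul1r /th; move: D1; clear; lra.
have eta0 : 0 < eta.
  rewrite subr_gt0; have := @gt0_ltr_powR R p^-1 _ 1 (th / decay p).
  by rewrite invr_gt0 !nnegrE powR1 => /(_ p0); apply => //; apply: ltW; apply: lt_trans ratio.
have etap : (1 + eta) `^ p * decay p = th.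
  rewrite /eta addrC subrK powR_rootK //; last by apply: ltW; apply: lt_trans ratio.
  by rewrite divfK // gt_eqF.
pose c2 := (1 + eta^-1) `^ p * (2 `^ p * HLc p).
have c20 : 0 < c2.
  by rewrite !mulr_gt0 ?powR_gt0 ?HLc_gt0 // addr_gt0 // invr_gt0.
pose c3 := c2 * (256 * 2 `^ p) * 8 `^ (- p).
have c256 : 0 < 256 * 2 `^ p :> R by rewrite mulr_gt0 ?ltr0n ?powR_gt0.
have c30 : 0 < c3.
  by apply: mulr_gt0; [exact: mulr_gt0|exact: powR_gt0].
exists ((1 - th)^-1 * (1 + c3)); first by rewrite mulr_gt0 ?invr_gt0 // addr_gt0.
move=> k f g r H /andP[r0 r1]; have [g1 Hg] := deriv_exists H.
pose m := k.+1; have m0 : (0 < m)%N by [].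
have /andP[w0 w8] := @wdelta_bounds R m m0; set de := wdelta m in w0 w8.
have am : 0 <= m%:R * p <= m%:R * p by rewrite mulr_ge0 ?(ltW p0) //=.
pose phi z := modulus g z `^ p.
have mphi : measurable_fun (Dr r) phi by exact: deriv_powR_measurable Hg (ltW r1).
pose F z := (((r - nm (toC z)) `^ (m%:R * p - 2))%:E *
     \int[mu2]_(w in sq z (2 * (wdelta m * (r - nm (toC z))))) (phi w)%:E)%E.
have F0 z : (0 <= F z)%E.
  by rewrite /F mule_ge0 ?lee_fin ?powR_ge0 //; exact: Ip_ge0.
pose wf z := (modulus f z `^ p * (r - nm (toC z)) `^ (k%:R * p))%:E.
pose G := wf \_ (Dr r).
have mwf : measurable_fun (Dr r) wf by apply/measurable_EFinP; exact: Xw_measurable H (ltW r1).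
have mG : measurable_fun setT G by apply/(measurable_restrictT _ (Dr_measurable r)).
have wf0 z : (0 <= wf z)%E by rewrite lee_fin mulr_ge0 ?powR_ge0.
have G0 z : (0 <= G z)%E by rewrite /G patchE; case: ifP.
have m34 : measurable (Dr (3 / 4) : set (R * R)) by exact: Dr_measurable.
have m34c : measurable (~` Dr (3 / 4) : set (R * R)) by exact: measurableC.
(* [h1] takes care of [|z| < 3/4], where the weight is at most 1; [h2] holds the contracted
   integrand elsewhere. *)
pose h1 := (fun z => (modulus f z `^ p)%:E) \_ (Dr (3 / 4)).
pose h2 := (fun z => G (radial de r z)) \_ (~` Dr (3 / 4)).
have mh1 : measurable_fun setT h1.
  apply/(measurable_restrictT _ m34); apply/measurable_EFinP.
  by apply: deriv_powR_measurable H _; clear; lra.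
have mh2 : measurable_fun setT h2.
  apply/(measurable_restrictT _ m34c).
  have mGr := measurableT_comp mG (radial_measurable de r).
  exact: measurable_funS measurableT (@subsetT _ _) mGr.
have h10 z : (0 <= h1 z)%E by rewrite /h1 patchE; case: ifP => // _; rewrite lee_fin powR_ge0.
have h20 z : (0 <= h2 z)%E by rewrite /h2 patchE; case: ifP.
pose c1 := (1 + eta) `^ p * (1 + de) `^ (- (k%:R * p)).
have c10 : 0 <= c1 by rewrite mulr_ge0 ?powR_ge0.
pose K2 := c2 * de `^ p / de ^+ 2.
have K20 : 0 < K2 by rewrite /K2 divr_gt0 ?exprn_gt0 // mulr_gt0 ?powR_gt0.
have de8 : 0 < de <= 1 / 8 by rewrite w0.
have rr : 0 < r <= 1 by rewrite r0 ltW.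
have pt z : Dr r z -> (wf z <= h1 z + (c1%:E * h2 z + K2%:E * F z))%E.
  move=> hz; have R0 : (0 <= c1%:E * h2 z + K2%:E * F z)%E.
    by rewrite adde_ge0 // mule_ge0 // lee_fin ltW.
  have t0 : 0 < r - nm (toC z) by rewrite subr_gt0.
  have tle : (r - nm (toC z)) `^ (k%:R * p) <= 1.
    rewrite -[X in _ <= X](powRr0 (r - nm (toC z))); apply: ger_powR.
      by rewrite t0; have := nm_ge0 (toC z); move: r1; clear; lra.
    by rewrite mulr_ge0 // ltW.
  have [s34|s34] := ltP (nm (toC z)) (3 / 4).
    apply: (@le_trans _ _ (h1 z)); last by rewrite leeDl.
    rewrite /h1 patchE mem_set // /wf lee_fin -[X in _ <= X]mulr1.
    by rewrite ler_wpM2l ?powR_ge0.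
  apply: (@le_trans _ _ (c1%:E * h2 z + K2%:E * F z)%E); last by rewrite leeDr.
  have zr : 3 / 4 <= nm (toC z) < r by rewrite s34.
  have [sqz tz] := radial_facts de8 rr zr.
  set z' := radial de r z in sqz tz *.
  have Dz' : Dr r z'.
    by rewrite /Dr /= -subr_gt0 tz mulr_gt0 // addr_gt0.
  have [d0 hd] := disc_room m0 (ltW r1) hz.
  have PD := pw_diff p0 H d0 hd sqz.
  have -> : h2 z = wf z'.
    rewrite /h2 patchE mem_set; last by move=> h; move: s34; rewrite leNgt h.
    by rewrite -/z' /G patchE mem_set.
  rewrite /F -/(Ip g p _) -/de; rewrite -/de in d0 hd PD.
  set t := r - nm (toC z) in t0 tle d0 hd PD tz *.
  case EI : (Ip g p _) PD (Ip_ge0 g p (sq z (2 * (de * t)))) => [I| |] // PD I0; last first.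
    by rewrite !gt0_muley ?lte_fin ?powR_gt0 // addey ?leey // -EFinM.
  move: PD I0; rewrite -!EFinM -!EFinD !lee_fin => PD I0.
  have tri : modulus f z <= modulus f z' + nm (f (toC z') - f (toC z)).
    have := nm_subl (f (toC z)) (f (toC z')); rewrite /modulus (nmB (f (toC z))).
    by clear; lra.
  have sp := split_powR p0 eta0 (modulus_ge0 _ _) (modulus_ge0 _ _) (nm_ge0 _) tri.
  have sp2 := ler_wpM2r (powR_ge0 t (k%:R * p)) sp.
  apply: (le_trans sp2); rewrite mulrDl; apply: lerD.
    rewrite tz powRM ?(ltW t0) //; last by rewrite addr_ge0 // ltW.
    rewrite le_eqVlt; apply/orP; left; apply/eqP; rewrite /c1.
    rewrite powRN; field; rewrite gt_eqF // powR_gt0 // addr_gt0 //.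
  rewrite powR_sub2 // -natr1 mulrDl mul1r powRD; last by rewrite (gt_eqF t0) implybT.
  have d20 : 0 < (de * t) ^+ 2 by rewrite exprn_gt0.
  rewrite -ler_pdivlMr // in PD.
  apply: (@le_trans _ _ ((1 + eta^-1) `^ p * (2 `^ p * HLc p * (de * t) `^ p * I / (de * t) ^+ 2)
    * t `^ (k%:R * p))).
    by rewrite ler_wpM2r ?powR_ge0 // ler_wpM2l ?powR_ge0.
  rewrite (powR_wM _ w0 (ltW t0)) /K2 /c2 le_eqVlt; apply/orP; left; apply/eqP; field.
  by rewrite !gt_eqF.
have B : (Xw f p r (k%:R * p) <= Ip f p (Dr (3 / 4)) + (c1%:E * (((1 + de / 2)^-1)%:E *
    Xw f p r (k%:R * p)) + K2%:E * ((256 * 2 `^ p * de ^+ 2)%:E * Xw g p r (m%:R * p))))%E.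
  have [mF W] : measurable_fun (Dr r) F /\ (\int[mu2]_(z in Dr r) F z <=
      (256 * 2 `^ p * de ^+ 2)%:E * Xw g p r (m%:R * p))%E.
    exact: (whitney_tonelli m0 p0 am (fun z => powR_ge0 (modulus g z) p) mphi).
  apply: (@le_trans _ _ (\int[mu2]_(z in Dr r) (h1 z + (c1%:E * h2 z + K2%:E * F z)))%E).
    apply: ge0_le_integral => //; first exact: Dr_measurable.
      by move=> z _; exact: wf0.
    apply: emeasurable_funD; first exact: (measurable_funS measurableT).
    apply: emeasurable_funD; apply: emeasurable_funM => //.
    exact: (measurable_funS measurableT).
  have mh2' : measurable_fun (Dr r) h2 by exact: (measurable_funS measurableT).
  have p2 z : Dr r z -> (0 <= c1%:E * h2 z)%E by move=> _; rewrite mule_ge0 // lee_fin.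
  have p3 z : Dr r z -> (0 <= K2%:E * F z)%E.
    by move=> _; rewrite mule_ge0 // lee_fin ltW.
  have q2 : measurable_fun (Dr r) (fun z => c1%:E * h2 z)%E.
    by apply: emeasurable_funM.
  have q3 : measurable_fun (Dr r) (fun z => K2%:E * F z)%E.
    by apply: emeasurable_funM.
  have mD := @Dr_measurable R r.
  rewrite ge0_integralD //; last 3 first.
  - exact: (measurable_funS measurableT).
  - by move=> z hz; rewrite adde_ge0 ?p2 ?p3.
  - exact: emeasurable_funD.
  apply: leeD.
    rewrite /Ip [X in (_ <= X)%E]integral_mkcond -/h1.
    by apply: ge0_subset_integral.
  rewrite ge0_integralD //; apply: leeD.
    rewrite ge0_integralZl_EFin // lee_wpmul2l ?lee_fin //.
    have IG : (\int[mu2]_z G z = Xw f p r (k%:R * p))%E by rewrite /G -integral_mkcond.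
    rewrite -{}IG; apply: le_trans (radial_contraction de8 rr mG G0).
    rewrite [X in (_ <= X)%E]integral_mkcond -/h2.
    by apply: ge0_subset_integral.
  rewrite ge0_integralZl_EFin ?(ltW K20) // lee_wpmul2l ?lee_fin ?(ltW K20) //.
have Xfin := Xw_fin p0 H r1 (_ : 0 <= k%:R * p).
have {}Xfin : (Xw f p r (k%:R * p) < +oo)%E by apply: Xfin; rewrite mulr_ge0 // ltW.
move: B Xfin (Xw_ge0 f p r (k%:R * p)) (Xw_ge0 g p r (m%:R * p)) (Ip_ge0 f p (Dr (3 / 4))).
have K0 : 0 < (1 - th)^-1 * (1 + c3) by rewrite mulr_gt0 ?invr_gt0 // addr_gt0.
rewrite -/m; case: (Xw f p r _) => [x| |] //; case: (Ip f p _) => [i| |] //; last first.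
  move=> _ _ _ X1 _; rewrite addye ?gt0_muley ?leey ?lte_fin //.
  have n0 : (0 <= (m%:R `^ (- p))%:E * Xw g p r (m%:R * p))%E.
    by rewrite mule_ge0 // lee_fin powR_ge0.
  by rewrite gt_eqF // (lt_le_trans _ n0).
case: (Xw g p r _) => [y| |] //; last first.
  move=> _ _ _ _ _; rewrite [X in (_ + X)%E]gt0_muley ?lte_fin ?powR_gt0 ?ltr0n //.
  by rewrite addey // gt0_muley ?leey ?lte_fin.
rewrite -!EFinM -!EFinD -?EFinM !lee_fin => B _ x0 y0 i0.
have cth : c1 * (1 + de / 2)^-1 <= th.
  by rewrite /c1 -mulrA -etap ler_wpM2l ?powR_ge0 // decay_step.
(* The gain appears here: [de ^ p] is [8 ^ (- p) * m ^ (- p)], while the [de ^ 2] from the Tonelli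
   bound cancels the one in [K2]. *)
have E3 : K2 * (256 * 2 `^ p * de ^+ 2 * y) = c3 * (m%:R `^ (- p) * y).
  have Ew : de `^ p = 8 `^ (- p) * m%:R `^ (- p) by exact: wdeltaE.
  by rewrite /K2 Ew /c3; field; rewrite gt_eqF.
have B1 : x * (1 - th) <= i + c3 * (m%:R `^ (- p) * y).
  have : c1 * ((1 + de / 2)^-1 * x) <= th * x by rewrite mulrA ler_wpM2r.
  by move: B; rewrite E3; clear; lra.
rewrite -mulrA ler_pdivlMl // mulrC; apply: (le_trans B1).
have my : 0 <= m%:R `^ (- p) * y by rewrite mulr_ge0 ?powR_ge0.
have := mulr_ge0 (ltW c30) i0; move: my; clear; lra.
Qed.

End WeightedNorms.

(** * Solutions of the differential equation *)

Section Assembly.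
Context {R : realType}.
Local Notation C := R[i].
Local Notation nm := (cabs R).
Local Notation mu := (@lebesgue_measure R).
Local Notation mu2 := (mu \x mu)%E.
Implicit Types (f g : C -> C) (r p a : R).

Lemma nm_sum (I : Type) (s : seq I) (P : pred I) (F : I -> C) :
  nm (\sum_(i <- s | P i) F i) <= \sum_(i <- s | P i) nm (F i).
Proof.
elim/big_ind2: _ => [|x u y v h1 h2|//]; first by rewrite nm0.
by apply: (le_trans (nmD _ _)); exact: lerD.
Qed.

(* The weights 2^j keep the constant independent of the number of terms. *)
Lemma sum_powR p (N : nat) (b : nat -> R) : 0 < p -> (forall j, 0 <= b j) ->
  (\sum_(j < N) b j) `^ p <= 2 `^ p * \sum_(j < N) (2 ^+ j * b j) `^ p.
Proof.
move=> p0; elim: N b => [|N IH] b b0.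
  by rewrite !big_ord0 powR0 ?gt_eqF // mulr0.
rewrite !big_ord_recl expr0 mul1r.
set S := \sum_(i < N) b (bump 0 i).
have S0 : 0 <= S by apply: sumr_ge0.
have IHb : S `^ p <= 2 `^ p * \sum_(j < N) (2 ^+ j * b j.+1) `^ p.
  by apply: (IH (fun j => b j.+1)).
apply: (@le_trans _ _ (2 `^ p * (b 0%N `^ p + S `^ p))).
  have max2 x y : 0 <= x -> 0 <= y -> x <= y -> (x + y) `^ p <= 2 `^ p * (x `^ p + y `^ p).
    move=> x0 y0 xy; apply: (@le_trans _ _ ((2 * y) `^ p)).
      by apply: ler_powRl => //; [exact: addr_ge0|move: xy; clear; lra].
    by rewrite powRM // ler_wpM2l ?powR_ge0 // lerDr powR_ge0.
  have [h|/ltW h] := leP (b 0%N) S; first exact: max2.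
  by rewrite addrC [X in _ * X]addrC; exact: max2.
rewrite ler_wpM2l ?powR_ge0 // lerD2l; apply: (le_trans IHb).
rewrite mulr_sumr; apply: ler_sum => j _.
by rewrite -powRM ?mulr_ge0 ?exprn_ge0 // mulrA -exprS.
Qed.

(** Beyond [N > x] every further factor [x] is beaten by the new factor of the factorial; up to [N]
    the powers are at most [X ^ N]. *)
Lemma factorial_dominates (x : R) : 0 <= x ->
  exists2 E, 0 < E & forall j : nat, x ^+ j <= E * (j`!)%:R.
Proof.
move=> x0; pose N := Num.bound x; pose X := Num.max 1 x.
have X1 : 1 <= X by rewrite le_max lexx.
have xX : x <= X by rewrite le_max lexx orbT.
have X0 : 0 < X by apply: lt_le_trans X1.
have xN : x < N%:R by have := archi_boundP x0.
exists (X ^+ N); first exact: exprn_gt0.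
elim=> [|j IH]; first by rewrite expr0 fact0 mulr1 exprn_ege1.
have [jN|Nj] := leqP j.+1 N.
  apply: (@le_trans _ _ (X ^+ N)).
    apply: (@le_trans _ _ (X ^+ j.+1)); first by rewrite lerXn2r ?nnegrE // ltW.
    exact: ler_weXn2l.
  by rewrite ler_peMr ?exprn_ge0 ?(ltW X0) // ler1n fact_gt0.
rewrite exprS factS natrM mulrCA; apply: ler_pM => //; first exact: exprn_ge0.
by apply: (le_trans (ltW xN)); rewrite ler_nat ltnW.
Qed.

Lemma geometric_bound (x : R) n : 0 <= x < 1 -> \sum_(j < n) x ^+ j.+1 <= (1 - x)^-1.
Proof.
move=> /andP[x0 x1]; have d0 : 0 < 1 - x by rewrite subr_gt0.
rewrite -[X in _ <= X]mul1r ler_pdivlMr // mulr_suml.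
have : \sum_(j < n) x ^+ j.+1 * (1 - x) = x - x ^+ n.+1.
  elim: n => [|n IH]; first by rewrite big_ord0 expr1 subrr.
  by rewrite big_ord_recr /= IH [x ^+ n.+2]exprS; ring.
move=> ->; have := exprn_ge0 n.+1 x0; move: x1; clear; lra.
Qed.

Lemma Iter_op_deriv (F : cfun R) (F1 : C -> C) : deriv_on_disc F F1 ->
  forall i, deriv_on_disc (Iter_op R i.+1 F) (Iter_op R i F).
Proof.
move=> H; elim=> [|i IH]; first exact: Iop_deriv H.
exact: Iop_deriv IH.
Qed.

Lemma Xw_zero f g p r : 0 < p -> deriv_on_disc f g -> r <= 1 ->
  Xw f p r 0 = Ip f p (Dr r).
Proof. by move=> p0 H r1; apply: eq_integral => z _; rewrite powRr0 mulr1. Qed.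

(** [F] is reached from its [n]-th iterated primitive by [n] differentiations, each raising the
    weight exponent by [p], from 0 to [n * p]. *)
Lemma Xw_Iter_op p n (F : cfun R) (F1 : C -> C) : 0 < p -> deriv_on_disc F F1 ->
  (Ip (Iter_op R n F) p (Dr 1) < +oo)%E ->
  exists2 K, 0 <= K & forall r, 0 < r < 1 -> (Xw F p r (n%:R * p) <= K%:E)%E.
Proof.
move=> p0 H fin.
have D j : exists F1, deriv_on_disc (Iter_op R j F) F1.
  by case: j => [|j]; [exists F1|eexists; exact: Iter_op_deriv H j].
suff main i : (i <= n)%N -> exists2 K, 0 <= K &
    forall r, 0 < r < 1 -> (Xw (Iter_op R (n - i) F) p r (i%:R * p) <= K%:E)%E.
  by have := main n (leqnn n); rewrite subnn.
elim: i => [_|i IH lin].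
  have [F2 H2] := D n; rewrite subn0.
  have If0 := Ip_ge0 (Iter_op R n F) p (Dr 1).
  exists (fine (Ip (Iter_op R n F) p (Dr 1))); first exact: fine_ge0.
  move=> r /andP[r0 r1]; rewrite fineK ?ge0_fin_numE // mul0r.
  rewrite (Xw_zero p0 H2 (ltW r1)); apply: Ip_subset H2 _ _ _ _ => //; try exact: Dr_measurable.
  exact/Dr_sub/ltW.
have [K K0 HK] := IH (ltnW lin).
have [K' K'0 HK'] := deriv_weighted i p0.
exists (K' * K); first exact: mulr_ge0.
move=> r hr; have E : (n - i)%N = (n - i.+1).+1 by rewrite subnSK.
have := HK' _ _ _ (Iter_op_deriv H (n - i.+1)) hr; rewrite -E => h.
apply: (le_trans h); rewrite EFinM lee_wpmul2l ?lee_fin //.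
exact: HK.
Qed.

End Assembly.

(** * The equation at a point, and convergence of the majorant *)

Section Core.
Context {R : realType}.
Local Notation C := R[i].
Local Notation nm := (cabs R).
Local Notation mu := (@lebesgue_measure R).
Local Notation mu2 := (mu \x mu)%E.
Implicit Types (r p : R).

Lemma powR_weight p (x t : R) (m : nat) : 0 <= x -> 0 <= t ->
  x `^ p * t `^ (m%:R * p) = (x * t ^+ m) `^ p.
Proof. by move=> x0 t0; rewrite powRM ?exprn_ge0 // powRrM powR_mulrn. Qed.

Lemma powRX p (y : R) m : 0 <= y -> (y `^ p) ^+ m = (y ^+ m) `^ p.
Proof.
by move=> y0; rewrite -powR_mulrn ?powR_ge0 // -powRrM mulrC powRrM powR_mulrn.
Qed.

(** Meant for [T = 1 - |z|^2] and [t = r - |z|]: of the [n] factors [t], [n - k] turn the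
    coefficient [G k] into at most [A], and [k] stay with the derivative of order [k]. *)
Lemma weighted_ode p (n : nat) (a G : nat -> R) (b t T A : R) : 0 < p ->
  (forall k, 0 <= a k) -> (forall k, 0 <= G k) -> 0 <= b -> 0 <= A -> 0 <= t <= T ->
  a n <= b + \sum_(k < n) G k * a k ->
  (forall k, (k < n)%N -> G k * T ^+ (n - k) <= A) ->
  a n `^ p * t `^ (n%:R * p) <= 2 `^ p * (b `^ p * t `^ (n%:R * p) +
    A `^ p * \sum_(j < n) (2 `^ p) ^+ j.+1 *
      (a (n - j.+1)%N `^ p * t `^ ((n - j.+1)%:R * p))).
Proof.
move=> p0 a0 G0 b0 A0 /andP[t0 tT] h hG.
(* The order is reversed: [c 0] is the source term and [c j.+1] belongs to the derivative of order
   [n - j.+1]. The weights [2^j] of [sum_powR] then grow towards low orders, where the iterated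
   Hardy inequality pays for them. *)
pose c j := if j is j'.+1 then A * (a (n - j'.+1)%N * t ^+ (n - j'.+1)) else b * t ^+ n.
have c0 j : 0 <= c j by case: j => [|j]; rewrite /c !mulr_ge0 ?exprn_ge0.
rewrite powR_weight //.
apply: (@le_trans _ _ ((\sum_(j < n.+1) c j) `^ p)).
  apply: ler_powRl => //; first by rewrite mulr_ge0 ?exprn_ge0.
  apply: (@le_trans _ _ ((b + \sum_(k < n) G k * a k) * t ^+ n)).
    by rewrite ler_wpM2r ?exprn_ge0.
  rewrite big_ord_recl mulrDl lerD2l mulr_suml (reindex_inj rev_ord_inj) /=.
  apply: ler_sum => j _; rewrite add0n.
  set k := (n - j.+1)%N.
  have kn : (k < n)%N by rewrite /k ltn_subrL /= (leq_ltn_trans _ (ltn_ord j)).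
  have -> : t ^+ n = t ^+ (n - k) * t ^+ k by rewrite -exprD subnK // ltnW.
  rewrite (_ : _ * _ * _ = (G k * t ^+ (n - k)) * (a k * t ^+ k)); last by ring.
  rewrite ler_wpM2r ?mulr_ge0 ?exprn_ge0 //; apply: le_trans (hG k kn).
  by rewrite ler_wpM2l // lerXn2r ?nnegrE // (le_trans t0).
apply: (le_trans (sum_powR _ p0 c0)); rewrite ler_wpM2l ?powR_ge0 //.
rewrite big_ord_recl expr0 mul1r /= -powR_weight // lerD2l mulr_sumr.
apply: ler_sum => j _; rewrite add0n powRM ?exprn_ge0 //; last first.
  by rewrite !mulr_ge0 ?exprn_ge0.
rewrite powRM ?mulr_ge0 ?exprn_ge0 // powR_weight //.
by rewrite powRX // mulrCA.
Qed.

(** With [K = L ^ p] each term is a [p]-th power, and [n ^_ j.+1 >= (j.+1)!] removes the dependence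
    on [n]. In [4 * L] one factor 2 is the weight [2 ^ p], the other leaves the geometric ratio
    [x = 2 ^ (- p)]. *)
Lemma majorant_sum p K : 0 < p -> 0 < K -> exists2 Q, 0 < Q & forall n : nat,
  \sum_(j < n) (2 `^ p) ^+ j.+1 * (K ^+ j.+1 * (n ^_ j.+1)%:R `^ (- p)) <= Q.
Proof.
move=> p0 K0; pose L := K `^ p^-1; have L0 : 0 < L by exact: powR_gt0.
have LK : L `^ p = K by rewrite powR_rootK // ltW.
clearbody L.
have [E E0 HE] := @factorial_dominates R (4 * L) (mulr_ge0 (ler0n _ _) (ltW L0)).
pose x : R := 2^-1 `^ p.
have x01 : 0 <= x < 1.
  rewrite powR_ge0 /=; have := @gt0_ltr_powR R p p0 2^-1 1.
  rewrite !nnegrE powR1; apply=> //.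
  by rewrite invf_lt1 // ltr1n.
have x1 : 0 < 1 - x by move: x01; clear; lra.
exists (E `^ p * (1 - x)^-1); first by rewrite mulr_gt0 ?powR_gt0 ?invr_gt0.
move=> n; apply: (@le_trans _ _ (E `^ p * \sum_(j < n) x ^+ j.+1)); last first.
  by rewrite ler_wpM2l ?powR_ge0 ?geometric_bound.
rewrite mulr_sumr; apply: ler_sum => j _.
have f0 : 0 < ((j.+1)`!)%:R :> R by rewrite ltr0n fact_gt0.
have ff : ((j.+1)`!)%:R <= (n ^_ j.+1)%:R :> R.
  by rewrite ler_nat -bin_ffact leq_pmull // bin_gt0.
rewrite -LK /x !powRX ?(ltW L0) ?invr_ge0 // powRN.
have -> : ((n ^_ j.+1)%:R `^ p)^-1 = ((n ^_ j.+1)%:R^-1) `^ p :> R.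
  rewrite -powR_inv1 ?powR_ge0 // -powRrM mulrC powRrM powR_inv1 //.
have F0 : 0 < (n ^_ j.+1)%:R :> R by exact: lt_le_trans ff.
have iF : 0 <= (n ^_ j.+1)%:R^-1 :> R by rewrite invr_ge0 ltW.
have Lj : 0 <= L ^+ j.+1 by rewrite exprn_ge0 // ltW.
rewrite -!powRM ?mulr_ge0 ?exprn_ge0 ?(ltW E0) ?invr_ge0 ?(ltW L0) //.
apply: ler_powRl => //; first by apply: mulr_ge0; [exact: exprn_ge0|exact: mulr_ge0].
rewrite mulrA ler_pdivrMr // exprVn mulrAC ler_pdivlMr ?exprn_gt0 //.
rewrite (_ : _ * _ * _ = (4 * L) ^+ j.+1); last first.
  by rewrite mulrAC -!exprMn; congr (_ ^+ _); ring.
by apply: (le_trans (HE _)); rewrite ler_wpM2l // ltW.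
Qed.

End Core.

(** * The iterated Hardy inequality and the integrated equation *)

Section Solutions.
Context {R : realType}.
Local Notation C := R[i].
Local Notation nm := (cabs R).
Local Notation mu := (@lebesgue_measure R).
Local Notation mu2 := (mu \x mu)%E.
Implicit Types (r p A : R).

Lemma ge0_integral_affine_le d (T : measurableType d) (m : {measure set T -> \bar R})
    (D : set T) (n : nat) (u v : T -> R) (w : nat -> T -> R) (B b : R) (c : nat -> R) :
  measurable D -> 0 <= B -> 0 <= b -> (forall j, 0 <= c j) ->
  (forall z, D z -> 0 <= u z) -> (forall z, D z -> 0 <= v z) ->
  (forall j z, D z -> 0 <= w j z) ->
  measurable_fun D u -> measurable_fun D v -> (forall j, measurable_fun D (w j)) ->
  (forall z, D z -> u z <= B + (b * v z + \sum_(j < n) c j * w j z)) ->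
  (\int[m]_(z in D) (u z)%:E <= B%:E * m D + (b%:E * \int[m]_(z in D) (v z)%:E +
    \sum_(j < n) (c j)%:E * \int[m]_(z in D) (w j z)%:E))%E.
Proof.
move=> mD B0 b0 c0 u0 v0 w0 mu_ mv mw h.
have mbv : measurable_fun D (fun z => (b * v z)%:E).
  by apply/measurable_EFinP; apply: measurable_funM.
have mcw j : measurable_fun D (fun z => (c j * w j z)%:E).
  by apply/measurable_EFinP; apply: measurable_funM.
have ms : measurable_fun D (fun z => \sum_(j < n) (c j * w j z)%:E)%E.
  by apply: emeasurable_sum => j _; exact: mcw.
apply: (@le_trans _ _ (\int[m]_(z in D) (B%:E + ((b * v z)%:E + \sum_(j < n) (c j * w j z)%:E)))%E).
  apply: ge0_le_integral => //.
  - exact/measurable_EFinP.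
  - apply: emeasurable_funD; first exact: measurable_cst.
    exact: emeasurable_funD.
  - by move=> z Dz; rewrite sumEFin -!EFinD lee_fin h.
have bv0 z : D z -> (0 <= (b * v z)%:E)%E by move=> Dz; rewrite lee_fin mulr_ge0 ?v0.
have cw0 j z : D z -> (0 <= (c j * w j z)%:E)%E.
  by move=> Dz; rewrite lee_fin mulr_ge0 ?w0.
have s0 z : D z -> (0 <= \sum_(j < n) (c j * w j z)%:E)%E.
  by move=> Dz; apply: sume_ge0 => j _; exact: cw0.
rewrite ge0_integralD //; last 2 first.
- by move=> z Dz; rewrite adde_ge0 ?bv0 ?s0.
- exact: emeasurable_funD.
rewrite integral_cst // leeD2l // ge0_integralD // leeD //.
  rewrite -ge0_integralZl_EFin //.
  exact/measurable_EFinP.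
rewrite (@ge0_integral_sum _ _ R m D mD _ (fun (j : 'I_n) z => (c j * w j z)%:E)) //; last first.
  by move=> j z; exact: cw0.
apply: lee_sum => j _; rewrite -ge0_integralZl_EFin //.
- exact: w0.
- exact/measurable_EFinP.
Qed.

(** For [0 < r < 1] and analytic [f] the integral is finite, so [fine] loses nothing and the
    absorption can subtract real numbers. *)
Definition Yw (f : cfun R) p (k : nat) r : R := fine (Xw (cderiv R k f) p r (k%:R * p)).

Lemma Yw_ge0 f p k r : 0 <= Yw f p k r.
Proof. by rewrite fine_ge0 // Xw_ge0. Qed.

Lemma YwE f p k r : 0 < p -> analytic_on_disc R f -> 0 < r < 1 ->
  Xw (cderiv R k f) p r (k%:R * p) = (Yw f p k r)%:E.
Proof.
move=> p0 Hf /andP[r0 r1]; rewrite fineK // ge0_fin_numE ?Xw_ge0 //.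
by apply: (Xw_fin p0 (cderiv_deriv k Hf) r1); rewrite mulr_ge0 // ltW.
Qed.

(** Going from order [n - j] down to [n - j.+1] costs [K * (n - j)^(-p)], and these factors build
    the falling factorial. [K] depends on [p] alone; [M] may depend on [f], [n] and [j], but not on
    [r]. *)
Lemma hardy_chain p : 0 < p -> exists2 K, 0 < K &
  forall (f : cfun R) (n j : nat), analytic_on_disc R f -> (j <= n)%N ->
  exists2 M, 0 <= M & forall r, 0 < r < 1 ->
    Yw f p (n - j) r <= M + K ^+ j * (n ^_ j)%:R `^ (- p) * Yw f p n r.
Proof.
move=> p0; have [K K0 HK] := @hardy_step R p p0; exists K => // f n j Hf.
elim: j => [_|j IH jn].
  exists 0 => // r hr; rewrite subn0 ffactn0 powR1 expr0 !mul1r add0r.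
  exact: lexx.
have [M M0 HM] := IH (ltnW jn).
set k := (n - j.+1)%N; have kE : (n - j)%N = k.+1 by rewrite /k subnSK.
have If : (Ip (cderiv R k f) p (Dr (3/4)) \is a fin_num)%E.
  rewrite ge0_fin_numE ?Ip_ge0 // -(Xw_zero p0 (cderiv_deriv k Hf)); last by lra.
  by apply: (Xw_fin p0 (cderiv_deriv k Hf)); lra.
set I := fine (Ip (cderiv R k f) p (Dr (3/4))).
have I0 : 0 <= I by rewrite fine_ge0 ?Ip_ge0.
have q0 : 0 <= k.+1%:R `^ (- p) :> R by exact: powR_ge0.
exists (K * (I + k.+1%:R `^ (- p) * M)).
  by rewrite mulr_ge0 ?addr_ge0 ?mulr_ge0 // ltW.
move=> r hr; have := HK k _ _ _ (cderiv_deriv k Hf) hr.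
rewrite (YwE k p0 Hf hr) (YwE k.+1 p0 Hf hr) -(fineK If) -/I -[(_ * (Yw _ _ _ _)%:E)%E]EFinM -EFinD -EFinM lee_fin.
move=> h; apply: (le_trans h).
have {}HM := HM r hr; rewrite kE in HM.
apply: (@le_trans _ _ (K * (I + k.+1%:R `^ (- p) * (M + K ^+ j * (n ^_ j)%:R `^ (- p) * Yw f p n r)))).
  by rewrite ler_pM2l // lerD2l ler_wpM2l.
rewrite ffactnSr kE natrM powRM // exprS le_eqVlt; apply/orP; left; apply/eqP; ring.
Qed.

Lemma ode_integrated p A (n : nat) (F f : cfun R) (F1 : C -> C) (g : nat -> cfun R) (r0 CF : R) :
  0 < p -> 0 <= A -> r0 < 1 -> deriv_on_disc F F1 -> analytic_on_disc R f -> solves_lde R n g F f ->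
  (forall k z, (k < n)%N -> r0 < nm z -> nm z < 1 ->
    nm (g k z) * (1 - nm z ^+ 2) ^+ (n - k) <= A) ->
  (forall r, 0 < r < 1 -> (Xw F p r (n%:R * p) <= CF%:E)%E) ->
  exists2 M, 0 <= M & forall r, 0 < r < 1 -> Yw f p n r <=
    M + 2 `^ p * A `^ p * \sum_(j < n) (2 `^ p) ^+ j.+1 * Yw f p (n - j.+1) r.
Proof.
move=> p0 A0 r01 HF Hf lde hg hCF.
have [S S0 HS] := @bounded_closed_disc R _ r0 r01 (fun w : C => deriv_cont (z := w) (cderiv_deriv n Hf)).
have CF0 : 0 <= CF.
  have h2 : 0 < (2^-1 : R) < 1 by lra.
  by have := le_trans (Xw_ge0 _ _ _ _) (hCF _ h2); rewrite lee_fin.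
have f1 : (mu2 (@Dr R 1) \is a fin_num)%E by rewrite ge0_fin_numE // mu2_Dr.
set m1 := fine (mu2 (@Dr R 1)); have m10 : 0 <= m1 by rewrite fine_ge0.
exists (S `^ p * m1 + 2 `^ p * CF).
  by rewrite addr_ge0 // mulr_ge0 ?powR_ge0.
move=> r /andP[rp r1].
have mDr := @Dr_measurable R r.
pose c j := 2 `^ p * A `^ p * (2 `^ p) ^+ j.+1.
have := @ge0_integral_affine_le _ _ mu2 (Dr r) n
  (fun z => modulus (cderiv R n f) z `^ p * (r - nm (toC z)) `^ (n%:R * p))
  (fun z => modulus F z `^ p * (r - nm (toC z)) `^ (n%:R * p))
  (fun j z => modulus (cderiv R (n - j.+1) f) z `^ p * (r - nm (toC z)) `^ ((n - j.+1)%:R * p))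
  (S `^ p) (2 `^ p) c mDr (powR_ge0 _ _) (powR_ge0 _ _).
move=> Hint.
have {Hint} : (Xw (cderiv R n f) p r (n%:R * p) <= (S `^ p)%:E * mu2 (Dr r) +
    ((2 `^ p)%:E * Xw F p r (n%:R * p) +
    \sum_(j < n) (c j)%:E * Xw (cderiv R (n - j.+1) f) p r ((n - j.+1)%:R * p)))%E.
  apply: Hint => [j|z _|z _|j z _|||j|z hz].
  - by rewrite mulr_ge0 ?exprn_ge0 ?mulr_ge0 ?powR_ge0.
  - by rewrite mulr_ge0 ?powR_ge0.
  - by rewrite mulr_ge0 ?powR_ge0.
  - by rewrite mulr_ge0 ?powR_ge0.
  - exact: Xw_measurable (cderiv_deriv n Hf) (ltW r1).
  - exact: Xw_measurable HF (ltW r1).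
  - exact: Xw_measurable (cderiv_deriv _ Hf) (ltW r1).
  have t0 : 0 <= r - nm (toC z) by rewrite subr_ge0 ltW.
  have z1 : nm (toC z) < 1 by exact: lt_trans r1.
  have z0 := nm_ge0 (toC z).
  (* On the compact part [f^(n)] itself is bounded by [S] and the weight by 1; the equation is
     applied only beyond [r0], where the coefficients are controlled. *)
  have [zr0|r0z] := leP (nm (toC z)) r0.
    apply: (@le_trans _ _ (S `^ p * 1)); last first.
      rewrite mulr1 lerDl addr_ge0 ?mulr_ge0 ?powR_ge0 //.
      apply: sumr_ge0 => j _.
      by rewrite mulr_ge0 ?mulr_ge0 ?exprn_ge0 ?powR_ge0.
    apply: ler_pM; rewrite ?powR_ge0 //.
      by apply: ler_powRl; rewrite ?modulus_ge0 // HS.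
    rewrite powRrM powR_mulrn //; apply: (@le_trans _ _ (1 `^ p)); last by rewrite powR1.
    apply: ler_powRl; rewrite ?exprn_ge0 // exprn_ile1 //.
    by move: z0 r1; clear; lra.
  have zd : toC z \in disc R by rewrite in_disc.
  have Te : 0 <= r - nm (toC z) <= 1 - nm (toC z) ^+ 2.
    rewrite t0 andTb; have : nm (toC z) * nm (toC z) <= nm (toC z) by rewrite ler_piMl // ltW.
    by move: r1; rewrite expr2; clear; lra.
  have ode : nm (cderiv R n f (toC z)) <= nm (F (toC z)) +
      \sum_(k < n) nm (g k (toC z)) * nm (cderiv R k f (toC z)).
    have := lde _ zd; rewrite -/(toC z) => e.
    have -> : cderiv R n f (toC z) = F (toC z) - \sum_(k < n) g k (toC z) * cderiv R k f (toC z).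
      by rewrite -e addrK.
    apply: (le_trans (nmD _ _)); rewrite nmN lerD2l; apply: (le_trans (nm_sum _ _ _)).
    by apply: ler_sum => k _; rewrite nmM.
  have := weighted_ode p0 (fun k => nm_ge0 (cderiv R k f (toC z)))
    (fun k => nm_ge0 (g k (toC z))) (nm_ge0 (F (toC z))) A0 Te ode
    (fun k kn => hg k _ kn r0z z1).
  move=> h; apply: (le_trans h); rewrite mulrDr -[X in X <= _]add0r.
  apply: lerD; first exact: powR_ge0.
  rewrite lerD2l mulrA mulr_sumr; apply: ler_sum => j _.
  by rewrite /c !mulrA.
have hr : 0 < r < 1 by rewrite rp r1.
rewrite (YwE n p0 Hf hr).
have -> : (\sum_(j < n) (c j)%:E * Xw (cderiv R (n - j.+1) f) p r ((n - j.+1)%:R * p) =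
    (\sum_(j < n) c j * Yw f p (n - j.+1) r)%:E)%E.
  by rewrite -sumEFin; apply: eq_bigr => j _; rewrite (YwE _ p0 Hf hr) EFinM.
move=> h; rewrite -lee_fin; apply: (le_trans h).
rewrite -addrA !EFinD; apply: leeD.
  rewrite EFinM lee_wpmul2l ?lee_fin ?powR_ge0 // fineK //.
  by apply: le_measure; rewrite ?inE; [exact: Dr_measurable|exact: Dr_measurable|exact/Dr_sub/ltW].
apply: leeD.
  by rewrite EFinM lee_wpmul2l ?lee_fin ?powR_ge0 // hCF.
rewrite lee_fin mulr_sumr; apply: ler_sum => j _.
by rewrite /c mulrA.
Qed.
End Solutions.

(** * Absorption and passage to the unit disc *)

Section Main.
Context {R : realType}.
Local Notation C := R[i].
Local Notation nm := (cabs R).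
Local Notation mu := (@lebesgue_measure R).
Local Notation mu2 := (mu \x mu)%E.
Implicit Types (r p A : R).

(** The shift [i.+2] keeps all radii strictly between 0 and 1, where the weighted estimates are
    available. *)
Lemma Dr_exhaust : \bigcup_(i : nat) (@Dr R (1 - i.+2%:R^-1)) = Dr 1.
Proof.
apply/seteqP; split=> z; rewrite /Dr /=.
  by move=> [i _ /= h]; apply: (lt_le_trans h); rewrite gerBl invr_ge0.
move=> h; have h0 : 0 < 1 - nm (toC z) by rewrite subr_gt0.
exists (Num.bound (1 - nm (toC z))^-1) => //=.
rewrite ltrBrDl -ltrBrDr -[X in _ < X]invrK ltf_pV2 ?posrE ?invr_gt0 //.
apply: (@lt_trans _ _ (Num.bound (1 - nm (toC z))^-1)%:R); last by rewrite ltr_nat ltnW.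
by apply: archi_boundP; rewrite invr_ge0 ltW.
Qed.

Lemma Ip_exhaust (f g : C -> C) p (c : R) : deriv_on_disc f g ->
  (forall r, 0 < r < 1 -> (Ip f p (Dr r) <= c%:E)%E) -> (Ip f p (Dr 1) <= c%:E)%E.
Proof.
move=> H h.
have rho i : 0 < (1 - i.+2%:R^-1 : R) < 1.
  by rewrite subr_gt0 gtrBl invr_gt0 ltr0n andbT invf_lt1 ?ltr0n // ltr1n.
have L : Ip f p (Dr (1 - i.+2%:R^-1)) @[i --> \oo] --> Ip f p (Dr 1).
  rewrite -Dr_exhaust; apply: (@ge0_nondecreasing_set_cvg_integral _
    (measurableTypeR R * measurableTypeR R)%type R
    (fun i : nat => @Dr R (1 - i.+2%:R^-1)) (fun z => (modulus f z `^ p)%:E) mu2)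
    => [i j ij|i|i|i z _].
  - apply/subsetPset => z; rewrite /Dr /= => hz; apply: (lt_le_trans hz).
    by rewrite lerD2l lerN2 lef_pV2 ?posrE ?ltr0n // ler_nat !ltnS.
  - exact: Dr_measurable.
  - have /andP[_ /ltW ri] := rho i.
    by apply/measurable_EFinP; exact: deriv_powR_measurable H ri.
  - by rewrite lee_fin powR_ge0.
rewrite -(cvg_lim _ L) //; apply: lime_le; first by apply/cvg_ex; exists (Ip f p (Dr 1)).
by apply: nearW => i; exact: h.
Qed.

Lemma Lp_integral_fin (f : cfun R) p :
  (Lp_integral R p f < +oo)%E <-> (Ip f p (Dr 1) < +oo)%E.
Proof.
have pi0 : 0 < (pi^-1 : R) by rewrite invr_gt0 pi_gt0.
have -> : Lp_integral R p f = ((pi^-1)%:E * Ip f p (Dr 1))%E by [].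
have := Ip_ge0 f p (Dr 1); case: (Ip f p (Dr 1)) => [x| |] // _.
  by rewrite -EFinM !ltry.
by rewrite gt0_muley ?lte_fin.
Qed.

Lemma solution_bounded p : 0 < p -> exists2 A, 0 < A &
  forall (n : nat) (F f : cfun R) (g : nat -> cfun R) (r0 : R), r0 < 1 ->
  analytic_on_disc R F -> (Ip (Iter_op R n F) p (Dr 1) < +oo)%E ->
  (forall k z, (k < n)%N -> r0 < nm z -> nm z < 1 ->
    nm (g k z) * (1 - nm z ^+ 2) ^+ (n - k) <= A) ->
  analytic_on_disc R f -> solves_lde R n g F f ->
  (Ip f p (Dr 1) < +oo)%E.
Proof.
move=> p0; have [K K0 HK] := @hardy_chain R p p0.
have [Q Q0 HQ] := majorant_sum p0 K0.
have tp : 0 < 2 `^ p :> R by exact: powR_gt0.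
(* With [A ^ p = q] one gets [2 ^ p * A ^ p * Q = 1/2], so the sum over lower orders returns at most
   half of [Yw f p n r]; [q] depends on [p] only, through [Q]. *)
pose q := (2 * 2 `^ p * Q)^-1.
have q0 : 0 < q by rewrite invr_gt0 !mulr_gt0.
exists (q `^ p^-1); first exact: powR_gt0.
move=> n F f g r0 r01 HF hIF hg Hf lde.
have DF := analytic_deriv HF.
have [CF CF0 HCF] := Xw_Iter_op p0 DF hIF.
have [M M0 HM] := ode_integrated p0 (powR_ge0 _ _) r01 DF Hf lde hg HCF.
pose w j : R := (2 `^ p) ^+ j.+1.
pose c j := K ^+ j * (n ^_ j)%:R `^ (- p).
have w0 j : 0 <= w j by rewrite exprn_ge0 // ltW.
have chain i : (i <= n)%N -> exists2 M', 0 <= M' & forall r, 0 < r < 1 ->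
    \sum_(j < i) w j * Yw f p (n - j.+1) r <=
    M' + (\sum_(j < i) w j * c j.+1) * Yw f p n r.
  elim: i => [_|i IH lin].
    by exists 0 => // r _; rewrite !big_ord0 mul0r addr0.
  have [M1 M10 HM1] := IH (ltnW lin).
  have [M2 M20 HM2] := HK f n i.+1 Hf lin.
  exists (M1 + w i * M2); first by rewrite addr_ge0 ?mulr_ge0.
  move=> r hr; rewrite !big_ord_recr /=.
  apply: le_trans (lerD (HM1 r hr) (ler_wpM2l (w0 i) (HM2 r hr))) _.
  by rewrite le_eqVlt /c; apply/orP; left; apply/eqP; ring.
have [M1 M10 HM1] := chain n (leqnn n).
have [M2 M20 HM2] := HK f n n Hf (leqnn n).
have qE : 2 `^ p * (q `^ p^-1) `^ p * Q = 2^-1.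
  rewrite powR_rootK ?(ltW q0) // /q; field.
  by rewrite !gt_eqF.
have d0 : 0 <= 2 `^ p * (q `^ p^-1) `^ p by rewrite mulr_ge0 ?powR_ge0.
set d := 2 `^ p * (q `^ p^-1) `^ p in HM qE d0.
have Yn r : 0 < r < 1 -> Yw f p n r <= 2 * (M + d * M1).
  move=> hr; have h1 := HM r hr; have h2 := HM1 r hr.
  have Y0 := Yw_ge0 f p n r.
  have h3 : \sum_(j < n) w j * Yw f p (n - j.+1) r <= M1 + Q * Yw f p n r.
    by apply: (le_trans h2); rewrite lerD2l ler_wpM2r // HQ.
  have := ler_wpM2l d0 h3; rewrite mulrDr mulrA qE.
  by move: h1; rewrite -/w; clear; lra.
(* The bound on order [n] is uniform in [r]; [hardy_chain] with [j = n] brings it down to order 0,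
   where the weight is 1, and monotone convergence lets [r] tend to 1. *)
apply: (@le_lt_trans _ _ (M2 + c n * (2 * (M + d * M1)))%:E); last exact: ltry.
apply: (Ip_exhaust (analytic_deriv Hf)) => r hr.
have /andP[_ r1] := hr.
rewrite -(Xw_zero p0 (analytic_deriv Hf) (ltW r1)).
have := YwE 0 p0 Hf hr; rewrite mul0r => ->; rewrite lee_fin.
have := HM2 r hr; rewrite subnn => h; apply: (le_trans h); rewrite lerD2l.
by rewrite ler_wpM2l ?Yn // mulr_ge0 ?powR_ge0 ?exprn_ge0 // ltW.
Qed.

End Main.

Theorem theorem1p7 (R : realType) (p : R) (hp : 0 < p) :
  (exists A : R, 0 < A /\
    forall (n : nat) (F : cfun R) (g : nat -> cfun R),
      (0 < n)%N ->
      analytic_on_disc R F ->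
      Bergman R p (Iter_op R n F) ->
      (forall k : nat, (k < n)%N -> B0 R (n - k)%:R (g k)) ->
      (forall k : nat, (k < n)%N -> (bnorm R (n - k)%:R (g k) < A%:E)%E) ->
      forall f : cfun R, analytic_on_disc R f -> solves_lde R n g F f ->
        Bergman R p f)
  /\
  (forall (n : nat) (F : cfun R) (g : nat -> cfun R),
      (0 < n)%N ->
      analytic_on_disc R F ->
      Bergman R p (Iter_op R n F) ->
      (forall k : nat, (k < n)%N -> B0_little R (n - k)%:R (g k)) ->
      forall f : cfun R, analytic_on_disc R f -> solves_lde R n g F f ->
        Bergman R p f).
Proof.
have [A A0 HA] := @solution_bounded R p hp.
have w0 (z : R[i]) : cabs R z < 1 -> 0 <= 1 - cabs R z ^+ 2.
  by move=> z1; rewrite subr_ge0 exprn_ile1 ?nm_ge0 // ltW.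
split.
- exists A; split=> [//|n F g n0 HF [_ /Lp_integral_fin hF] _ hg f Hf lde].
  split; [exact: Hf|apply/Lp_integral_fin].
  (* Any negative radius makes the region [r0 < |z| < 1] the whole disc, on which the norm bound
     holds. *)
  apply: (HA n F f g (-1)) => // k z kn _ z1.
  rewrite -(powR_mulrn (n - k) (w0 z z1)) -lee_fin.
  apply: (le_trans _ (ltW (hg k kn))); apply: ereal_sup_ubound.
  by exists z.
- move=> n F g n0 HF [_ /Lp_integral_fin hF] hg f Hf lde.
  split; [exact: Hf|apply/Lp_integral_fin].
  have [r0 r01 Hr0] : exists2 r0 : R, r0 < 1 & forall k z, (k < n)%N ->
      r0 < cabs R z -> cabs R z < 1 ->
      cabs R (g k z) * (1 - cabs R z ^+ 2) `^ (n - k)%:R <= A.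
    (* Each coefficient has its own radius beyond which it is at most [A]; the induction takes the
       maximum of these finitely many radii. *)
    suff main i : (i <= n)%N -> exists2 r0 : R, r0 < 1 & forall k z, (k < i)%N ->
        r0 < cabs R z -> cabs R z < 1 ->
        cabs R (g k z) * (1 - cabs R z ^+ 2) `^ (n - k)%:R <= A by exact: main.
    elim: i => [_|i IH lin]; first by exists 0.
    have [r0 r01 H0] := IH (ltnW lin); have [_ /(_ A A0)[r1 [r11 H1]]] := hg i lin.
    exists (Num.max r0 r1); first by rewrite gt_max r01.
    move=> k z; rewrite ltnS leq_eqVlt gt_max => /orP[/eqP ->|ki] /andP[h0 h1] z1.
      by apply: ltW; exact: H1.
    exact: H0.
  apply: (HA n F f g r0) => // k z kn h z1.
  by rewrite -(powR_mulrn (n - k) (w0 z z1)) Hr0.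
Qed.
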